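(* The formal Poisson homology groups $H_k=H_k(\mathbb{R}^4,\pi)=\ker(\delta_\pi:\Omega^k_f\to\Omega^{k-1}_f)/\delta_\pi(\Omega^{k+1}_f)$ are described as follows. (0) Every class in $H_0$ has a unique representative of the form $p+\sum_{i=1}^4 a_ix_i$ with $p\in\mathbb{R}[[f_1,f_2]]$ and $a_i\in\mathbb{R}[[x_2^2,x_4]]$. (1) Every class in $H_1$ has a unique representative of the form $$\sum_{j=1}^2\big(p_j\zeta_j+q_j\,df_j\big)+\sum_{i=1}^4\big(d(a_ix_i)+b_ix_i\,df_1\big)$$ with $p_j,q_j\in\mathbb{R}[[f_1,f_2]]$ and $a_i,b_i\in\mathbb{R}[[x_2^2,x_4]]$. (2) Every class in $H_2$ has a unique representative of the form $$p\,\zeta_1\wedge\zeta_2+q\,df_1\wedge df_2+\sum_{i=1}^2\big(p_i\,d(f_1\zeta_i)+q_i\,d\zeta_i\big)+\sum_{i=1}^4 d(a_ix_i)\wedge df_1$$ with $p,p_i,q,q_i\in\mathbb{R}[[f_1,f_2]]$ and $a_i\in\mathbb{R}[[x_2^2,x_4]]$. (3) Every class in $H_3$ has a unique representative of the form $$\sum_{i=1}^2\big(p_i\,\zeta_2\wedge d\zeta_i+q_i\,df_1\wedge d\zeta_i\big)$$ with $p_i,q_i\in\mathbb{R}[[f_1,f_2]]$. (4) $H_4=\mathbb{R}[[f_1,f_2]]\,\mu$. In each case the displayed forms are cycles for $\delta_\pi$.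
   Context: Let $x_1,\dots,x_4$ be the coordinates on $\mathbb{R}^4$, $\mu=dx_1\wedge dx_2\wedge dx_3\wedge dx_4$, and $f_1=x_1^2-x_2^2+x_3^2-x_4^2$, $f_2=2(x_1x_2+x_3x_4)$. Let $\mathcal{R}=\mathbb{R}[[x_1,x_2,x_3,x_4]]$ and $\Omega^k_f=\mathcal{R}\otimes\wedge^k(\mathbb{R}^4)^*$ (formal differential $k$-forms), with de Rham differential $d$. $\mathbb{R}[[f_1,f_2]]\subset\mathcal{R}$ denotes the subring of power series in $f_1,f_2$. The Poisson bivector $\pi$ on $\mathbb{R}^4$ is determined by $\pi(dg,dh)\,\mu=dg\wedge dh\wedge df_1\wedge df_2$ for all functions $g,h$. Contraction is $\iota_{X_1\wedge\dots\wedge X_k}=\iota_{X_k}\cdots\iota_{X_1}$, so $\iota_\pi\mu=df_1\wedge df_2$. The Poisson homology differential is $\delta_\pi=\iota_\pi\circ d-d\circ\iota_\pi:\Omega^k_f\to\Omega^{k-1}_f$, which satisfies $\delta_\pi^2=0$. $\zeta_1=\tfrac12(-x_3dx_1+x_4dx_2+x_1dx_3-x_2dx_4)$ and $\zeta_2=\tfrac12(-x_4dx_1-x_3dx_2+x_2dx_3+x_1dx_4)$. *)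

(* Defs.v *)
From HB Require Import structures.
From mathcomp Require Import all_boot all_order all_algebra.
From mathcomp Require Import boolp reals.
From mathcomp Require Import mpoly zify.

Set Implicit Arguments.
Unset Strict Implicit.
Unset Printing Implicit Defensive.

Import GRing.Theory.

Local Open Scope ring_scope.

(** * Formal power series in [n] variables *)

(* A record rather than a bare function type, so that the pointwise product on
   functions is never picked up in place of the Cauchy product. *)
Record fps (n : nat) (R : Type) := Fps { fcoef : 'X_{1..n} -> R }.

Notation "'{fps' R [ n ] }" := (fps n R) (at level 0, format "'{fps'  R [ n ] }").

Lemma fpsP (n : nat) (R : Type) (f g : {fps R[n]}) :
  (forall m, fcoef f m = fcoef g m) -> f = g.
Proof. by case: f g => [f] [g] /= fg; congr Fps; apply/funext. Qed.

HB.instance Definition _ n R := gen_eqMixin {fps R[n]}.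
HB.instance Definition _ n R := gen_choiceMixin {fps R[n]}.

Section FpsRing.
Variables (n : nat) (R : comNzRingType).
Implicit Types (f g h : {fps R[n]}) (m : 'X_{1..n}).

Definition fps_zero : {fps R[n]} := Fps (fun=> 0).
Definition fps_add f g := Fps (fun m => fcoef f m + fcoef g m).
Definition fps_opp f := Fps (fun m => - fcoef f m).

Lemma fps_addA : associative fps_add.
Proof. by move=> f g h; apply: fpsP => m /=; rewrite addrA. Qed.
Lemma fps_addC : commutative fps_add.
Proof. by move=> f g; apply: fpsP => m /=; rewrite addrC. Qed.
Lemma fps_add0 : left_id fps_zero fps_add.
Proof. by move=> f; apply: fpsP => m /=; rewrite add0r. Qed.
Lemma fps_addN : left_inverse fps_zero fps_opp fps_add.
Proof. by move=> f; apply: fpsP => m /=; rewrite addNr. Qed.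

HB.instance Definition _ :=
  GRing.isZmodule.Build {fps R[n]} fps_addA fps_addC fps_add0 fps_addN.

Definition fpsC (c : R) : {fps R[n]} :=
  Fps (fun m => if m == 0%MM then c else 0).

Definition fps_mul f g : {fps R[n]} :=
  Fps (fun m => \sum_(k : 'X_{1..n < (mdeg m).+1, (mdeg m).+1}
                      | m == (k.1 + k.2)%MM) fcoef f k.1 * fcoef g k.2).

Definition fps_trunc (b : nat) f : {mpoly R[n]} :=
  \sum_(k : 'X_{1..n < b}) fcoef f k *: 'X_[k].

Lemma mcoeff_trunc b f m : (mdeg m < b)%N -> (fps_trunc b f)@_m = fcoef f m.
Proof.
move=> lt_mb; rewrite /fps_trunc raddf_sum /= (bigD1 (BMultinom lt_mb)) //=.
rewrite mcoeffZ mcoeffX eqxx mulr1 big1 ?addr0 // => k /eqP neq_k.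
rewrite mcoeffZ mcoeffX; case: eqP => [eq_k|_]; last by rewrite mulr0.
by case: neq_k; apply/val_inj.
Qed.

Lemma mcoeffM_local (p p' q q' : {mpoly R[n]}) m :
    (forall k, (mdeg k <= mdeg m)%N -> p@_k = p'@_k) ->
    (forall k, (mdeg k <= mdeg m)%N -> q@_k = q'@_k) ->
  (p * q)@_m = (p' * q')@_m.
Proof.
move=> eq_p eq_q; rewrite !mcoeffM; apply: eq_bigr => -[k1 k2] /= _.
by rewrite eq_p ?eq_q // -ltnS bmdeg.
Qed.

Lemma fcoefM_trunc f g m b : (mdeg m < b)%N ->
  fcoef (fps_mul f g) m = (fps_trunc b f * fps_trunc b g)@_m.
Proof.
move=> lt_mb; rewrite mcoeffM; apply: eq_bigr => -[k1 k2] /= _.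
by rewrite !mcoeff_trunc // (leq_trans (bmdeg _)).
Qed.

Lemma fps_mulA : associative fps_mul.
Proof.
move=> f g h; apply: fpsP => m; rewrite !(fcoefM_trunc _ _ (ltnSn _)).
set b := (mdeg m).+1.
have trM u v k : (mdeg k <= mdeg m)%N ->
    (fps_trunc b (fps_mul u v))@_k = (fps_trunc b u * fps_trunc b v)@_k.
  by move=> le_k; rewrite mcoeff_trunc // (@fcoefM_trunc _ _ _ b).
rewrite (@mcoeffM_local _ (fps_trunc b f) _ (fps_trunc b g * fps_trunc b h)) //.
  rewrite [RHS](@mcoeffM_local _ (fps_trunc b f * fps_trunc b g)
                               _ (fps_trunc b h)) ?mulrA //.
  by move=> k /trM.
by move=> k /trM.
Qed.

Lemma fps_mulC : commutative fps_mul.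
Proof.
by move=> f g; apply: fpsP => m; rewrite !(fcoefM_trunc _ _ (ltnSn _)) mulrC.
Qed.

Lemma fps_mul1 : left_id (fpsC 1) fps_mul.
Proof.
move=> f; apply: fpsP => m; rewrite (fcoefM_trunc _ _ (ltnSn _)).
rewrite (@mcoeffM_local _ 1 _ (fps_trunc (mdeg m).+1 f)) //.
  by rewrite mul1r mcoeff_trunc.
by move=> k le_k; rewrite mcoeff_trunc // mcoeff1 /=; case: eqP.
Qed.

Lemma fps_mulDl : left_distributive fps_mul fps_add.
Proof.
move=> f g h; apply: fpsP => m /=; rewrite -big_split /=.
by apply: eq_bigr => k _; rewrite mulrDl.
Qed.

Lemma fps_oner_neq0 : fpsC 1 != 0.
Proof.
apply/eqP => /(congr1 (fun f => fcoef f 0%MM)) /=; rewrite eqxx.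
by apply/eqP/oner_neq0.
Qed.

HB.instance Definition _ := GRing.Zmodule_isComNzRing.Build {fps R[n]}
  fps_mulA fps_mulC fps_mul1 fps_mulDl fps_oner_neq0.

Definition fpsX (i : 'I_n) : {fps R[n]} :=
  Fps (fun m => if m == U_(i)%MM then 1 else 0).

Definition fps_deriv (i : 'I_n) f : {fps R[n]} :=
  Fps (fun m => fcoef f (m + U_(i))%MM *+ (m i).+1).

End FpsRing.

(* The substitution [P(g_1, .., g_k)] of series [g_i] without constant term:
   [g ^ e] then has order at least [mdeg e], so only the exponents [e] with
   [mdeg e <= mdeg m] contribute to the coefficient of [m]. *)
Definition fps_subst (k n : nat) (R : comNzRingType)
    (P : {fps R[k]}) (g : 'I_k -> {fps R[n]}) : {fps R[n]} :=
  Fps (fun m => \sum_(e : 'X_{1..k < (mdeg m).+1})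
                   fcoef P e * fcoef (\prod_(i < k) g i ^+ e i) m).

(* The subring R[[g_1, g_2]]; only meaningful for series without constant
   term. *)
Definition in_series2 (n : nat) (R : comNzRingType)
    (g1 g2 p : {fps R[n]}) : Prop :=
  exists P : {fps R[2]}, p = fps_subst P (fun i => if i == ord0 then g1 else g2).

(** * Formal differential forms *)

(* The component of [w] at [I = {i_1 < .. < i_k}] is the coefficient of
   dx_{i_1} /\ .. /\ dx_{i_k}.  The exponent [^o] makes [*:] the multiplication
   of a form by a power series. *)
Definition dform (n : nat) (R : comNzRingType) : Type :=
  {ffun {set 'I_n} -> {fps R[n]}^o}.

Section Forms.
Variables (n : nat) (R : comNzRingType).
Implicit Types (p : {fps R[n]}) (w v : dform n R) (I J K : {set 'I_n}).

Definition is_form (k : nat) w : Prop := forall I, #|I| != k -> w I = 0.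

Definition form_basis I : dform n R := [ffun J => (I == J)%:R].

Definition form0 p : dform n R := p *: form_basis set0.
Definition dx (i : 'I_n) : dform n R := form_basis [set i].
Definition vol : dform n R := form_basis setT.

Definition inversions I J : nat := #|[set ij in setX I J | (ij.2 < ij.1)%N]|.

Definition wedge w v : dform n R :=
  [ffun K : {set 'I_n} => \sum_(I : {set 'I_n} | I \subset K)
               (-1) ^+ inversions I (K :\: I) * (w I * v (K :\: I))].

Definition form_deriv (i : 'I_n) w : dform n R :=
  [ffun I => fps_deriv i (w I)].

Definition dR w : dform n R := \sum_i wedge (dx i) (form_deriv i w).

Definition contract (i : 'I_n) w : dform n R :=
  [ffun J : {set 'I_n} => if i \in J then 0
            else (-1) ^+ #|[set j in J | (j < i)%N]| * w (i |: J)].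

(* Contraction with the bivector \sum_(i < j) B i j d/dx_i /\ d/dx_j, with the
   convention i_{X /\ Y} = i_Y i_X. *)
Definition contract2 (B : 'I_n -> 'I_n -> {fps R[n]}) w : dform n R :=
  \sum_(i < n) \sum_(j < n | (i < j)%N) B i j *: contract j (contract i w).

End Forms.

Notation "w ∧ v" := (wedge w v) (at level 38, right associativity) : ring_scope.

Section FormTheory.
Variables (n : nat) (R : comNzRingType).
Implicit Types (p : {fps R[n]}) (w v : dform n R) (I J K : {set 'I_n}).

Lemma dformZE p w I : (p *: w) I = p * w I.
Proof. by rewrite ffunE. Qed.

Lemma wedge_suml (T : Type) (r : seq T) (P : pred T)
    (c : T -> {fps R[n]}) (F : T -> dform n R) v :
  (\sum_(t <- r | P t) c t *: F t) ∧ v = \sum_(t <- r | P t) c t *: (F t ∧ v).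
Proof.
apply/ffunP => K; rewrite ffunE !sum_ffunE.
under [RHS]eq_bigr do rewrite dformZE ffunE mulr_sumr.
rewrite [RHS]exchange_big /=; apply: eq_bigr => I _.
rewrite sum_ffunE mulr_suml mulr_sumr; apply: eq_bigr => t _.
by rewrite dformZE -mulrA mulrCA.
Qed.

Lemma wedge_sumr (T : Type) (r : seq T) (P : pred T)
    (c : T -> {fps R[n]}) (F : T -> dform n R) w :
  w ∧ (\sum_(t <- r | P t) c t *: F t) = \sum_(t <- r | P t) c t *: (w ∧ F t).
Proof.
apply/ffunP => K; rewrite ffunE !sum_ffunE.
under [RHS]eq_bigr do rewrite dformZE ffunE mulr_sumr.
rewrite [RHS]exchange_big /=; apply: eq_bigr => I _.
rewrite sum_ffunE !mulr_sumr; apply: eq_bigr => t _.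
by rewrite dformZE [w I * _]mulrCA [LHS]mulrCA.
Qed.

Lemma is_form_wedge k l w v :
  is_form k w -> is_form l v -> is_form (k + l) (w ∧ v).
Proof.
move=> w_k v_l K card_K; rewrite ffunE big1 // => I sIK.
have [/eqP card_I|/w_k->] := boolP (#|I| == k); last by rewrite mul0r mulr0.
rewrite v_l ?mulr0 // cardsD (setIidPr sIK) card_I.
apply: contraNneq card_K => <-.
by rewrite subnKC // -card_I subset_leq_card.
Qed.

Lemma dx_is_form (i : 'I_n) : is_form 1 (dx R i).
Proof.
move=> I card_I; rewrite ffunE; case: eqP => // eq_I.
by rewrite -eq_I cards1 in card_I.
Qed.

Lemma wedge_dxE i w K :
  (dx R i ∧ w) K =
    if i \in K then (-1) ^+ #|[set j in K :\ i | (j < i)%N]| * w (K :\ i) else 0.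
Proof.
rewrite ffunE; case: ifP => iK.
  rewrite (bigD1 [set i]) ?sub1set //= ffunE eqxx mul1r big1 ?addr0.
    congr (_ ^+ _ * _); rewrite /inversions.
    have inj : injective (fun j : 'I_n => (i, j)) by move=> ? ? [].
    rewrite -(card_imset _ inj); congr #|pred_of_set _|.
    apply/setP => -[a b]; rewrite !inE /=; apply/idP/imsetP.
      case/andP=> /and3P[/eqP-> ? ?] ?; exists b; rewrite ?inE //.
      by apply/andP; split=> //; apply/andP.
    by case=> j; rewrite !inE => ? [-> ->]; rewrite eqxx.
  move=> I /andP[_ neqI]; rewrite ffunE eq_sym (negbTE neqI).
  by rewrite mul0r mulr0.
rewrite big1 // => I sIK; rewrite ffunE; case: eqP => [eqI|_].
  by rewrite -eqI sub1set iK in sIK.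
by rewrite mul0r mulr0.
Qed.

Lemma dR0E p : dR (form0 p) = \sum_i fps_deriv i p *: dx R i.
Proof.
apply: eq_bigr => i _; apply/ffunP => K.
rewrite wedge_dxE dformZE [form_deriv _ _ _]ffunE [dx _ _ _]ffunE.
have derivE I : fps_deriv i (form0 p I) = fps_deriv i p * (set0 == I)%:R.
  rewrite dformZE ffunE; case: eqP => _; first by rewrite !mulr1.
  by rewrite !mulr0; apply: fpsP => m /=; rewrite mul0rn.
rewrite derivE; case: ifP => iK.
  have -> : (set0 == K :\ i) = ([set i] == K).
    apply/eqP/eqP => [K0|<-]; last by rewrite setDv.
    by rewrite -(setD1K iK) -K0 setU0.
  have [<-|_] := eqVneq [set i] K; last by rewrite !mulr0.
  rewrite setDv (_ : [set j in set0 | _] = set0) ?cards0 ?mul1r //.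
  by apply/setP => j; rewrite !inE.
case: eqP => [eqK|_]; last by rewrite !mulr0.
by rewrite -eqK set11 in iK.
Qed.

Lemma dR0_is_form p : is_form 1 (dR (form0 p)).
Proof.
move=> I card_I; rewrite dR0E sum_ffunE big1 // => i _.
by rewrite dformZE dx_is_form ?mulr0.
Qed.

Lemma wedge_dR0 p w : dR (form0 p) ∧ w = \sum_i fps_deriv i p *: (dx R i ∧ w).
Proof. by rewrite dR0E wedge_suml. Qed.

Lemma top_form w : is_form n w -> w = w setT *: vol n R.
Proof.
move=> w_n; apply/ffunP => I; rewrite dformZE ffunE.
have [<-|neqI] := eqVneq setT I; first by rewrite mulr1.
rewrite mulr0 w_n //; apply: contraNneq neqI => cardI.
by rewrite eq_sym eqEcard subsetT cardsT card_ord cardI /=.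
Qed.

End FormTheory.

(** * The Poisson structure *)

Section Poisson.
Variable R : realType.

Definition x (i : 'I_4) : {fps R[4]} := fpsX R i.
Definition x1 := x (inord 0).
Definition x2 := x (inord 1).
Definition x3 := x (inord 2).
Definition x4 := x (inord 3).

Definition dx1 : dform 4 R := dx R (inord 0).
Definition dx2 : dform 4 R := dx R (inord 1).
Definition dx3 : dform 4 R := dx R (inord 2).
Definition dx4 : dform 4 R := dx R (inord 3).

Definition mu : dform 4 R := dx1 ∧ dx2 ∧ dx3 ∧ dx4.

Definition f1 : {fps R[4]} := x1 ^+ 2 - x2 ^+ 2 + x3 ^+ 2 - x4 ^+ 2.
Definition f2 : {fps R[4]} := 2%:R * (x1 * x2 + x3 * x4).

Definition df1 : dform 4 R := dR (form0 f1).
Definition df2 : dform 4 R := dR (form0 f2).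
Definition df (j : 'I_2) : dform 4 R := if j == ord0 then df1 else df2.

(* The component pi(dx_i, dx_j) of the Poisson bivector; [poissonP] is its
   defining property, and [contract2_mu] is i_pi mu = df_1 /\ df_2. *)
Definition poisson (i j : 'I_4) : {fps R[4]} :=
  (dx R i ∧ dx R j ∧ df1 ∧ df2) setT.

Definition half : {fps R[4]} := fpsC 4 2^-1.

Definition zeta1 : dform 4 R :=
  half *: (- x3 *: dx1 + x4 *: dx2 + x1 *: dx3 - x2 *: dx4).
Definition zeta2 : dform 4 R :=
  half *: (- x4 *: dx1 - x3 *: dx2 + x2 *: dx3 + x1 *: dx4).
Definition zeta (j : 'I_2) : dform 4 R := if j == ord0 then zeta1 else zeta2.

Definition delta (w : dform 4 R) : dform 4 R :=
  contract2 poisson (dR w) - dR (contract2 poisson w).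

Definition is_cycle (k : nat) (w : dform 4 R) : Prop :=
  is_form k w /\ delta w = 0.

Definition is_boundary (k : nat) (w : dform 4 R) : Prop :=
  exists2 v, is_form k.+1 v & w = delta v.

(* The elements of H_k, as cosets of the boundaries in the cycles. *)
Definition homology_class (k : nat) (C : dform 4 R -> Prop) : Prop :=
  exists2 w, is_cycle k w & C = (fun v => is_boundary k (v - w)).

(* The forms [nf t], for admissible coefficients [t], are cycles, and every
   class of H_k contains [nf t] for exactly one admissible [t]. *)
Definition unique_representatives (k : nat) (T : Type)
    (adm : T -> Prop) (nf : T -> dform 4 R) : Prop :=
  (forall t, adm t -> is_cycle k (nf t)) /\
  (forall C, homology_class k C -> exists! t, adm t /\ C (nf t)).

Definition in_Rf (p : {fps R[4]}) : Prop := in_series2 f1 f2 p.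
Definition in_Rx (a : {fps R[4]}) : Prop := in_series2 (x2 ^+ 2) x4 a.

End Poisson.

Arguments mu {R}.
Arguments x {R} i.
Arguments f1 {R}.
Arguments f2 {R}.
Arguments df1 {R}.
Arguments df2 {R}.
Arguments df {R} j.
Arguments zeta1 {R}.
Arguments zeta2 {R}.
Arguments zeta {R} j.

Section PoissonTheory.
Variable R : realType.

Lemma muE : mu = vol 4 R.
Proof.
have mu4 : is_form 4 (mu : dform 4 R).
  by do 3!apply: (@is_form_wedge _ _ 1 _ _ _ (@dx_is_form _ _ _));
    apply: dx_is_form.
have ordE k : (k < 4)%N -> inord k = k :> nat := fun lt_k => @inordK 3 k lt_k.
have low (i : 'I_4) (w : dform 4 R) (K : {set 'I_4}) :
    i \in K -> (forall j, j \in K -> (i <= j)%N) -> (dx R i ∧ w) K = w (K :\ i).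
  move=> iK le_i; rewrite wedge_dxE iK.
  rewrite (_ : [set j in _ | _] = set0) ?cards0 ?mul1r //.
  apply/setP => j; rewrite !inE; apply/negbTE/negP => /andP[/andP[_ /le_i]].
  by rewrite leqNgt => /negbTE->.
have mem0 : inord 0 \in [set: 'I_4] by rewrite inE.
have mem1 : inord 1 \in [set: 'I_4] :\ inord 0.
  by rewrite !inE -!val_eqE /= !ordE.
have mem2 : inord 2 \in [set: 'I_4] :\ inord 0 :\ inord 1.
  by rewrite !inE -!val_eqE /= !ordE.
have le0 j : j \in [set: 'I_4] -> ((inord 0 : 'I_4) <= j)%N by rewrite ordE.
have le1 j : j \in [set: 'I_4] :\ inord 0 -> ((inord 1 : 'I_4) <= j)%N.
  by rewrite !inE -!val_eqE /= !ordE //; lia.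
have le2 j : j \in [set: 'I_4] :\ inord 0 :\ inord 1 ->
    ((inord 2 : 'I_4) <= j)%N.
  by rewrite !inE -!val_eqE /= !ordE //; lia.
rewrite (top_form mu4) /mu (low _ _ _ mem0 le0) (low _ _ _ mem1 le1).
rewrite (low _ _ _ mem2 le2).
suff KE : [set inord 3] = [set: 'I_4] :\ inord 0 :\ inord 1 :\ inord 2.
  by rewrite ffunE KE eqxx scale1r.
apply/setP => i; rewrite !inE -!val_eqE /= !ordE //.
by case: i => -[|[|[|[|]]]].
Qed.

Lemma df_is_form : is_form 2 ((df1 : dform 4 R) ∧ df2).
Proof. by apply: (@is_form_wedge _ _ 1 1); apply: dR0_is_form. Qed.

Lemma poissonP (g h : {fps R[4]}) :
  (\sum_i \sum_j poisson R i j * (fps_deriv i g * fps_deriv j h)) *: mu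
    = dR (form0 g) ∧ dR (form0 h) ∧ df1 ∧ df2.
Proof.
have top i j : is_form 4 (dx R i ∧ dx R j ∧ df1 ∧ df2).
  by do 2!apply: (@is_form_wedge _ _ 1 _ _ _ (@dx_is_form _ _ _));
    apply: df_is_form.
rewrite wedge_dR0 scaler_suml; apply: eq_bigr => i _.
rewrite wedge_dR0 wedge_sumr scaler_suml scaler_sumr; apply: eq_bigr => j _.
by rewrite (top_form (top i j)) -muE !scalerA mulrC.
Qed.

Lemma contract2_vol (n : nat) (T : comNzRingType) (w : dform n T) :
  is_form 2 w -> n = 4 ->
  contract2 (fun i j => (dx T i ∧ dx T j ∧ w) setT) (vol n T) = w.
Proof.
move=> w2 n4; apply/ffunP => K; rewrite /contract2 sum_ffunE.
have sgn2 k : (-1) ^+ k * (-1) ^+ k = 1 :> {fps T[n]}.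
  by rewrite -expr2 sqrr_sign.
have term (i j : 'I_n) : (i < j)%N ->
  ((dx T i ∧ dx T j ∧ w) setT *: contract j (contract i (vol n T))) K
    = if ~: K == [set i; j] then w K else 0.
  move=> lt_ij; rewrite dformZE !wedge_dxE !inE /= andbT.
  have neq_ji : j != i by rewrite neq_ltn lt_ij orbT.
  rewrite neq_ji ffunE.
  have [jK|jK] := boolP (j \in K).
    rewrite mulr0; case: eqP => // /setP/(_ j); by rewrite !inE jK eqxx orbT.
  rewrite ffunE !inE eq_sym (negbTE neq_ji) /=.
  have [iK|iK] := boolP (i \in K).
    rewrite !mulr0; case: eqP => // /setP/(_ i); by rewrite !inE iK eqxx.
  rewrite ffunE; have [TE|neqT] := eqVneq setT (i |: (j |: K)); last first.
    rewrite !mulr0; case: eqP => // KE; case/eqP: neqT.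
    by rewrite setUA -KE setUC setUCr.
  have KE : setT :\ i :\ j = K.
    apply/setP => k; move/setP/(_ k): TE; rewrite !inE.
    by have [->|_] := eqVneq k j; rewrite ?(negbTE jK) //=;
       have [->|_] := eqVneq k i; rewrite ?(negbTE iK).
  have -> : ~: K = [set i; j].
    by apply/setP => k; rewrite -KE !inE andbT negb_and !negbK orbC.
  have iE : setT :\ i = j |: K by rewrite -KE setD1K // !inE neq_ji.
  rewrite eqxx KE iE mulr1; set a := (-1) ^+ _; set b := (-1) ^+ _.
  by rewrite mulrC -(mulrA b) (mulrA a a) sgn2 mul1r mulrA sgn2 mul1r.
have [/eqP cardK|cardK] := boolP (#|K| == 2); last first.
  rewrite w2 // big1 // => i _; rewrite sum_ffunE big1 // => j /term->.
  by rewrite w2 // if_same.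
have /cards2P[i [j [neq_ij KE]]] : #|~: K| == 2.
  by rewrite cardsCs setCK cardK card_ord n4.
wlog lt_ij : i j neq_ij KE / (i < j)%N => [wl|].
  have [/wl->//|] := ltnP i j; rewrite leq_eqVlt => /orP[/eqP/val_inj eq_ij|lt_ji].
    by rewrite eq_ij eqxx in neq_ij.
  by apply: (wl j i); rewrite // 1?eq_sym // setUC.
rewrite (bigD1 i) //= sum_ffunE (bigD1 j) //= term // KE eqxx big1 ?addr0.
  rewrite big1 ?addr0 // => k neq_ki; rewrite sum_ffunE big1 // => l lt_kl.
  rewrite term // KE; case: eqP => // /setP eqs.
  move: (eqs k) (eqs i); rewrite !inE !eqxx /= [i == k]eq_sym (negbTE neq_ki) /=.
  move=> /eqP kj /esym/eqP il; move: lt_kl lt_ij; rewrite kj il => lt_jl lt_lj.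
  by rewrite ltnNge ltnW in lt_jl.
move=> l /andP[lt_il neq_lj]; rewrite term // KE; case: eqP => // /setP/(_ l).
rewrite !inE eqxx orbT (negbTE neq_lj) orbF => /eqP lE.
by rewrite lE ltnn in lt_il.
Qed.

Lemma contract2_mu : contract2 (poisson R) mu = df1 ∧ df2.
Proof. by rewrite muE; apply: contract2_vol => //; apply: df_is_form. Qed.

End PoissonTheory.

(* Main.v *)
Require Import Defs.
From HB Require Import structures.
From mathcomp Require Import all_boot all_order all_algebra.
From mathcomp Require Import boolp reals.
From mathcomp Require Import mpoly zify ring complex.

(** Over K = R[i] let w1 = x1 + i x2 + i x3 - x4, w2 = x1 + i x2 - i x3 + x4,
    and let v1, v2 be their conjugates.  Then w1 w2 = f1 + i f2 and
    v1 v2 = f1 - i f2, and pi = A /\ B for two linear vector fields A, B that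
    are diagonal in the coordinates X = (w1, w2, v1, v2).  Hence delta preserves
    the grading of forms by the exponent al of the logarithmic monomials
    X^al dlog X_i1 /\ .. /\ dlog X_ik, and in degree al it is the contraction
    with the constant vector A(al) B - B(al) A, which is exact as soon as the
    i-th component of this vector is nonzero for some i with al_i > 0.  So a
    cycle is a boundary if and only if it vanishes in the other, special degrees,
    in which delta = 0: the degrees (a, a, b, b), in which forms have coefficients
    in K[[w1 w2, v1 v2]], and (a, b, 0, 0), (0, 0, a, b) with a <> b.  The
    latter are filled by the series sum_i a_i x_i with a_i in K[[x2^2, x4]]:
    restricted to v = 0 or to w = 0, these are the series in two variables z1,
    z2 without the monomials z1^(2k), and such a series is determined by its
    coefficients off the diagonal in the two isotropic coordinates, whose product
    is z1^2 + z2^2.  Comparing the coefficients of the proposed representatives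
    in special degrees is then linear algebra, and taking real parts descends
    from K to R. *)

Set Implicit Arguments.
Unset Strict Implicit.
Unset Printing Implicit Defensive.

Import GRing.Theory.

Local Open Scope ring_scope.

(** * Formal power series *)

(** With y_1 = x_1 + i x_2 and y_2 = x_3 + i x_4 one has f_1 + i f_2 = y_1^2 + y_2^2, and w1 = y_1 +
    i y_2, w2 = y_1 - i y_2 are the isotropic coordinates of this quadratic form. A is the
    infinitesimal rotation of (y_1, y_2) and B is 4i times it, so both preserve f_1 and f_2. Their
    eigenvalues on X are (-i, i, i, -i) and (4, -4, 4, -4), hence A(al) B - B(al) A has the
    components 8i (al_3 - al_4), 8i (al_4 - al_3), 8i (al_2 - al_1), 8i (al_1 - al_2). The obstacle
    is regularity: a formal form has no dlog X_i in a degree with al_i = 0. In degree (a, b, 0, 0)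
    the vector is nonzero when a <> b, but it points along v1 and v2, where the form has no
    component to contract, and the homotopy would create a pole; these degrees therefore survive.
    The special degrees are only visible over K. The descent works because the f_j, zeta_j and x_i
    are real: the real part of a normal form over K is the normal form whose coefficients are the
    real parts. *)

Section FpsCoef.
Variables (n : nat) (T : comNzRingType).
Implicit Types (f g : {fps T[n]}) (m : 'X_{1..n}).

Lemma fcoefD f g m : fcoef (f + g) m = fcoef f m + fcoef g m.
Proof. by []. Qed.
Lemma fcoefN f m : fcoef (- f) m = - fcoef f m.
Proof. by []. Qed.
Lemma fcoefB f g m : fcoef (f - g) m = fcoef f m - fcoef g m.
Proof. by []. Qed.
Lemma fcoef0 m : fcoef (0 : {fps T[n]}) m = 0.
Proof. by []. Qed.
Lemma fcoef1 m : fcoef (1 : {fps T[n]}) m = (m == 0%MM)%:R.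
Proof. by rewrite /1%R /=; case: eqP. Qed.
Lemma fcoef_sum (I : Type) (r : seq I) (P : pred I) (F : I -> {fps T[n]}) m :
  fcoef (\sum_(i <- r | P i) F i) m = \sum_(i <- r | P i) fcoef (F i) m.
Proof. by apply: (big_morph (fun f => fcoef f m)). Qed.

(** The bound [b] is free, so that several products in one identity can be truncated at the same
    degree; multiplicative properties of series then reduce to those of [{mpoly T[n]}]. *)
Lemma fcoefM_lt f g m b : (mdeg m < b)%N ->
  fcoef (f * g) m = (fps_trunc b f * fps_trunc b g)@_m.
Proof. exact: fcoefM_trunc. Qed.

Lemma fps_trunc_is_zmod b : zmod_morphism (@fps_trunc n T b).
Proof.
move=> f g; rewrite -sumrB; apply: eq_bigr => k _.
by rewrite fcoefB scalerBl.
Qed.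

Definition fps_monom m : {fps T[n]} := Fps (fun k => (k == m)%:R).

Lemma fpsXE i : fpsX T i = fps_monom U_(i)%MM.
Proof. by apply: fpsP => m /=; case: eqP. Qed.

Lemma fps_truncX b m : (mdeg m < b)%N -> fps_trunc b (fps_monom m) = 'X_[m].
Proof.
move=> lt_mb; rewrite /fps_trunc (bigD1 (BMultinom lt_mb)) //= eqxx scale1r.
rewrite big1 ?addr0 // => k neq_k; case: eqP => [eq_k|]; last by rewrite scale0r.
by case/eqP: neq_k; apply: val_inj.
Qed.

Lemma fcoef_monomM k f m :
  fcoef (fps_monom k * f) m = if (k <= m)%MM then fcoef f (m - k)%MM else 0.
Proof.
set b := (mdeg m + mdeg k).+1; have lt_mb : (mdeg m < b)%N by rewrite ltnS leq_addr.
rewrite (fcoefM_lt _ _ lt_mb) fps_truncX; last by rewrite ltnS leq_addl.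
rewrite mulrC.
case: ifP => [/submK <-|nle].
  rewrite [(_ + k)%MM]addmC mcoeffMX mcoeff_trunc; first by rewrite addmC addmK.
  by rewrite (leq_ltn_trans (mdegB _ _)).
rewrite mcoeffMr big1 // => -[k1 k2] /= /eqP mE.
rewrite mcoeffX; case: eqP => [kE|]; last by rewrite mulr0.
by case/negP: nle; rewrite mE kE; apply: lem_addr.
Qed.

Lemma fps_monomD k l : fps_monom (k + l)%MM = fps_monom k * fps_monom l.
Proof.
apply: fpsP => m; rewrite fcoef_monomM; case: ifP => [le_km|nle] /=.
  by rewrite -{1}(submK le_km) [(k + l)%MM]addmC eqm_add2r.
by case: eqP => // mE; case/negP: nle; rewrite mE; apply: lem_addr.
Qed.

Lemma fps_monom0 : fps_monom 0%MM = 1.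
Proof. by apply: fpsP => m; rewrite fcoef1. Qed.

Lemma fcoefXM (i : 'I_n) f m :
  fcoef (fpsX T i * f) m = if (0 < m i)%N then fcoef f (m - U_(i))%MM else 0.
Proof.
rewrite fpsXE fcoef_monomM; congr (if _ then _ else _).
by rewrite lep1mP lt0n.
Qed.

Lemma fpsC_is_zmod : zmod_morphism (@fpsC n T).
Proof. by move=> a b; apply: fpsP => m /=; case: eqP; rewrite ?subr0. Qed.

Lemma fcoefCM c f m : fcoef (fpsC n c * f) m = c * fcoef f m.
Proof.
rewrite (fcoefM_lt _ _ (ltnSn _)).
rewrite (@mcoeffM_local _ _ _ c%:MP _ (fps_trunc (mdeg m).+1 f)) //.
  by rewrite mcoeffCM mcoeff_trunc.
move=> k le_k; rewrite mcoeff_trunc // mcoeffC /=.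
by case: eqP; rewrite ?mulr1 ?mulr0.
Qed.

Lemma fpsC_is_monoid : monoid_morphism (@fpsC n T).
Proof.
split=> [|a b]; apply: fpsP => m; first by rewrite fcoef1 /=; case: eqP.
by rewrite fcoefCM /=; case: eqP; rewrite ?mulr0.
Qed.

HB.instance Definition _ b :=
  GRing.isZmodMorphism.Build {fps T[n]} {mpoly T[n]} (@fps_trunc n T b)
    (fps_trunc_is_zmod b).
HB.instance Definition _ :=
  GRing.isZmodMorphism.Build T {fps T[n]} _ fpsC_is_zmod.
HB.instance Definition _ :=
  GRing.isMonoidMorphism.Build T {fps T[n]} _ fpsC_is_monoid.

Lemma fcoef0M f g : fcoef (f * g) 0%MM = fcoef f 0%MM * fcoef g 0%MM.
Proof.
rewrite (@fcoefM_lt _ _ _ 1) ?mdeg0 // rmorphM /=.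
by rewrite !mcoeff_trunc ?mdeg0.
Qed.

End FpsCoef.

(** * Congruence of series up to a total degree *)

Section FpsApprox.
Variables (n : nat) (T : comNzRingType).
Implicit Types (f g : {fps T[n]}) (m : 'X_{1..n}).

(** Congruence modulo the power d + 1 of the maximal ideal; [vanish_lt d] is membership in the power
    d. *)
Definition eqd d f g := forall m, (mdeg m <= d)%N -> fcoef f m = fcoef g m.
Definition vanish_lt d f := forall m, (mdeg m < d)%N -> fcoef f m = 0.

Lemma eqdP f g : (forall d, eqd d f g) -> f = g.
Proof. by move=> fg; apply: fpsP => m; apply: (fg (mdeg m)). Qed.

Lemma eqdM d f f' g g' : eqd d f f' -> eqd d g g' -> eqd d (f * g) (f' * g').
Proof.
move=> ff' gg' m le_m; rewrite !(fcoefM_lt _ _ (ltnSn _)).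
by apply: mcoeffM_local => k le_k;
  rewrite !mcoeff_trunc // ?ff' ?gg' // (leq_trans le_k).
Qed.

Lemma vanish_ltM a b f g :
  vanish_lt a f -> vanish_lt b g -> vanish_lt (a + b) (f * g).
Proof.
move=> fa gb m lt_m; rewrite (fcoefM_lt _ _ (ltnSn _)) mcoeffM big1 //.
case=> k1 k2 /= /eqP mE; rewrite !mcoeff_trunc; last 2 first.
- by rewrite ltnS [in leqRHS]mE mdegD leq_addl.
- by rewrite ltnS [in leqRHS]mE mdegD leq_addr.
have [/fa->|le_a] := ltnP (mdeg k1) a; first by rewrite mul0r.
rewrite gb ?mulr0 // -(ltn_add2l a) (leq_ltn_trans _ lt_m) //.
by rewrite [in leqRHS]mE mdegD leq_add2r.
Qed.

Lemma vanish_lt0 f : vanish_lt 0 f. Proof. by []. Qed.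

Lemma vanish_lt1 f : fcoef f 0%MM = 0 -> vanish_lt 1 f.
Proof. by move=> f0 m; rewrite ltnS leqn0 mdeg_eq0 => /eqP->. Qed.

Lemma vanish_ltX a e f : vanish_lt a f -> vanish_lt (e * a) (f ^+ e).
Proof.
move=> fa; elim: e => [|e IHe]; first exact: vanish_lt0.
by rewrite exprS mulSn; apply: vanish_ltM.
Qed.

(** Each factor has order at least 1 and orders add up. This makes the finite sum in [fps_subst] the
    whole substitution. *)
Lemma vanish_lt_mmap1 k (g : 'I_k -> {fps T[n]}) e :
  (forall i, fcoef (g i) 0%MM = 0) -> vanish_lt (mdeg e) (mmap1 g e).
Proof.
move=> g0; rewrite /mmap1 mdegE.
apply: (big_ind2 vanish_lt) => [|? ? ? ? ? ?|i _]; first exact: vanish_lt0.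
  exact: vanish_ltM.
by have := vanish_ltX (a := 1) (e := e i) (vanish_lt1 (g0 i)); rewrite muln1.
Qed.

End FpsApprox.

(** The product in [fps_subst] is convertible to [mmap1], which gives access to the theory of
    polynomial substitution. *)
Lemma fcoef_subst k n (T : comNzRingType) (P : {fps T[k]}) (g : 'I_k -> {fps T[n]}) m :
  fcoef (fps_subst P g) m
    = \sum_(e : 'X_{1..k < (mdeg m).+1}) fcoef P e * fcoef (mmap1 g e) m.
Proof. by []. Qed.

(** * Substitution of series without constant term *)

Section FpsSubst.
Variables (k n : nat) (T : comNzRingType) (g : 'I_k -> {fps T[n]}).
Hypothesis g0 : forall i, fcoef (g i) 0%MM = 0.
Implicit Types (P Q : {fps T[k]}).

Let mm := mmap (@fpsC n T) g.

(** Where [p] and [q] differ the exponent has degree above d, and its image has order above d. *)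
Lemma eqd_mmap d (p q : {mpoly T[k]}) :
  (forall e, (mdeg e <= d)%N -> p@_e = q@_e) -> eqd d (mm p) (mm q).
Proof.
move=> pq m le_m; apply/eqP; rewrite -subr_eq0 -fcoefB -mmapB.
rewrite /mmap fcoef_sum big_seq big1 // => e.
rewrite mcoeff_msupp => pq_e; rewrite fcoefCM.
rewrite (vanish_lt_mmap1 (e := e)) ?mulr0 //.
rewrite (leq_ltn_trans le_m) // ltnNge; apply: contraNN pq_e => /pq pq_e.
by rewrite mcoeffB pq_e subrr.
Qed.

Lemma fcoef_subst_trunc P m :
  fcoef (fps_subst P g) m = fcoef (mm (fps_trunc (mdeg m).+1 P)) m.
Proof.
rewrite /mm /fps_trunc raddf_sum fcoef_sum; apply: eq_bigr => e _ /=.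
by rewrite mmapZ mmapX fcoefCM.
Qed.

Lemma eqd_subst_trunc d b P :
  (d < b)%N -> eqd d (fps_subst P g) (mm (fps_trunc b P)).
Proof.
move=> lt_db m le_m; rewrite fcoef_subst_trunc.
apply: (@eqd_mmap (mdeg m)) => // e le_e; rewrite !mcoeff_trunc //.
by apply: leq_ltn_trans lt_db; apply: leq_trans le_m.
Qed.

Lemma eqd_subst d P Q : eqd d P Q -> eqd d (fps_subst P g) (fps_subst Q g).
Proof.
move=> PQ m le_m; rewrite !fcoef_subst_trunc.
apply: (@eqd_mmap (mdeg m)) => // e le_e; rewrite !mcoeff_trunc //.
by apply: PQ; apply: leq_trans le_m.
Qed.

Lemma fps_substB : zmod_morphism (fun P : {fps T[k]} => fps_subst P g).
Proof.
move=> P Q; apply: fpsP => m.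
by rewrite fcoefB !fcoef_subst_trunc raddfB /= /mm mmapB.
Qed.

Lemma fps_substC c : fps_subst (fpsC k c) g = fpsC n c.
Proof.
apply: eqdP => d m le_m; rewrite fcoef_subst_trunc.
rewrite (@eqd_mmap (mdeg m) _ c%:MP) // ?/mm ?mmapC // => e le_e.
by rewrite mcoeff_trunc // mcoeffC /=; case: eqP; rewrite ?mulr1 ?mulr0.
Qed.

Lemma fps_subst_monom m : fps_subst (fps_monom T m) g = mmap1 g m.
Proof.
apply: eqdP => d.
have := @eqd_subst_trunc d (d + mdeg m).+1 (fps_monom T m).
by rewrite fps_truncX ?ltnS ?leq_addl ?leq_addr // /mm mmapX; apply.
Qed.

Lemma fps_substX i : fps_subst (fpsX T i) g = g i.
Proof. by rewrite fpsXE fps_subst_monom mmap1U. Qed.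

Lemma fps_subst_is_monoid : monoid_morphism (fun P : {fps T[k]} => fps_subst P g).
Proof.
split=> [|P Q]; first by rewrite -(rmorph1 (@fpsC k T)) fps_substC rmorph1.
apply: eqdP => d m le_m.
have := eqdM (@eqd_subst_trunc d _ P (ltnSn d)) (@eqd_subst_trunc d _ Q (ltnSn d)).
move=> /(_ _ le_m)->.
rewrite (@eqd_subst_trunc d _ _ (ltnSn d)) // -rmorphM /=.
apply: (@eqd_mmap d) => // e le_e.
rewrite mcoeff_trunc // (fcoefM_lt _ _ (ltnSn _)).
by apply: mcoeffM_local => a le_a; rewrite !mcoeff_trunc // ltnS (leq_trans le_a).
Qed.

(* The unused argument makes the hypothesis available to the morphism instances. *)
Definition fps_subst_morph (_ : forall i, fcoef (g i) 0%MM = 0) P := fps_subst P g.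

HB.instance Definition _ h :=
  GRing.isZmodMorphism.Build {fps T[k]} {fps T[n]} (fps_subst_morph h)
    fps_substB.
HB.instance Definition _ h :=
  GRing.isMonoidMorphism.Build {fps T[k]} {fps T[n]} (fps_subst_morph h)
    fps_subst_is_monoid.

Lemma fps_subst0E P : fcoef (fps_subst P g) 0%MM = fcoef P 0%MM.
Proof.
rewrite (@eqd_subst _ P (fpsC k (fcoef P 0%MM)) _ 0%MM (leqnn _)) ?mdeg0.
  by rewrite fps_substC /= eqxx.
by move=> m; rewrite leqn0 mdeg_eq0 => /eqP->; rewrite /= eqxx.
Qed.

End FpsSubst.

(** Up to degree d the series [P] may be replaced by a polynomial, and substitution of [h] is a ring
    morphism, so it passes through polynomial expressions in the [g i]. *)
Lemma fps_subst_comp (k l n : nat) (T : comNzRingType)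
    (g : 'I_k -> {fps T[l]}) (h : 'I_l -> {fps T[n]}) (P : {fps T[k]}) :
    (forall i, fcoef (g i) 0%MM = 0) -> (forall i, fcoef (h i) 0%MM = 0) ->
  fps_subst (fps_subst P g) h = fps_subst P (fun i => fps_subst (g i) h).
Proof.
move=> g0 h0; apply: eqdP => d m le_m.
have gh0 i : fcoef (fps_subst (g i) h) 0%MM = 0 by rewrite fps_subst0E.
rewrite (eqd_subst h0 (eqd_subst_trunc g0 P (ltnSn d))) //.
rewrite (eqd_subst_trunc gh0 P (ltnSn d)) //.
congr (fcoef _ m); rewrite -/(fps_subst_morph h0 _) /mmap rmorph_sum.
apply: eq_bigr => e _; rewrite rmorphM rmorph_prod /=.
rewrite {1}/fps_subst_morph fps_substC //; congr (_ * _).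
by apply: eq_bigr => i _; rewrite rmorphXn.
Qed.

Lemma mmap1_fpsX (n : nat) (T : comNzRingType) e :
  mmap1 (fpsX T (n:=n)) e = fps_monom T e.
Proof.
rewrite /mmap1 [in RHS](multinomUE_id e).
rewrite (big_morph _ (@fps_monomD n T) (@fps_monom0 n T)).
apply: eq_bigr => i _; rewrite fpsXE; elim: (e i) => [|d IHd].
  by rewrite expr0 mulm0n fps_monom0.
by rewrite exprS IHd mulmS fps_monomD.
Qed.

Lemma fps_subst_id (k : nat) (T : comNzRingType) (P : {fps T[k]}) :
  fps_subst P (fpsX T (n:=k)) = P.
Proof.
apply: fpsP => m; rewrite fcoef_subst (bigD1 (BMultinom (ltnSn (mdeg m)))) //=.
rewrite mmap1_fpsX /= eqxx mulr1 big1 ?addr0 // => e neq_e.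
rewrite mmap1_fpsX /=; case: eqP => [mE|]; last by rewrite mulr0.
by case/eqP: neq_e; apply: val_inj.
Qed.

(** * Partial derivatives and the chain rule *)

Section FpsDeriv.
Variables (n : nat) (T : comNzRingType).
Implicit Types (f g : {fps T[n]}) (m : 'X_{1..n}).

Lemma fcoef_deriv i f m :
  fcoef (fps_deriv i f) m = fcoef f (m + U_(i))%MM *+ (m i).+1.
Proof. by []. Qed.

Lemma fps_derivB i : zmod_morphism (@fps_deriv n T i).
Proof. by move=> f g; apply: fpsP => m; rewrite /= mulrnBl. Qed.

HB.instance Definition _ i :=
  GRing.isZmodMorphism.Build {fps T[n]} {fps T[n]} (@fps_deriv n T i)
    (fps_derivB i).

Lemma mcoeff_deriv_trunc i f m b : ((mdeg m).+1 < b)%N ->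
  (mderiv i (fps_trunc b f))@_m = fcoef (fps_deriv i f) m.
Proof.
by move=> lt_mb; rewrite mcoeff_deriv mcoeff_trunc // mdegD mdeg1 addn1.
Qed.

Lemma fps_derivM i f g :
  fps_deriv i (f * g) = fps_deriv i f * g + f * fps_deriv i g.
Proof.
apply: fpsP => m; rewrite fcoefD fcoef_deriv.
(* A derivative reads coefficients one degree higher, hence the extra degree in the truncation. *)
set b := (mdeg m).+2; have lt_b : (mdeg (m + U_(i))%MM < b)%N.
  by rewrite mdegD mdeg1 addn1.
rewrite (fcoefM_lt _ _ lt_b) -mcoeff_deriv mderivM mcoeffD.
have lt_mb : (mdeg m < b)%N by rewrite ltnW.
rewrite !(fcoefM_lt _ _ lt_mb).
congr (_ + _); apply: mcoeffM_local => k le_k;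
  by rewrite ?mcoeff_deriv_trunc ?mcoeff_trunc // /b !ltnS // leqW.
Qed.

Lemma fps_derivC i (c : T) : fps_deriv i (fpsC n c) = 0.
Proof. by apply: fpsP => m; rewrite /= mnmD_eq0 mnm1_eq0 andbF mul0rn. Qed.

Lemma fps_derivCM i c f : fps_deriv i (fpsC n c * f) = fpsC n c * fps_deriv i f.
Proof. by rewrite fps_derivM fps_derivC mul0r add0r. Qed.

Lemma fps_derivX (i j : 'I_n) : fps_deriv i (fpsX T j) = (i == j)%:R.
Proof.
apply: fpsP => m /=; rewrite [U_(j)%MM]lock.
have [<-|neq_ij] := eqVneq i j.
  rewrite -lock -{2}[U_(i)%MM]add0m eqm_add2r fcoef1.
  by case: eqP => [->|_]; rewrite ?mnm0E ?mul0rn ?mulr1n.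
case: eqP => [/mnmP/(_ i)|_]; last by rewrite mul0rn.
by rewrite -lock mnmDE !mnm1E eqxx eq_sym (negbTE neq_ij) addn1.
Qed.

Lemma eqd_deriv d i f g : eqd d.+1 f g -> eqd d (fps_deriv i f) (fps_deriv i g).
Proof. by move=> fg m le_m /=; rewrite fg // mdegD mdeg1 addn1. Qed.

End FpsDeriv.

(** The formula is stable under sums and products and holds for constants and variables, hence for
    polynomials. A given coefficient only depends on a truncation of [P], taken one degree further
    because of the derivative. *)
Lemma fps_deriv_subst (k n : nat) (T : comNzRingType) (g : 'I_k -> {fps T[n]})
    (P : {fps T[k]}) j : (forall i, fcoef (g i) 0%MM = 0) ->
  fps_deriv j (fps_subst P g)
    = \sum_i fps_subst (fps_deriv i P) g * fps_deriv j (g i).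
Proof.
move=> g0.
pose chain (p : {mpoly T[k]}) := fps_deriv j (mmap (@fpsC n T) g p)
    = \sum_i mmap (@fpsC n T) g (mderiv i p) * fps_deriv j (g i).
have chainP p : chain p.
  have chainD q r : chain q -> chain r -> chain (q + r).
    rewrite /chain => qP rP; rewrite mmapD raddfD /= qP rP -big_split /=.
    by apply: eq_bigr => i _; rewrite mderivD mmapD mulrDl.
  have chainM q r : chain q -> chain r -> chain (q * r).
    rewrite /chain => qP rP; rewrite rmorphM fps_derivM qP rP mulr_suml mulr_sumr.
    rewrite -big_split /=; apply: eq_bigr => i _.
    by rewrite mderivM mmapD !rmorphM /= mulrDl mulrA; congr (_ + _); rewrite mulrAC.
  have chainC c : chain c%:MP.
    rewrite /chain mmapC fps_derivC big1 // => i _.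
    by rewrite mderivC mmap0 mul0r.
  have chainX i : chain 'X_i.
    rewrite /chain mmapX mmap1U (bigD1 i) //= mderivX mnm1E eqxx scale1r.
    have -> : (U_(i) - U_(i) = 0 :> 'X_{1..k})%MM.
      by apply/mnmP => l; rewrite mnmBE mnm0E subnn.
    rewrite mmapX mmap11 mul1r big1 ?addr0 // => l neq_li.
    by rewrite mderivX mnm1E eq_sym (negbTE neq_li) scale0r mmap0 mul0r.
  rewrite -/(chain p) (mpolyE p); apply: big_ind => [||m _]; first 2 last.
  - rewrite -mul_mpolyC; apply: (chainM _ _ (chainC _)).
    rewrite mpolyXE_id; apply: (big_ind chain (chainC 1) chainM) => i _.
    elim: (m i) => [|d IHd]; first exact: (chainC 1).
    by rewrite exprS; apply: chainM.
  - exact: (chainC 0).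
  - exact: chainD.
apply: fpsP => m.
have lt_m : (mdeg m < (mdeg m).+1)%N by [].
set b := (mdeg m).+2; set p := fps_trunc b P.
have eq1 : eqd (mdeg m).+1 (fps_subst P g) (mmap (@fpsC n T) g p).
  by apply: eqd_subst_trunc.
rewrite (@eqd_deriv _ _ (mdeg m) j _ _ eq1) // chainP !fcoef_sum; apply: eq_bigr => i _.
apply: (@eqdM _ _ (mdeg m)) => // l le_l.
rewrite [RHS](eqd_subst_trunc g0 (fps_deriv i P) (ltnSn (mdeg m))) //.
apply: (@eqd_mmap _ _ _ _ g0 (mdeg m)) => // e le_e.
by rewrite mcoeff_deriv_trunc ?mcoeff_trunc // /b ltnS.
Qed.

(** * Substitution of independent monomials *)

Section FpsSubstMonom.
Variables (k n : nat) (T : comNzRingType) (u : 'I_k -> 'X_{1..n}).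
Hypothesis u_neq0 : forall i, u i != 0%MM.

Definition mnm_comb (e : 'X_{1..k}) : 'X_{1..n} := (\sum_i u i *+ e i)%MM.

Hypothesis u_inj : injective mnm_comb.

Lemma mmap1_monom e : mmap1 (fun i => fps_monom T (u i)) e = fps_monom T (mnm_comb e).
Proof.
rewrite /mmap1 /mnm_comb (big_morph _ (@fps_monomD n T) (@fps_monom0 n T)).
apply: eq_bigr => i _; elim: (e i) => [|d IHd].
  by rewrite expr0 mulm0n fps_monom0.
by rewrite exprS IHd mulmS fps_monomD.
Qed.

Lemma leq_mdeg_comb e : (mdeg e <= mdeg (mnm_comb e))%N.
Proof.
rewrite mdeg_sum mdegE leq_sum // => i _; rewrite mdegMn.
by rewrite leq_pmull // lt0n mdeg_eq0.
Qed.

(** Independent monomials produce no collisions, so each coefficient of the result comes from a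
    single term of [P]. *)
Lemma fcoef_subst_comb (P : {fps T[k]}) e :
  fcoef (fps_subst P (fun i => fps_monom T (u i))) (mnm_comb e) = fcoef P e.
Proof.
(* Nonzero exponents [u i] keep [e] inside the range of the sum defining the substitution. *)
have lt_e : (mdeg e < (mdeg (mnm_comb e)).+1)%N by rewrite ltnS leq_mdeg_comb.
rewrite fcoef_subst (bigD1 (BMultinom lt_e)) //= mmap1_monom /= eqxx.
rewrite mulr1 big1 ?addr0 // => e' neq_e'.
rewrite mmap1_monom /=; case: eqP => [/u_inj eE|]; last by rewrite mulr0.
by case/eqP: neq_e'; apply: val_inj.
Qed.

Lemma fcoef_subst_notcomb (P : {fps T[k]}) m : (forall e, m != mnm_comb e) ->
  fcoef (fps_subst P (fun i => fps_monom T (u i))) m = 0.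
Proof.
move=> not_m; rewrite fcoef_subst big1 // => e _.
by rewrite mmap1_monom /= (negbTE (not_m _)) mulr0.
Qed.

End FpsSubstMonom.

(** * Change of the coefficient ring *)

Section FpsMap.
Variables (n : nat) (T T' : comNzRingType).

Definition fps_map (c : T -> T') (f : {fps T[n]}) : {fps T'[n]} :=
  Fps (fun m => c (fcoef f m)).

Lemma fps_mapB (c : {additive T -> T'}) : zmod_morphism (fps_map c).
Proof. by move=> f g; apply: fpsP => m; rewrite /= raddfB. Qed.

HB.instance Definition _ (c : {additive T -> T'}) :=
  GRing.isZmodMorphism.Build {fps T[n]} {fps T'[n]} (fps_map c) (fps_mapB c).

Lemma fps_map_is_monoid (c : {rmorphism T -> T'}) : monoid_morphism (fps_map c).
Proof.
split=> [|f g]; apply: fpsP => m; last first.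
  by rewrite /= rmorph_sum; apply: eq_bigr => k _; rewrite rmorphM.
by rewrite fcoef1 -(rmorph_nat c) -fcoef1.
Qed.

HB.instance Definition _ (c : {rmorphism T -> T'}) :=
  GRing.isMonoidMorphism.Build {fps T[n]} {fps T'[n]} (fps_map c)
    (fps_map_is_monoid c).

Lemma fps_map_deriv (c : {additive T -> T'}) i f :
  fps_map c (fps_deriv i f) = fps_deriv i (fps_map c f).
Proof. by apply: fpsP => m; rewrite /= raddfMn. Qed.

Lemma fps_mapC (c : {additive T -> T'}) a : fps_map c (fpsC n a) = fpsC n (c a).
Proof. by apply: fpsP => m /=; case: eqP; rewrite ?raddf0. Qed.

Lemma fps_mapX (c : {rmorphism T -> T'}) i : fps_map c (fpsX T i) = fpsX T' i.
Proof. by apply: fpsP => m /=; case: eqP; rewrite ?rmorph0 ?rmorph1. Qed.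

End FpsMap.

Lemma fps_map_subst k n (T T' : comNzRingType) (c : {rmorphism T -> T'})
    (P : {fps T[k]}) (g : 'I_k -> {fps T[n]}) :
  fps_map c (fps_subst P g) = fps_subst (fps_map c P) (fun i => fps_map c (g i)).
Proof.
apply: fpsP => m; rewrite /= rmorph_sum; apply: eq_bigr => e _.
have -> : \prod_i fps_map c (g i) ^+ e i = fps_map c (\prod_i g i ^+ e i).
  by rewrite rmorph_prod; apply: eq_bigr => i _; rewrite rmorphXn.
by rewrite rmorphM.
Qed.

(** * A T-linear map back to the smaller ring; the model is the real part *)

Section FpsProj.
Variables (n : nat) (T T' : comNzRingType).
Variables (c : {rmorphism T -> T'}) (r : {additive T' -> T}).
Hypothesis rM : forall a b, r (c a * b) = a * r b.

Lemma fps_projM (f : {fps T[n]}) (g : {fps T'[n]}) :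
  fps_map r (fps_map c f * g) = f * fps_map r g.
Proof. by apply: fpsP => m; rewrite /= raddf_sum; apply: eq_bigr. Qed.

Lemma fps_proj_subst k (P : {fps T'[k]}) (g : 'I_k -> {fps T[n]}) :
  fps_map r (fps_subst P (fun i => fps_map c (g i))) = fps_subst (fps_map r P) g.
Proof.
apply: fpsP => m; rewrite /= raddf_sum; apply: eq_bigr => e _.
have -> : \prod_i fps_map c (g i) ^+ e i = fps_map c (\prod_i g i ^+ e i).
  by rewrite rmorph_prod; apply: eq_bigr => i _; rewrite rmorphXn.
by rewrite mulrC rM mulrC.
Qed.

End FpsProj.

(** * Exterior algebra over formal power series *)

Section Clifford.
Variables (n : nat) (A : comNzRingType).
Implicit Types (w : {set 'I_n} -> A) (K : {set 'I_n}) (i j : 'I_n).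

Definition set_sign i K : A := (-1) ^+ #|[set j in K | (j < i)%N]|.

Definition ext i w K := if i \in K then set_sign i (K :\ i) * w (K :\ i) else 0.
Definition ctr i w K := if i \in K then 0 else set_sign i K * w (i |: K).

Lemma set_signK i K : set_sign i K * set_sign i K = 1.
Proof. by rewrite -expr2 sqrr_sign. Qed.

Lemma set_signU i j K : j \notin K ->
  set_sign i (j |: K) = (-1) ^+ (j < i)%N * set_sign i K.
Proof.
move=> jK; rewrite /set_sign; case: ltnP => [lt_ji|le_ij].
  rewrite expr1 -[X in X * _]expr1 -exprD.
  have -> : [set k in j |: K | (k < i)%N] = j |: [set k in K | (k < i)%N].
    apply/setP => k; rewrite !inE andb_orl; congr (_ || _).
    by case: eqP => // ->; rewrite lt_ji.
  by rewrite cardsU1 inE (negbTE jK).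
rewrite expr0 mul1r; congr (_ ^+ #|pred_of_set _|).
apply/setP => k; rewrite !inE; case: eqP => // -> /=.
by rewrite ltnNge le_ij andbF.
Qed.

(** Of i and j exactly one has to pass the other, depending on the order of insertion; all
    anticommutation below rests on this sign. *)
Lemma set_signC i j K : i != j -> i \notin K -> j \notin K ->
  set_sign i (j |: K) * set_sign j K = - (set_sign j (i |: K) * set_sign i K).
Proof.
move=> neq_ij iK jK; rewrite !set_signU //.
have [lt_ij|lt_ji|/val_inj eq_ij] := ltngtP i j; last by rewrite eq_ij eqxx in neq_ij.
  by rewrite !expr0 !expr1 mul1r mulN1r mulNr opprK mulrC.
by rewrite !expr0 !expr1 mul1r mulN1r mulNr mulrC.
Qed.

Lemma ext_ext i j w K : ext i (ext j w) K = - ext j (ext i w) K.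
Proof.
rewrite /ext !inE; have [<-|neq_ij] := eqVneq i j.
  by case: ifP => _; rewrite /= ?mulr0 oppr0.
have [iK|] := boolP (i \in K); last by rewrite andbF mulr0 if_same oppr0.
have [jK|] /= := boolP (j \in K); last by rewrite !mulr0 oppr0.
set L := K :\ i :\ j.
have -> : K :\ i = j |: L by rewrite setD1K // !inE eq_sym neq_ij.
have -> : K :\ j :\ i = L by rewrite /L !setDDl setUC.
have -> : K :\ j = i |: L.
  apply/setP => k; rewrite !inE; have [->|_] //= := eqVneq k i.
  by rewrite neq_ij iK.
by rewrite !mulrA set_signC ?mulNr // !inE ?eqxx // andbF.
Qed.

Lemma ext_sq i w K : ext i (ext i w) K = 0.
Proof. by rewrite /ext !inE eqxx; case: ifP; rewrite /= ?mulr0. Qed.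

Lemma ctr_ctr i j w K : ctr i (ctr j w) K = - ctr j (ctr i w) K.
Proof.
rewrite /ctr !inE; have [<-|neq_ij] := eqVneq i j.
  by rewrite /= mulr0 if_same oppr0.
have [iK|iK] /= := boolP (i \in K); first by rewrite mulr0 if_same oppr0.
have [jK|jK] /= := boolP (j \in K); first by rewrite mulr0 oppr0.
rewrite !mulrA setUCA -mulNr; congr (_ * _).
by rewrite mulrC [in RHS]mulrC set_signC // eq_sym.
Qed.

(** The Clifford relation. It yields the contraction formulas for all vector fields below, and the
    homotopy of [log_delta_exact]. *)
Lemma ctr_ext i j w K :
  ctr i (ext j w) K + ext j (ctr i w) K = (i == j)%:R * w K.
Proof.
rewrite /ctr /ext !inE; have [<-|neq_ij] := eqVneq i j.
  rewrite /= mul1r; case: ifP => iK.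
    by rewrite add0r mulrA set_signK mul1r setD1K.
  by rewrite addr0 setU1K ?iK // mulrA set_signK mul1r.
rewrite mul0r /=.
have [jK|jK] := boolP (j \in K); last by rewrite mulr0 if_same addr0.
have [iK|iK] /= := boolP (i \in K); first by rewrite mulr0 addr0.
set L := K :\ j; have KE : K = j |: L by rewrite setD1K.
have -> : (i |: K) :\ j = i |: L.
  apply/setP => k; rewrite !inE; case: eqP => // ->.
  by rewrite eq_sym (negbTE neq_ij).
rewrite [in X in X + _]KE !mulrA -mulrDl.
have jL : j \notin L by rewrite !inE eqxx.
have iL : i \notin L by rewrite !inE (negbTE iK) andbF.
rewrite !set_signU // mulrACA [set_sign j L * _]mulrC.
have [lt_ij|lt_ji|/val_inj eq_ij] := ltngtP i j; last by rewrite eq_ij eqxx in neq_ij.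
  by rewrite expr0 expr1 mul1r mulN1r addNr mul0r.
by rewrite expr0 expr1 mulr1 mulN1r addNr mul0r.
Qed.

Lemma eq_ext i w w' : w =1 w' -> ext i w =1 ext i w'.
Proof. by move=> ww' K; rewrite /ext ww'. Qed.
Lemma eq_ctr i w w' : w =1 w' -> ctr i w =1 ctr i w'.
Proof. by move=> ww' K; rewrite /ctr ww'. Qed.

Lemma ext_sum (I : Type) (r : seq I) (P : pred I) (a : I -> A) (F : I -> {set 'I_n} -> A) i K :
  ext i (fun L => \sum_(t <- r | P t) a t * F t L) K
    = \sum_(t <- r | P t) a t * ext i (F t) K.
Proof.
rewrite /ext; case: ifP => _; last by rewrite big1 // => t _; rewrite mulr0.
by rewrite mulr_sumr; apply: eq_bigr => t _; rewrite mulrCA.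
Qed.

Lemma ctr_sum (I : Type) (r : seq I) (P : pred I) (a : I -> A) (F : I -> {set 'I_n} -> A) i K :
  ctr i (fun L => \sum_(t <- r | P t) a t * F t L) K
    = \sum_(t <- r | P t) a t * ctr i (F t) K.
Proof.
rewrite /ctr; case: ifP => _; first by rewrite big1 // => t _; rewrite mulr0.
by rewrite mulr_sumr; apply: eq_bigr => t _; rewrite mulrCA.
Qed.

End Clifford.

(* The differential forms [dform], as a record for the same reason as [fps]:
   terms of type [dform] are finite functions, which unification unfolds. *)
Record cform n (T : comNzRingType) := Form { fc : {set 'I_n} -> {fps T[n]} }.

Lemma formP n (T : comNzRingType) (u v : cform n T) : fc u =1 fc v -> u = v.
Proof. by case: u v => [u] [v] /= uv; congr Form; apply/funext. Qed.

HB.instance Definition _ n T := gen_eqMixin (cform n T).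
HB.instance Definition _ n T := gen_choiceMixin (cform n T).

Section FormModule.
Variables (n : nat) (T : comNzRingType).
Implicit Types (u v w : cform n T) (p q : {fps T[n]}).

Definition form_zero : cform n T := Form (fun=> 0).
Definition form_add u v := Form (fun K => fc u K + fc v K).
Definition form_opp u := Form (fun K => - fc u K).
Definition form_scale p u := Form (fun K => p * fc u K).

Lemma form_addA : associative form_add.
Proof. by move=> u v w; apply: formP => K /=; rewrite addrA. Qed.
Lemma form_addC : commutative form_add.
Proof. by move=> u v; apply: formP => K /=; rewrite addrC. Qed.
Lemma form_add0 : left_id form_zero form_add.
Proof. by move=> u; apply: formP => K /=; rewrite add0r. Qed.
Lemma form_addN : left_inverse form_zero form_opp form_add.
Proof. by move=> u; apply: formP => K /=; rewrite addNr. Qed.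

HB.instance Definition _ :=
  GRing.isZmodule.Build (cform n T) form_addA form_addC form_add0 form_addN.

Lemma form_scaleA p q u : form_scale p (form_scale q u) = form_scale (p * q) u.
Proof. by apply: formP => K /=; rewrite mulrA. Qed.
Lemma form_scale1 : left_id 1 form_scale.
Proof. by move=> u; apply: formP => K /=; rewrite mul1r. Qed.
Lemma form_scaleDr : right_distributive form_scale +%R.
Proof. by move=> p u v; apply: formP => K; apply: mulrDr. Qed.
Lemma form_scaleDl u : {morph form_scale^~ u : p q / p + q}.
Proof. by move=> p q; apply: formP => K; apply: mulrDl. Qed.

HB.instance Definition _ := GRing.Zmodule_isLmodule.Build {fps T[n]} (cform n T)
  form_scaleA form_scale1 form_scaleDr form_scaleDl.

Lemma fcD u v K : fc (u + v) K = fc u K + fc v K. Proof. by []. Qed.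
Lemma fcN u K : fc (- u) K = - fc u K. Proof. by []. Qed.
Lemma fcB u v K : fc (u - v) K = fc u K - fc v K. Proof. by []. Qed.
Lemma fcZ p u K : fc (p *: u) K = p * fc u K. Proof. by []. Qed.
Lemma fc_sum (I : Type) (r : seq I) (P : pred I) (F : I -> cform n T) K :
  fc (\sum_(i <- r | P i) F i) K = \sum_(i <- r | P i) fc (F i) K.
Proof. by apply: (big_morph (fun u => fc u K)). Qed.

Definition dxw (i : 'I_n) u : cform n T := Form (ext i (fc u)).
Definition ctw (i : 'I_n) u : cform n T := Form (ctr i (fc u)).

Lemma dxw_is_linear i : linear (dxw i).
Proof.
move=> p u v; apply: formP => K; rewrite fcD fcZ /= /ext.
case: ifP => _; last by rewrite mulr0 addr0.
by rewrite mulrDr mulrCA.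
Qed.

HB.instance Definition _ i :=
  GRing.isLinear.Build {fps T[n]} (cform n T) (cform n T) _ (dxw i) (dxw_is_linear i).

Lemma ctw_is_linear i : linear (ctw i).
Proof.
move=> p u v; apply: formP => K; rewrite fcD fcZ /= /ctr.
case: ifP => _; first by rewrite mulr0 addr0.
by rewrite mulrDr mulrCA.
Qed.

HB.instance Definition _ i :=
  GRing.isLinear.Build {fps T[n]} (cform n T) (cform n T) _ (ctw i) (ctw_is_linear i).

Lemma dxw_dxw i j u : dxw i (dxw j u) = - dxw j (dxw i u).
Proof. by apply: formP => K; apply: ext_ext. Qed.

Lemma dxw_sq i u : dxw i (dxw i u) = 0.
Proof. by apply: formP => K; apply: ext_sq. Qed.

Lemma ctw_ctw i j u : ctw i (ctw j u) = - ctw j (ctw i u).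
Proof. by apply: formP => K; apply: ctr_ctr. Qed.

Lemma ctw_dxw i j u : ctw i (dxw j u) = (i == j)%:R *: u - dxw j (ctw i u).
Proof.
apply/eqP; rewrite eq_sym subr_eq eq_sym; apply/eqP/formP => K.
exact: ctr_ext.
Qed.

(** The exterior product with the 1-form of components [a], followed by the contraction with the
    field of components [V]. A 1-form itself is [cov a] applied to the constant form 1, so that
    products of 1-forms become compositions of operators. *)
Definition cov (a : 'I_n -> {fps T[n]}) u : cform n T := \sum_i a i *: dxw i u.
Definition interior (V : 'I_n -> {fps T[n]}) u : cform n T := \sum_i V i *: ctw i u.

Lemma cov_is_linear a : linear (cov a).
Proof.
move=> p u v; rewrite /cov scaler_sumr -big_split; apply: eq_bigr => i _ /=.
by rewrite linearP scalerDr !scalerA mulrC.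
Qed.

HB.instance Definition _ a :=
  GRing.isLinear.Build {fps T[n]} (cform n T) (cform n T) _ (cov a) (cov_is_linear a).

Lemma interior_is_linear a : linear (interior a).
Proof.
move=> p u v; rewrite /interior scaler_sumr -big_split; apply: eq_bigr => i _ /=.
by rewrite linearP scalerDr !scalerA mulrC.
Qed.

HB.instance Definition _ a :=
  GRing.isLinear.Build {fps T[n]} (cform n T) (cform n T) _ (interior a)
    (interior_is_linear a).

Lemma cov_covE a b u :
  cov a (cov b u) = \sum_i \sum_j (a i * b j) *: dxw i (dxw j u).
Proof.
apply: eq_bigr => i _; rewrite /cov linear_sum scaler_sumr; apply: eq_bigr => j _.
by rewrite linearZ scalerA.
Qed.

Lemma cov_cov a b u : cov a (cov b u) = - cov b (cov a u).
Proof.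
rewrite !cov_covE exchange_big -sumrN; apply: eq_bigr => j _.
rewrite -sumrN; apply: eq_bigr => i _.
by rewrite (dxw_dxw i j u) scalerN (mulrC (a i)).
Qed.

(** The terms above the diagonal are paired with those below it. Showing that twice the sum vanishes
    would not be enough, since 2 may be a zero divisor in T. *)
Lemma sum_skew (F : 'I_n -> 'I_n -> cform n T) :
    (forall i, F i i = 0) -> (forall i j, F i j + F j i = 0) ->
  \sum_i \sum_j F i j = 0.
Proof.
move=> F0 FN; have split_sum (i : 'I_n) : \sum_j F i j
    = \sum_(j < n) (if (i < j)%N then F i j else 0)
      + \sum_(j < n) (if (j < i)%N then F i j else 0).
  rewrite -big_split; apply: eq_bigr => j _ /=.
  by case: ltngtP => [_|_|/val_inj->]; rewrite ?addr0 ?add0r ?F0.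
rewrite (eq_bigr _ (fun i _ => split_sum i)) big_split.
rewrite [X in _ + X = _]exchange_big -big_split.
apply: big1 => i _; rewrite -big_split; apply: big1 => j _ /=.
by case: ifP => _; [exact: FN | exact: addr0].
Qed.

Lemma cov_sq a u : cov a (cov a u) = 0.
Proof.
rewrite cov_covE; apply: sum_skew => [i|i j]; first by rewrite dxw_sq scaler0.
by rewrite (dxw_dxw i j) scalerN (mulrC (a i)) addNr.
Qed.

Lemma interior_dxw V j u : interior V (dxw j u) = V j *: u - dxw j (interior V u).
Proof.
have -> : V j *: u = \sum_i (V i * (i == j)%:R) *: u.
  rewrite -scaler_suml (bigD1 j) //= eqxx mulr1 big1; first by rewrite addr0.
  by move=> i /negbTE->; rewrite mulr0.
rewrite /interior linear_sum -sumrB; apply: eq_bigr => i _.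
by rewrite ctw_dxw scalerBr scalerA (linearZ_LR (dxw j)).
Qed.

Lemma interior_cov V a u :
  interior V (cov a u) = (\sum_i V i * a i) *: u - cov a (interior V u).
Proof.
rewrite {1}/cov linear_sum scaler_suml -sumrB; apply: eq_bigr => j _.
by rewrite linearZ /= interior_dxw scalerBr scalerA mulrC.
Qed.

(** The constant function 1 as a 0-form, in the role of a Fock vacuum: contractions annihilate it
    and the [dxw i] create all forms from it. *)
Definition vacuum : cform n T := Form (fun K => (K == set0)%:R).

Lemma interior_vac V : interior V vacuum = 0.
Proof.
apply: big1 => i _; apply: formP => K; rewrite fcZ /= /ctr.
case: ifP => iK; rewrite ?mulr0 //=; case: eqP => [E|_]; last by rewrite !mulr0.
by move: (setU11 i K); rewrite E inE.
Qed.

Definition bform (K : {set 'I_n}) : cform n T := Form (fun L => (L == K)%:R).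

Lemma form_sum u : u = \sum_K fc u K *: bform K.
Proof.
apply: formP => L; rewrite fc_sum (bigD1 L) //= eqxx mulr1 big1 ?addr0 //.
by move=> K neqK; rewrite eq_sym (negbTE neqK) mulr0.
Qed.

Lemma dxw_basis i (K : {set 'I_n}) : i \notin K ->
  dxw i (bform K) = set_sign {fps T[n]} i K *: bform (i |: K).
Proof.
move=> iK; apply: formP => L; rewrite fcZ /= /ext /=.
have [iL|iL] := boolP (i \in L); last first.
  case: eqP => [LE|]; last by rewrite mulr0.
  by case/negP: iL; rewrite LE setU11.
have [->|neq] := eqVneq L (i |: K); first by rewrite setU1K // eqxx.
case: eqP => [LE|]; last by rewrite !mulr0.
by case/eqP: neq; rewrite -LE setD1K.
Qed.

(* Forms are generated from the constant form 1 by multiplication by series and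
   by the operators [dx_i /\ _]. *)
Lemma form_rec (P : cform n T -> Prop) :
    (forall u v, P u -> P v -> P (u + v)) -> (forall p u, P u -> P (p *: u)) ->
    P vacuum -> (forall i u, P u -> P (dxw i u)) ->
  forall u, P u.
Proof.
move=> PD PZ Pv Pdx u; rewrite (form_sum u).
have P0 : P 0 by rewrite -(scale0r vacuum); apply: (PZ _ _ Pv).
apply: (big_ind P P0 PD) => K _; apply: (PZ).
have [m cardK] := ubnP #|K|; elim: m K cardK => // m IHm K.
have [->|[i iK]] := set_0Vmem K; first by [].
rewrite (cardsD1 i) iK ltnS => ltK.
have iKi : i \notin K :\ i by rewrite !inE eqxx.
have -> : bform K = set_sign {fps T[n]} i (K :\ i) *: dxw i (bform (K :\ i)).
  by rewrite dxw_basis // scalerA set_signK scale1r setD1K.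
by apply/PZ/Pdx/IHm.
Qed.

Definition deg_form k u := forall K : {set 'I_n}, #|K| != k -> fc u K = 0.

Lemma deg_vac : deg_form 0 vacuum.
Proof. by move=> K; move=> /negbTE K0; rewrite /= -cards_eq0 K0. Qed.

Lemma deg_form0 k : deg_form k 0. Proof. by []. Qed.

Lemma deg_formD k u v : deg_form k u -> deg_form k v -> deg_form k (u + v).
Proof. by move=> uk vk K cardK; rewrite fcD uk ?vk ?addr0. Qed.

Lemma deg_formZ k p u : deg_form k u -> deg_form k (p *: u).
Proof. by move=> uk K cardK; rewrite fcZ uk ?mulr0. Qed.

Lemma deg_form_sum k (I : Type) (r : seq I) (P : pred I) (F : I -> cform n T) :
  (forall i, deg_form k (F i)) -> deg_form k (\sum_(i <- r | P i) F i).
Proof.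
by move=> Fk; apply: big_ind => [||i _]; [exact: deg_form0 | exact: deg_formD | exact: Fk].
Qed.

Lemma deg_dxw k i u : deg_form k u -> deg_form k.+1 (dxw i u).
Proof.
move=> uk K cardK; rewrite /= /ext; case: ifP => // iK.
by rewrite uk ?mulr0 //; apply: contraNneq cardK => <-; rewrite (cardsD1 i) iK.
Qed.

Lemma deg_cov k a u : deg_form k u -> deg_form k.+1 (cov a u).
Proof. by move=> uk; apply: deg_form_sum => i; apply/deg_formZ/deg_dxw. Qed.

Definition dF u : cform n T :=
  \sum_i dxw i (Form (fun K => fps_deriv i (fc u K))).

End FormModule.

Section Pderiv.
Variables (n : nat) (T : comNzRingType).
Implicit Types (u v : cform n T) (p : {fps T[n]}).

Definition pd (i : 'I_n) u : cform n T := Form (fun K => fps_deriv i (fc u K)).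

Lemma pd_zmod i : zmod_morphism (pd i).
Proof. by move=> u v; apply: formP => K; apply: raddfB. Qed.

HB.instance Definition _ i :=
  GRing.isZmodMorphism.Build (cform n T) (cform n T) (pd i) (pd_zmod i).

Lemma pdZ i p u : pd i (p *: u) = fps_deriv i p *: u + p *: pd i u.
Proof. by apply: formP => K; apply: fps_derivM. Qed.

Lemma pd_dxw i j u : pd i (dxw j u) = dxw j (pd i u).
Proof.
apply: formP => K; rewrite /= /ext; case: ifP => _; last by rewrite raddf0.
by rewrite /set_sign raddfMsign.
Qed.

Lemma pd_vac i : pd i (vacuum n T) = 0.
Proof.
apply: formP => K; rewrite /=; case: eqP => _; last by rewrite raddf0.
by rewrite -(rmorph1 (@fpsC n T)) fps_derivC.
Qed.

Lemma dFE u : dF u = \sum_i dxw i (pd i u). Proof. by []. Qed.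

Lemma dF_zmod : zmod_morphism (@dF n T).
Proof.
by move=> u v; rewrite !dFE -sumrB; apply: eq_bigr => i _; rewrite !raddfB.
Qed.

HB.instance Definition _ :=
  GRing.isZmodMorphism.Build (cform n T) (cform n T) (@dF n T) dF_zmod.

Lemma dFZ p u : dF (p *: u) = cov (fun i => fps_deriv i p) u + p *: dF u.
Proof.
rewrite !dFE scaler_sumr -big_split; apply: eq_bigr => i _ /=.
by rewrite pdZ raddfD /= !(linearZ_LR (dxw i)).
Qed.

End Pderiv.

Lemma card_count (I : finType) (A : {pred I}) : #|A| = count (mem A) (enum I).
Proof. by rewrite enumT cardE /enum_mem size_filter. Qed.

(** * Linear changes of coordinates *)

Section Pullback.
Variables (n : nat) (T : comNzRingType) (M : 'I_n -> 'I_n -> T).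
Implicit Types (u v : cform n T) (p : {fps T[n]}) (I K : {set 'I_n}).

Definition lin (i : 'I_n) : {fps T[n]} := \sum_j fpsC n (M i j) * fpsX T j.

Lemma lin0 i : fcoef (lin i) 0%MM = 0.
Proof.
rewrite fcoef_sum big1 // => j _; rewrite fcoefCM /=.
by rewrite eq_sym mnm1_eq0 mulr0.
Qed.

Definition lsub p := fps_subst p lin.

HB.instance Definition _ :=
  GRing.isZmodMorphism.Build {fps T[n]} {fps T[n]} lsub
    (@fps_substB n n T lin).
HB.instance Definition _ :=
  GRing.isMonoidMorphism.Build {fps T[n]} {fps T[n]} lsub
    (fps_subst_is_monoid lin0).

Lemma lsubC c : lsub (fpsC n c) = fpsC n c.
Proof. exact: (fps_substC lin0). Qed.

Lemma lsubX i : lsub (fpsX T i) = lin i.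
Proof. exact: (fps_substX lin0). Qed.

Lemma lin_deriv i j : fps_deriv j (lin i) = fpsC n (M i j).
Proof.
rewrite raddf_sum (bigD1 j) //= fps_derivCM fps_derivX eqxx mulr1 big1.
  by rewrite addr0.
by move=> k neq_kj; rewrite fps_derivCM fps_derivX eq_sym (negbTE neq_kj) mulr0.
Qed.

Lemma lsub_deriv j p :
  fps_deriv j (lsub p) = \sum_i fpsC n (M i j) * lsub (fps_deriv i p).
Proof.
rewrite (fps_deriv_subst _ _ lin0); apply: eq_bigr => i _.
by rewrite lin_deriv mulrC.
Qed.

(** The components of d([lin i]), which are constant by [lin_deriv]. *)
Definition dlin (i j : 'I_n) : {fps T[n]} := fpsC n (M i j).

Definition pull_fold (s : seq 'I_n) I : cform n T :=
  foldr (fun i u => if i \in I then cov (dlin i) u else u) (vacuum n T) s.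

Definition pull_basis I := pull_fold (enum 'I_n) I.

(** Moving d([lin i]) to its place in the ordered product costs one sign for every smaller index of
    [I]; if it is already there, the square of a 1-form kills the product. *)
Lemma pull_fold_dx i I s : sorted ltn (map val s) ->
  i \in s -> cov (dlin i) (pull_fold s I)
    = if i \in I then 0
      else ((-1) ^+ count (fun j => (j \in I) && (j < i)%N) s)%R *: pull_fold s (i |: I).
Proof.
elim: s => // a s IHs sorted_s.
have lt_as b : b \in s -> (a < b)%N.
  move=> bs; have /(order_path_min ltn_trans) /allP := sorted_s.
  by apply; apply: map_f.
have {}IHs := IHs (path_sorted sorted_s).
have notin_fold b : b \notin s -> pull_fold s (b |: I) = pull_fold s I.
  elim: (s) => //= c r IHr; rewrite inE negb_or => /andP[neq_bc br].
  by rewrite !inE eq_sym (negbTE neq_bc) /= IHr.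
rewrite inE; have [-> _|neq_ia /= is_s] := eqVneq i a.
  have as_ : a \notin s by apply/negP => /lt_as; rewrite ltnn.
  rewrite /= ltnn andbF add0n setU11.
  have -> : count (fun j : 'I_n => (j \in I) && (j < a)%N) s = 0%N.
    apply/eqP; rewrite -leqn0 leqNgt -has_count; apply/hasPn => b /lt_as lt_ab.
    by rewrite ltnNge (ltnW lt_ab) andbF.
  case: ifP => aI; first exact: cov_sq.
  by rewrite expr0 scale1r notin_fold.
have lt_ai := lt_as _ is_s.
rewrite lt_ai andbT !inE [a == i]eq_sym (negbTE neq_ia) /=.
have [aI|aI] := boolP (a \in I); last by rewrite add0n IHs.
rewrite cov_cov (IHs is_s); case: ifP => iI; first by rewrite raddf0 oppr0.
by rewrite (linearZ_LR (cov (dlin a))) add1n exprS mulN1r scaleNr.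
Qed.

Lemma pull_basis_dx i I :
  cov (dlin i) (pull_basis I)
    = if i \in I then 0 else set_sign {fps T[n]} i I *: pull_basis (i |: I).
Proof.
rewrite pull_fold_dx ?mem_enum //; last first.
  by rewrite val_enum_ord (@iota_ltn_sorted 0).
case: ifP => // _; congr ((-1) ^+ _ *: _); rewrite card_count.
by apply: eq_count => j; rewrite /= inE.
Qed.

Lemma deg_pull_basis I : deg_form #|I| (pull_basis I).
Proof.
have -> : #|I| = count (mem I) (enum 'I_n).
  exact: card_count.
rewrite /pull_basis /pull_fold; elim: (enum _) => [|i s IHs] /=.
  exact: deg_vac.
by case: ifP => _; [apply: deg_cov | apply: IHs].
Qed.

Lemma pd_pull_basis j I : pd j (pull_basis I) = 0.
Proof.
rewrite /pull_basis /pull_fold; elim: (enum _) => [|i s IHs] /=.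
  exact: pd_vac.
case: ifP => _ //; rewrite {1}/cov raddf_sum big1 // => k _ /=.
by rewrite pdZ fps_derivC scale0r add0r pd_dxw IHs raddf0 scaler0.
Qed.

Lemma pull_basis0 : pull_basis set0 = vacuum n T.
Proof. by rewrite /pull_basis /pull_fold; elim: (enum _) => //= i s ->; rewrite inE. Qed.

Definition pull u : cform n T := \sum_I lsub (fc u I) *: pull_basis I.

Lemma pull_zmod : zmod_morphism pull.
Proof.
move=> u v; rewrite /pull -sumrB; apply: eq_bigr => I _.
by rewrite fcB rmorphB scalerBl.
Qed.

HB.instance Definition _ :=
  GRing.isZmodMorphism.Build (cform n T) (cform n T) pull pull_zmod.

Lemma pullZ p u : pull (p *: u) = lsub p *: pull u.
Proof.
rewrite /pull scaler_sumr; apply: eq_bigr => I _.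
by rewrite fcZ rmorphM scalerA.
Qed.

Lemma pull_vac : pull (vacuum n T) = vacuum n T.
Proof.
rewrite /pull (bigD1 set0) //= eqxx rmorph1 scale1r pull_basis0 big1 ?addr0 //.
by move=> I /negbTE->; rewrite rmorph0 scale0r.
Qed.

Lemma pull_dxw i u : pull (dxw i u) = cov (dlin i) (pull u).
Proof.
rewrite /pull linear_sum /=.
rewrite (bigID (fun I : {set 'I_n} => i \in I)) /= addrC big1 ?add0r; last first.
  by move=> I iI; rewrite /= /ext (negbTE iI) rmorph0 scale0r.
rewrite [RHS](bigID (fun I : {set 'I_n} => i \in I)) /=.
rewrite [X in _ = X + _]big1 ?add0r; last first.
  by move=> I iI; rewrite (linearZ_LR (cov (dlin i))) /= pull_basis_dx iI scaler0.
rewrite (reindex_onto (fun I => i |: I) (fun I => I :\ i)) /=; last first.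
  by move=> I iI; rewrite setD1K.
apply: eq_big => [I|I /andP[_ /eqP IE]].
  rewrite setU11 /=; apply/eqP/idP => [<-|iI]; first by rewrite !inE eqxx.
  by rewrite setU1K.
have iI : i \notin I by rewrite -IE !inE eqxx.
rewrite (linearZ_LR (cov (dlin i))) /= pull_basis_dx (negbTE iI) /= /ext setU11 setU1K //.
by rewrite rmorphM scalerA mulrC /set_sign rmorph_sign.
Qed.

Lemma pull_cov a u :
  pull (cov a u) = cov (fun j => \sum_i lsub (a i) * dlin i j) (pull u).
Proof.
rewrite /cov raddf_sum.
under eq_bigr => i _ do rewrite /= pullZ pull_dxw /cov scaler_sumr.
rewrite exchange_big /=; apply: eq_bigr => j _.
by rewrite scaler_suml; apply: eq_bigr => i _; rewrite scalerA.
Qed.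

Lemma pd_pull j u : pd j (pull u) = \sum_i dlin i j *: pull (pd i u).
Proof.
rewrite /pull raddf_sum /=.
under [RHS]eq_bigr => i _ do rewrite scaler_sumr.
rewrite exchange_big /=; apply: eq_bigr => I _.
rewrite pdZ pd_pull_basis scaler0 addr0 lsub_deriv scaler_suml.
by apply: eq_bigr => i _; rewrite scalerA.
Qed.

Lemma pull_dF u : pull (dF u) = dF (pull u).
Proof.
rewrite !dFE raddf_sum /=.
under eq_bigr => i _ do rewrite pull_dxw /cov.
under [RHS]eq_bigr => j _ do rewrite pd_pull linear_sum.
rewrite exchange_big /=; apply: eq_bigr => j _; apply: eq_bigr => i _.
by rewrite (linearZ_LR (dxw j)).
Qed.

(** The hypothesis says that the differential of the linear map sends [V'] to [V]. Since
    contractions satisfy the same recursion against [dxw] and kill the constant form 1, [form_rec]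
    reduces the claim to the pairing of V with dx_i. *)
Lemma pull_interior V V' u :
    (forall i, lsub (V i) = \sum_j dlin i j * V' j) ->
  pull (interior V u) = interior V' (pull u).
Proof.
move=> VV'; elim/form_rec: u => [u v IHu IHv|p u IHu||i u IHu].
- by rewrite !raddfD /= IHu IHv.
- by rewrite (linearZ_LR (interior V)) !pullZ (linearZ_LR (interior V')) IHu.
- by rewrite interior_vac raddf0 pull_vac interior_vac.
rewrite interior_dxw raddfB /= pullZ !pull_dxw interior_cov IHu VV'.
by congr (_ *: _ - _); apply: eq_bigr => j _; rewrite mulrC.
Qed.

Lemma deg_pull k u : deg_form k u -> deg_form k (pull u).
Proof.
move=> uk; apply: deg_form_sum => I.
have [/eqP <-|/uk->] := boolP (#|I| == k); first exact/deg_formZ/deg_pull_basis.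
by rewrite rmorph0 scale0r; apply: deg_form0.
Qed.

End Pullback.

Lemma lsubK n (T : comNzRingType) (M N : 'I_n -> 'I_n -> T) :
    (forall i j, \sum_k M i k * N k j = (i == j)%:R) ->
  cancel (lsub M) (lsub N).
Proof.
move=> MN p; rewrite /lsub fps_subst_comp; try exact: lin0.
rewrite -[RHS]fps_subst_id; congr fps_subst; apply/funext => i.
rewrite -/(lsub N (lin M i)) rmorph_sum.
under eq_bigr => k _ do rewrite rmorphM /= lsubC lsubX /lin mulr_sumr.
rewrite exchange_big /= (bigD1 i) //= [X in _ + X]big1 => [|j neq_ji].
  under eq_bigr => k _ do rewrite mulrA -rmorphM.
  by rewrite -mulr_suml -rmorph_sum MN eqxx rmorph1 mul1r addr0.
under eq_bigr => k _ do rewrite mulrA -rmorphM.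
by rewrite -mulr_suml -rmorph_sum MN eq_sym (negbTE neq_ji) rmorph0 mul0r.
Qed.

Lemma pullK n (T : comNzRingType) (M N : 'I_n -> 'I_n -> T) :
    (forall i j, \sum_k M i k * N k j = (i == j)%:R) ->
  cancel (pull M) (pull N).
Proof.
move=> MN u; elim/form_rec: u => [u v IHu IHv|p u IHu||i u IHu].
- by rewrite !raddfD /= IHu IHv.
- by rewrite !pullZ IHu (lsubK MN).
- by rewrite !pull_vac.
rewrite pull_dxw pull_cov IHu /cov (bigD1 i) //= [X in _ + X]big1 => [|j neq_ji].
  rewrite -[RHS]scale1r addr0; congr (_ *: _).
  under eq_bigr => k _ do rewrite lsubC -rmorphM.
  by rewrite -rmorph_sum MN eqxx rmorph1.
under eq_bigr => k _ do rewrite lsubC -rmorphM.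
by rewrite -rmorph_sum MN eq_sym (negbTE neq_ji) rmorph0 scale0r.
Qed.

(** * Translation between [dform] and [cform] *)

Section Translate.
Variables (n : nat) (T : comNzRingType).
Implicit Types (w : dform n T) (u v : cform n T) (p : {fps T[n]}).

Definition toF w : cform n T := Form (fun K => w K).
Definition ofF u : dform n T := [ffun K => fc u K].

Lemma ofFK u : toF (ofF u) = u.
Proof. by apply: formP => K; rewrite /= ffunE. Qed.

Lemma toF_inj : injective toF.
Proof. by move=> w w' /(congr1 (@fc _ _)) E; apply/ffunP => K; exact: (congr1 (fun f => f K) E). Qed.

Lemma toF_zmod : zmod_morphism toF.
Proof. by move=> w w'; apply: formP => K; rewrite /= !ffunE. Qed.

HB.instance Definition _ :=
  GRing.isZmodMorphism.Build (dform n T) (cform n T) toF toF_zmod.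

Lemma toFZ p w : toF (p *: w) = p *: toF w.
Proof. by apply: formP => K; apply: dformZE. Qed.

Definition wf u v : cform n T := Form (fun K => \sum_(I : {set 'I_n} | I \subset K)
  (-1) ^+ inversions I (K :\: I) * (fc u I * fc v (K :\: I))).

Lemma toF_wedge w w' : toF (w ∧ w') = wf (toF w) (toF w').
Proof. by apply: formP => K; rewrite /= ffunE. Qed.

Lemma wfDl u u' v : wf (u + u') v = wf u v + wf u' v.
Proof.
apply: formP => K; rewrite fcD -big_split; apply: eq_bigr => I _.
by rewrite fcD mulrDl mulrDr.
Qed.

Lemma wfZl p u v : wf (p *: u) v = p *: wf u v.
Proof.
apply: formP => K; rewrite fcZ mulr_sumr; apply: eq_bigr => I _.
by rewrite fcZ -mulrA mulrCA.
Qed.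

Lemma wf_is_linear u : linear (wf u).
Proof.
move=> p v v'; apply: formP => K; rewrite fcD fcZ mulr_sumr -big_split.
apply: eq_bigr => I _ /=; rewrite mulrDr mulrDr; congr (_ + _).
by rewrite [fc u I * _]mulrCA [LHS]mulrCA.
Qed.

HB.instance Definition _ u :=
  GRing.isLinear.Build {fps T[n]} (cform n T) (cform n T) _ (wf u) (wf_is_linear u).

Lemma wf0l v : wf 0 v = 0.
Proof. by have := wfZl 0 0 v; rewrite !scale0r. Qed.

Lemma toF_vac : toF (form_basis T set0) = vacuum n T.
Proof. by apply: formP => K; rewrite /= ffunE eq_sym. Qed.

Lemma toF_dxw i w : toF (dx T i ∧ w) = dxw i (toF w).
Proof. by apply: formP => K; rewrite /= wedge_dxE. Qed.

Lemma toF_dx i : toF (dx T i) = dxw i (vacuum n T).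
Proof.
apply: formP => K; rewrite /= ffunE /ext.
have [iK|iK] := boolP (i \in K); last first.
  by case: eqP => // KE; case/negP: iK; rewrite -KE set11.
have [->|neq] := eqVneq K [set i].
  rewrite setDv eqxx mulr1 /set_sign (_ : [set j in set0 | _] = set0) ?cards0 //.
  by apply/setP => j; rewrite !inE.
case: eqP => [K0|]; last by rewrite mulr0.
by case/eqP: neq; rewrite -(setD1K iK) K0 setU0.
Qed.

Lemma wf_dxw i v : wf (dxw i (vacuum n T)) v = dxw i v.
Proof. by rewrite -(ofFK v) -toF_dx -toF_wedge toF_dxw. Qed.

Lemma wf_cov a v : wf (cov a (vacuum n T)) v = cov a v.
Proof.
rewrite /cov; apply: (big_ind2 (fun u u' => wf u v = u')) => [|? ? ? ? <- <-|i _].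
- exact: wf0l.
- exact: wfDl.
by rewrite wfZl wf_dxw.
Qed.

Lemma toF_ctw i w : toF (contract i w) = ctw i (toF w).
Proof. by apply: formP => K; rewrite /= ffunE. Qed.

Lemma toF_dR w : toF (dR w) = dF (toF w).
Proof.
rewrite /dR raddf_sum; apply: eq_bigr => i _ /=; rewrite toF_dxw.
by congr dxw; apply: formP => K; rewrite /= ffunE.
Qed.

Lemma toF_form0 p : toF (form0 p) = p *: vacuum n T.
Proof. by rewrite toFZ toF_vac. Qed.

Lemma dF_vac : dF (vacuum n T) = 0.
Proof. by rewrite dFE big1 // => i _; rewrite pd_vac raddf0. Qed.

Lemma toF_dR0 p : toF (dR (form0 p)) = cov (fun i => fps_deriv i p) (vacuum n T).
Proof. by rewrite toF_dR toF_form0 dFZ dF_vac scaler0 addr0. Qed.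

Definition ctw2 (B : 'I_n -> 'I_n -> {fps T[n]}) u : cform n T :=
  \sum_(i < n) \sum_(j < n | (i < j)%N) B i j *: ctw j (ctw i u).

Lemma toF_contract2 B w : toF (contract2 B w) = ctw2 B (toF w).
Proof.
rewrite /contract2 raddf_sum; apply: eq_bigr => i _.
rewrite raddf_sum; apply: eq_bigr => j _ /=.
by rewrite toFZ !toF_ctw.
Qed.

Lemma is_formE k w : is_form k w <-> deg_form k (toF w).
Proof. by []. Qed.

Lemma ctw_sq i u : ctw i (ctw i u) = 0.
Proof.
apply: formP => K; rewrite /= /ctr /=; case: ifP => //.
by rewrite setU11 mulr0.
Qed.

(** A decomposable bivector contracts as the composition of two vector contractions; this turns the
    Poisson contraction into operators with good commutation rules. *)
Lemma ctw2_interior (V W : 'I_n -> {fps T[n]}) u :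
  ctw2 (fun i j => V i * W j - V j * W i) u = interior W (interior V u).
Proof.
pose G i j := (V i * W j) *: ctw j (ctw i u).
have -> : interior W (interior V u) = \sum_i \sum_j G i j.
  rewrite exchange_big; apply: eq_bigr => j _.
  rewrite /interior linear_sum scaler_sumr; apply: eq_bigr => i _ /=.
  by rewrite (linearZ_LR (ctw j)) scalerA mulrC.
(* One side sums over i < j and the other over all pairs; the discrepancy is arranged as a family
   that cancels between (i, j) and (j, i). *)
pose H (i j : 'I_n) :=
  (if (i < j)%N then (V i * W j - V j * W i) *: ctw j (ctw i u) else 0) - G i j.
apply/eqP; rewrite -subr_eq0; apply/eqP.
suff <- : \sum_i \sum_j H i j = ctw2 (fun i j => V i * W j - V j * W i) u
                                  - \sum_i \sum_j G i j.
  apply: sum_skew => [i|i j]; first by rewrite /H /G ltnn ctw_sq scaler0 subr0.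
  rewrite /H /G; case: ltngtP => [_|_|/val_inj->].
  - by rewrite sub0r (ctw_ctw i j) scalerN opprK scalerBl addrAC subrK subrr.
  - by rewrite sub0r (ctw_ctw j i) scalerN opprK scalerBl addrA [X in X - _]addrC subrK subrr.
  - by rewrite ctw_sq !scaler0 subr0 addr0.
rewrite -sumrB; apply: eq_bigr => i _; rewrite sumrB; congr (_ - _).
by rewrite [RHS]big_mkcond.
Qed.

End Translate.

(** * Change of scalars for forms *)

Section FormMap.
Variables (n : nat) (T T' : comNzRingType).

Definition fmap (c : T -> T') (u : cform n T) : cform n T' :=
  Form (fun K => fps_map c (fc u K)).

Lemma fmap_zmod (c : {additive T -> T'}) : zmod_morphism (fmap c).
Proof. by move=> u v; apply: formP => K; apply: raddfB. Qed.

HB.instance Definition _ (c : {additive T -> T'}) :=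
  GRing.isZmodMorphism.Build (cform n T) (cform n T') (fmap c) (fmap_zmod c).

Lemma fmap_dxw (c : {additive T -> T'}) i u : fmap c (dxw i u) = dxw i (fmap c u).
Proof.
apply: formP => K; rewrite /= /ext; case: ifP => _; last by rewrite raddf0.
by rewrite /set_sign raddfMsign.
Qed.

Lemma fmap_ctw (c : {additive T -> T'}) i u : fmap c (ctw i u) = ctw i (fmap c u).
Proof.
apply: formP => K; rewrite /= /ctr; case: ifP => _; first by rewrite raddf0.
by rewrite /set_sign raddfMsign.
Qed.

Lemma fmap_pd (c : {additive T -> T'}) i u : fmap c (pd i u) = pd i (fmap c u).
Proof. by apply: formP => K; apply: fps_map_deriv. Qed.

Lemma fmap_dF (c : {additive T -> T'}) u : fmap c (dF u) = dF (fmap c u).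
Proof.
rewrite !dFE raddf_sum; apply: eq_bigr => i _ /=.
by rewrite fmap_dxw fmap_pd.
Qed.

Lemma deg_fmap (c : {additive T -> T'}) k u : deg_form k u -> deg_form k (fmap c u).
Proof. by move=> uk K /uk /= ->; rewrite raddf0. Qed.

End FormMap.

Section FormMapMorph.
Variables (n : nat) (T T' : comNzRingType) (c : {rmorphism T -> T'}).
Implicit Types (u v : cform n T) (p : {fps T[n]}).

Lemma fmapZ p u : fmap c (p *: u) = fps_map c p *: fmap c u.
Proof. by apply: formP => K; apply: rmorphM. Qed.

Lemma fmap_vac : fmap c (vacuum n T) = vacuum n T'.
Proof. by apply: formP => K; rewrite /= rmorph_nat. Qed.

Lemma fmap_cov a u : fmap c (cov a u) = cov (fun i => fps_map c (a i)) (fmap c u).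
Proof.
rewrite /cov raddf_sum; apply: eq_bigr => i _ /=.
by rewrite fmapZ fmap_dxw.
Qed.

Variable r : {additive T' -> T}.
Hypothesis rM : forall a b, r (c a * b) = a * r b.

Lemma fmap_projZ p (z : cform n T') : fmap r (fps_map c p *: z) = p *: fmap r z.
Proof. by apply: formP => K; apply: fps_projM. Qed.

Lemma fmap_projZr (q : {fps T'[n]}) u : fmap r (q *: fmap c u) = fps_map r q *: u.
Proof.
by apply: formP => K; rewrite /= mulrC (fps_projM rM) mulrC.
Qed.

End FormMapMorph.

(** * Computation with subsets of four indices *)

Section Coordinates4.

Definition o0 : 'I_4 := inord 0.
Definition o1 : 'I_4 := inord 1.
Definition o2 : 'I_4 := inord 2.
Definition o3 : 'I_4 := inord 3.

Lemma o0E : o0 = 0%N :> nat. Proof. exact: inordK. Qed.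
Lemma o1E : o1 = 1%N :> nat. Proof. exact: inordK. Qed.
Lemma o2E : o2 = 2%N :> nat. Proof. exact: inordK. Qed.
Lemma o3E : o3 = 3%N :> nat. Proof. exact: inordK. Qed.
Definition oE := (o0E, o1E, o2E, o3E).

Lemma ord4P (P : 'I_4 -> Prop) : P o0 -> P o1 -> P o2 -> P o3 -> forall i, P i.
Proof.
move=> P0 P1 P2 P3 [[|[|[|[|//]]]] lt_i]; [move: P0|move: P1|move: P2|move: P3];
  by congr P; apply: val_inj; rewrite /= oE.
Qed.

Lemma sum4 (V : nmodType) (F : 'I_4 -> V) :
  \sum_i F i = F o0 + F o1 + F o2 + F o3.
Proof.
rewrite !big_ord_recl big_ord0 addr0 !addrA.
by congr (_ + _ + _ + _); congr F; apply: val_inj; rewrite /= oE.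
Qed.

Lemma sum4n (F : 'I_4 -> nat) : (\sum_i F i = F o0 + F o1 + F o2 + F o3)%N.
Proof. by rewrite -[LHS]/(\sum_i F i)%R sum4. Qed.

(** Subsets given by four booleans make membership, insertion, deletion and signs computable, so
    that components of explicit forms can be evaluated. *)
Definition set4 (b0 b1 b2 b3 : bool) : {set 'I_4} :=
  [set i | nth false [:: b0; b1; b2; b3] (val i)].

Lemma set4_o0 b0 b1 b2 b3 : (o0 \in set4 b0 b1 b2 b3) = b0.
Proof. by rewrite inE /= oE. Qed.
Lemma set4_o1 b0 b1 b2 b3 : (o1 \in set4 b0 b1 b2 b3) = b1.
Proof. by rewrite inE /= oE. Qed.
Lemma set4_o2 b0 b1 b2 b3 : (o2 \in set4 b0 b1 b2 b3) = b2.
Proof. by rewrite inE /= oE. Qed.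
Lemma set4_o3 b0 b1 b2 b3 : (o3 \in set4 b0 b1 b2 b3) = b3.
Proof. by rewrite inE /= oE. Qed.
Definition set4E := (set4_o0, set4_o1, set4_o2, set4_o3).

Lemma set4P (K : {set 'I_4}) :
  K = set4 (o0 \in K) (o1 \in K) (o2 \in K) (o3 \in K).
Proof. by apply/setP; apply: ord4P; rewrite set4E. Qed.

Lemma set4_D0 b0 b1 b2 b3 : set4 b0 b1 b2 b3 :\ o0 = set4 false b1 b2 b3.
Proof. by apply/setP; apply: ord4P; rewrite in_setD1 !set4E -val_eqE /= !oE. Qed.
Lemma set4_D1 b0 b1 b2 b3 : set4 b0 b1 b2 b3 :\ o1 = set4 b0 false b2 b3.
Proof. by apply/setP; apply: ord4P; rewrite in_setD1 !set4E -val_eqE /= !oE. Qed.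
Lemma set4_D2 b0 b1 b2 b3 : set4 b0 b1 b2 b3 :\ o2 = set4 b0 b1 false b3.
Proof. by apply/setP; apply: ord4P; rewrite in_setD1 !set4E -val_eqE /= !oE. Qed.
Lemma set4_D3 b0 b1 b2 b3 : set4 b0 b1 b2 b3 :\ o3 = set4 b0 b1 b2 false.
Proof. by apply/setP; apply: ord4P; rewrite in_setD1 !set4E -val_eqE /= !oE. Qed.

Lemma set4_U0 b0 b1 b2 b3 : o0 |: set4 b0 b1 b2 b3 = set4 true b1 b2 b3.
Proof. by apply/setP; apply: ord4P; rewrite in_setU1 !set4E -val_eqE /= !oE. Qed.
Lemma set4_U1 b0 b1 b2 b3 : o1 |: set4 b0 b1 b2 b3 = set4 b0 true b2 b3.
Proof. by apply/setP; apply: ord4P; rewrite in_setU1 !set4E -val_eqE /= !oE. Qed.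
Lemma set4_U2 b0 b1 b2 b3 : o2 |: set4 b0 b1 b2 b3 = set4 b0 b1 true b3.
Proof. by apply/setP; apply: ord4P; rewrite in_setU1 !set4E -val_eqE /= !oE. Qed.
Lemma set4_U3 b0 b1 b2 b3 : o3 |: set4 b0 b1 b2 b3 = set4 b0 b1 b2 true.
Proof. by apply/setP; apply: ord4P; rewrite in_setU1 !set4E -val_eqE /= !oE. Qed.

Lemma set_sign4 (A : comNzRingType) i b0 b1 b2 b3 :
  set_sign A i (set4 b0 b1 b2 b3)
    = (-1) ^+ (nth 0 [:: 0; nat_of_bool b0; b0 + b1; b0 + b1 + b2] i)%N.
Proof.
rewrite /set_sign -sum1_card big_mkcond sum4n /=.
rewrite !inE /= !oE /=; congr (_ ^+ _).
move: i; apply: ord4P; rewrite !oE /= ?ltnn ?andbF ?andbT;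
  by case: b0 b1 b2 => [] [] [].
Qed.

Section Ext4.
Variables (A : comNzRingType) (w : {set 'I_4} -> A) (b0 b1 b2 b3 : bool).

Lemma ext40 : ext o0 w (set4 b0 b1 b2 b3)
  = if b0 then w (set4 false b1 b2 b3) else 0.
Proof. by rewrite /ext set4E set4_D0 set_sign4 oE /= expr0 mul1r. Qed.
Lemma ext41 : ext o1 w (set4 b0 b1 b2 b3)
  = if b1 then (-1) ^+ b0 * w (set4 b0 false b2 b3) else 0.
Proof. by rewrite /ext set4E set4_D1 set_sign4 oE. Qed.
Lemma ext42 : ext o2 w (set4 b0 b1 b2 b3)
  = if b2 then (-1) ^+ (b0 + b1) * w (set4 b0 b1 false b3) else 0.
Proof. by rewrite /ext set4E set4_D2 set_sign4 oE. Qed.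
Lemma ext43 : ext o3 w (set4 b0 b1 b2 b3)
  = if b3 then (-1) ^+ (b0 + b1 + b2) * w (set4 b0 b1 b2 false) else 0.
Proof. by rewrite /ext set4E set4_D3 set_sign4 oE. Qed.

Lemma ctr40 : ctr o0 w (set4 b0 b1 b2 b3)
  = if b0 then 0 else w (set4 true b1 b2 b3).
Proof. by rewrite /ctr set4E set4_U0 set_sign4 oE /= expr0 mul1r. Qed.
Lemma ctr41 : ctr o1 w (set4 b0 b1 b2 b3)
  = if b1 then 0 else (-1) ^+ b0 * w (set4 b0 true b2 b3).
Proof. by rewrite /ctr set4E set4_U1 set_sign4 oE. Qed.
Lemma ctr42 : ctr o2 w (set4 b0 b1 b2 b3)
  = if b2 then 0 else (-1) ^+ (b0 + b1) * w (set4 b0 b1 true b3).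
Proof. by rewrite /ctr set4E set4_U2 set_sign4 oE. Qed.
Lemma ctr43 : ctr o3 w (set4 b0 b1 b2 b3)
  = if b3 then 0 else (-1) ^+ (b0 + b1 + b2) * w (set4 b0 b1 b2 true).
Proof. by rewrite /ctr set4E set4_U3 set_sign4 oE. Qed.

End Ext4.

Lemma set4_full : [set: 'I_4] = set4 true true true true.
Proof. by apply/setP; apply: ord4P; rewrite set4E inE. Qed.

Lemma set4_0 : set0 = set4 false false false false.
Proof. by apply/setP; apply: ord4P; rewrite set4E inE. Qed.

Lemma set4_eq0 b0 b1 b2 b3 :
  (set4 b0 b1 b2 b3 == set0) = [&& ~~ b0, ~~ b1, ~~ b2 & ~~ b3].
Proof.
apply/eqP/and4P => [E|[/negbTE-> /negbTE-> /negbTE-> /negbTE->]]; last by rewrite set4_0.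
move: (set4_o0 b0 b1 b2 b3) (set4_o1 b0 b1 b2 b3) (set4_o2 b0 b1 b2 b3).
by move: (set4_o3 b0 b1 b2 b3); rewrite E !inE => <- <- <- <-.
Qed.

Lemma card_set4 b0 b1 b2 b3 : #|set4 b0 b1 b2 b3| = (b0 + b1 + b2 + b3)%N.
Proof.
rewrite -sum1_card big_mkcond sum4n /= !inE /= !oE /=.
by case: b0 b1 b2 b3 => [] [] [] [].
Qed.

End Coordinates4.

(** * Logarithmic coefficients *)

Section CliffordVector.
Variables (n : nat) (A : comNzRingType).
Implicit Types (w : {set 'I_n} -> A) (a e : 'I_n -> A) (K : {set 'I_n}).

Definition extv e w K := \sum_i e i * ext i w K.
Definition ctrv a w K := \sum_i a i * ctr i w K.

Lemma ctrv_ext a j w K : ctrv a (ext j w) K = a j * w K - ext j (ctrv a w) K.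
Proof.
rewrite /ctrv ext_sum; apply/eqP; rewrite eq_sym subr_eq -big_split /=; apply/eqP.
under eq_bigr => i _ do rewrite -mulrDr ctr_ext.
rewrite (bigD1 j) //= eqxx mul1r big1 => [|i /negbTE->]; first by rewrite addr0.
by rewrite mul0r mulr0.
Qed.

Lemma ctrv_extv a e w K :
  ctrv a (extv e w) K = (\sum_i a i * e i) * w K - extv e (ctrv a w) K.
Proof.
have -> : ctrv a (extv e w) K = \sum_j e j * ctrv a (ext j w) K.
  rewrite /ctrv; under eq_bigr => i _ do rewrite ctr_sum mulr_sumr.
  rewrite exchange_big; apply: eq_bigr => j _ /=.
  by rewrite mulr_sumr; apply: eq_bigr => i _; rewrite mulrCA.
rewrite /extv mulr_suml -sumrB; apply: eq_bigr => j _.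
by rewrite ctrv_ext mulrBr mulrCA mulrA.
Qed.

Lemma ctrvB a w w' K : ctrv a (fun L => w L - w' L) K = ctrv a w K - ctrv a w' K.
Proof.
rewrite /ctrv -sumrB; apply: eq_bigr => i _; rewrite -mulrBr; congr (_ * _).
by rewrite /ctr; case: ifP => _; rewrite ?subr0 // mulrBr.
Qed.

Lemma ctrvZ a c w K : ctrv a (fun L => c * w L) K = c * ctrv a w K.
Proof.
rewrite /ctrv mulr_sumr; apply: eq_bigr => i _; rewrite mulrCA; congr (_ * _).
by rewrite /ctr; case: ifP => _; rewrite ?mulr0 // mulrCA.
Qed.

Lemma eq_ctrv a w w' : w =1 w' -> ctrv a w =1 ctrv a w'.
Proof. by move=> ww' K; apply: eq_bigr => i _; rewrite (eq_ctr i ww'). Qed.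

Lemma eq_extv a w w' : w =1 w' -> extv a w =1 extv a w'.
Proof. by move=> ww' K; apply: eq_bigr => i _; rewrite (eq_ext i ww'). Qed.

End CliffordVector.

Section LogCoef.
Variables (n : nat) (T : comNzRingType).
Implicit Types (u v : cform n T) (f : {fps T[n]}) (al be m : 'X_{1..n}).
Implicit Types (I K : {set 'I_n}).

(** The exponent relating the two bases: dX_K is X^([mind K]) times the product of the dlog X_i for
    i in K. *)
Definition mind K : 'X_{1..n} := [multinom (i \in K : nat) | i < n].

Lemma mindU i K : i \notin K -> mind (i |: K) = (mind K + U_(i))%MM.
Proof.
move=> iK; apply/mnmP => j; rewrite mnmDE !mnmE !inE eq_sym.
by case: eqP => [<-|_]; rewrite ?(negbTE iK) ?addn0.
Qed.

Lemma mind0 : mind set0 = 0%MM.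
Proof. by apply/mnmP => j; rewrite !mnmE inE. Qed.

(* The coefficient of [X^al] in [X^be * f]. *)
Definition shcoef f al be := if (be <= al)%MM then fcoef f (al - be)%MM else 0.

Lemma shcoef0 f al : shcoef f al 0%MM = fcoef f al.
Proof.
rewrite /shcoef (_ : (0 <= al)%MM); first by rewrite subm0.
by apply/mnm_lepP => i; rewrite mnm0E.
Qed.

Lemma shcoefB f g al be : shcoef (f - g) al be = shcoef f al be - shcoef g al be.
Proof. by rewrite /shcoef; case: ifP; rewrite ?subr0. Qed.

Lemma shcoefCM c f al be : shcoef (fpsC n c * f) al be = c * shcoef f al be.
Proof. by rewrite /shcoef fcoefCM; case: ifP; rewrite ?mulr0. Qed.

Lemma lemDU al be i :
  ((be + U_(i))%MM <= al)%MM = (be <= al)%MM && (0 < (al - be)%MM i)%N.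
Proof.
apply/mnm_lepP/andP => [le|[/mnm_lepP le lt0] j].
  split; last by have := le i; rewrite mnmDE mnmBE mnm1E eqxx addn1 subn_gt0.
  by apply/mnm_lepP => j; apply: leq_trans (le j); rewrite mnmDE leq_addr.
rewrite mnmDE mnm1E; case: eqP lt0 => [<-|_ _]; last by rewrite addn0.
by rewrite addn1 mnmBE subn_gt0.
Qed.

Lemma submU al be i : (al - (be + U_(i)) = al - be - U_(i))%MM.
Proof. by apply/mnmP => j; rewrite !(mnmBE, mnmDE) subnDA. Qed.

Lemma shcoefXM i f al be :
  shcoef (fpsX T i * f) al be = shcoef f al (be + U_(i))%MM.
Proof.
rewrite /shcoef lemDU fcoefXM submU; case: ifP => //= le.
Qed.

(** X_i d/dX_i multiplies a monomial by its exponent. The truncated subtraction is exact whenever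
    the coefficient on the right is not zero by definition. *)
Lemma shcoef_deriv i f al be : shcoef (fps_deriv i f) al (be + U_(i))%MM
  = (al i - be i)%:R * shcoef f al be.
Proof.
rewrite /shcoef lemDU; case: (boolP (be <= al)%MM) => [le|_] /=; last by rewrite mulr0.
rewrite mnmBE; case: posnP => [->|lt0]; first by rewrite mul0r.
rewrite submU submK; last by rewrite lep1mP mnmBE -lt0n.
rewrite mnmBE mnm1E eqxx subn1 mnmBE prednK // mulr_natl.
by [].
Qed.

(* The coefficient of X^al in the logarithmic component of [u] at [K], that is,
   with respect to the forms dX_i / X_i. *)
Definition lc u al K := shcoef (fc u K) al (mind K).

Lemma fcoef_lc u K m : fcoef (fc u K) m = lc u (m + mind K)%MM K.
Proof. by rewrite /lc /shcoef lem_addl addmK. Qed.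

Lemma lcP u v : (forall al, lc u al =1 lc v al) -> u = v.
Proof. by move=> uv; apply: formP => K; apply: fpsP => m; rewrite !fcoef_lc uv. Qed.

Lemma lcB u v al K : lc (u - v) al K = lc u al K - lc v al K.
Proof. exact: shcoefB. Qed.

Lemma lc0 al K : lc 0 al K = 0.
Proof. by rewrite -(subrr 0) lcB subrr. Qed.

Lemma lcD u v al K : lc (u + v) al K = lc u al K + lc v al K.
Proof. by rewrite -{1}[v]opprK lcB -[- v]sub0r lcB lc0 sub0r opprK. Qed.

Lemma lc_sum (I : Type) (r : seq I) (P : pred I) (F : I -> cform n T) al K :
  lc (\sum_(i <- r | P i) F i) al K = \sum_(i <- r | P i) lc (F i) al K.
Proof.
by apply: (big_morph (fun u => lc u al K)) => [u v|]; [exact: lcD | exact: lc0].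
Qed.

Lemma lcCZ c u al K : lc (fpsC n c *: u) al K = c * lc u al K.
Proof. exact: shcoefCM. Qed.

Lemma shcoefMsign f k al be : shcoef ((-1) ^+ k * f) al be = (-1) ^+ k * shcoef f al be.
Proof. by rewrite -shcoefCM rmorph_sign. Qed.

(** X_i d/dX_i is dual to dlog X_i, so this contraction preserves the degree and has constant
    coefficients. *)
Lemma lc_Xctw i u al K : lc (fpsX T i *: ctw i u) al K = ctr i (lc u al) K.
Proof.
rewrite /lc fcZ shcoefXM /= /ctr; case: ifP => iK.
  by rewrite /shcoef; case: ifP.
by rewrite /set_sign shcoefMsign mindU ?iK.
Qed.

(** The dlog X_i are closed and dX^al is X^al times the sum of the al_i dlog X_i. *)
Lemma lc_dF u al K : lc (dF u) al K = extv (fun i => (al i)%:R) (lc u al) K.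
Proof.
rewrite dFE lc_sum; apply: eq_bigr => i _; rewrite /lc /= /ext.
case: ifP => iK; last by rewrite mulr0 /shcoef; case: ifP.
rewrite /set_sign shcoefMsign -[in mind K](setD1K iK) mindU ?inE ?eqxx //.
by rewrite shcoef_deriv mnmE !inE eqxx subn0 mulrCA.
Qed.

(** A component along dX_i is divisible by X_i once it is written along dlog X_i. *)
Lemma lc_supp u al K i : i \in K -> al i = 0%N -> lc u al K = 0.
Proof.
move=> iK al0; rewrite /lc /shcoef; case: mnm_lepP => // /(_ i).
by rewrite mnmE iK al0.
Qed.

Lemma lc_deg k u al K : deg_form k u -> #|K| != k -> lc u al K = 0.
Proof. by move=> uk cardK; rewrite /lc uk // /shcoef; case: ifP. Qed.

Definition of_lc (c : 'X_{1..n} -> {set 'I_n} -> T) : cform n T :=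
  Form (fun K => Fps (fun m => c (m + mind K)%MM K)).

(** The condition of [lc_supp] is the only one: logarithmic coefficients that satisfy it are those
    of a regular form. *)
Lemma lc_of_lc c al K :
  (forall i, i \in K -> al i = 0%N -> c al K = 0) -> lc (of_lc c) al K = c al K.
Proof.
move=> c_supp; rewrite /lc /shcoef; case: mnm_lepP => [le|nle] /=.
  by rewrite submK //; apply/mnm_lepP.
have [i iK ali] : exists2 i, i \in K & al i = 0%N.
  have [i /andP[iK /eqP al0]|none] := pickP (fun i => (i \in K) && (al i == 0%N)).
    by exists i.
  case: nle => i; rewrite mnmE; have := none i.
  by case: (i \in K) => //= /negbT; rewrite lt0n.
by rewrite (c_supp i).
Qed.

End LogCoef.

(** * Homology of a product of two diagonal linear fields *)

Section LogHomology.
Variables (n : nat) (T : fieldType) (a b : 'I_n -> T).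
Implicit Types (u v : cform n T) (al : 'X_{1..n}) (K : {set 'I_n}).

Definition logfield (c : 'I_n -> T) i : {fps T[n]} := fpsC n (c i) * fpsX T i.
(* The bivector is a /\ b for the fields a = \sum_i a_i X_i d/dX_i and b. *)
Definition log_pi u := interior (logfield b) (interior (logfield a) u).
Definition log_delta u := log_pi (dF u) - dF (log_pi u).

Definition wt (c : 'I_n -> T) al : T := \sum_i c i * (al i)%:R.
Definition zfield al i : T := wt a al * b i - wt b al * a i.
(** Only the directions with al_i > 0 matter: for the others there is no dlog X_i to contract with,
    and multiplying by dlog X_i would leave the regular forms. *)
Definition special al := [forall i, (0 < al i)%N ==> (zfield al i == 0)].

Lemma lc_interior c u al K :
  lc (interior (logfield c) u) al K = ctrv c (lc u al) K.
Proof.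
rewrite /interior lc_sum; apply: eq_bigr => i _.
by rewrite -scalerA lcCZ lc_Xctw.
Qed.

(* In degree [al], [dF] is the exterior product with the covector [al], and the
   interior products with it commute up to the weights [wt a al], [wt b al]. *)
Lemma lc_delta u al K : lc (log_delta u) al K = ctrv (zfield al) (lc u al) K.
Proof.
rewrite lcB lc_dF /log_pi lc_interior.
rewrite (eq_ctrv _ (lc_interior _ _ _)).
rewrite (eq_ctrv _ (eq_ctrv _ (lc_dF _ _))).
rewrite (eq_ctrv _ (ctrv_extv _ _ _)) ctrvB ctrvZ ctrv_extv.
rewrite (eq_extv _ (lc_interior _ _ _)).
rewrite (eq_extv _ (eq_ctrv _ (lc_interior _ _ _))).
rewrite opprB addrA addrAC addrK /ctrv !mulr_sumr -sumrB.
by apply: eq_bigr => i _; rewrite /zfield /wt mulrBl !mulrA.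
Qed.

Lemma ctr_lc_supp i u al K : al i = 0%N -> ctr i (lc u al) K = 0.
Proof.
move=> al0; rewrite /ctr; case: ifP => // _.
by rewrite (@lc_supp _ _ _ _ _ i) ?setU11 ?mulr0.
Qed.

Lemma lc_delta_special u al K : special al -> lc (log_delta u) al K = 0.
Proof.
move=> /forallP sp; rewrite lc_delta /ctrv big1 // => i _.
have := sp i; case: posnP => [al0 _|_ /eqP->]; last by rewrite mul0r.
by rewrite ctr_lc_supp ?mulr0.
Qed.

(* The homotopy is the exterior product with dX_j / X_j, divided by the j-th
   component of [zfield al], for any nonzero one. *)
Lemma log_delta_exact k u : deg_form k u -> log_delta u = 0 ->
    (forall al K, special al -> lc u al K = 0) ->
  exists2 v, deg_form k.+1 v & u = log_delta v.
Proof.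
move=> uk u_cycle u_sp.
pose piv al := [pick i | (0 < al i)%N && (zfield al i != 0)].
pose c al K := if piv al is Some j then (zfield al j)^-1 * ext j (lc u al) K else 0.
(* The pivot j has al_j > 0, so the product with dX_j / X_j creates no pole. *)
have c_supp al K i : i \in K -> al i = 0%N -> c al K = 0.
  rewrite /c /piv; case: pickP => // j /andP[alj _] iK ali.
  rewrite /ext; case: ifP => jK; last by rewrite mulr0.
  rewrite (@lc_supp _ _ _ _ _ i) ?mulr0 // !inE iK andbT.
  by apply: contraTneq alj => <-; rewrite ali.
have lc_c al K : lc (of_lc c) al K = c al K by apply: lc_of_lc => i; apply: c_supp.
exists (of_lc c) => [K cardK|].
  apply: fpsP => m /=; rewrite /c; case: (piv _) => // j.
  rewrite /ext; case: ifP => jK; last by rewrite mulr0.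
  rewrite (lc_deg _ uk) ?mulr0 //; apply: contraNneq cardK => <-.
  by rewrite (cardsD1 j) jK.
apply: lcP => al K; rewrite lc_delta (eq_ctrv _ (lc_c al)).
(* In the Clifford relation for the contraction of the homotopy, the second term contains the
   contraction of [u], which is zero for a cycle. *)
have cyc L : ctrv (zfield al) (lc u al) L = 0 by rewrite -lc_delta u_cycle lc0.
rewrite /c /piv; case: pickP => [j /andP[alj zj]|nopiv].
  rewrite ctrvZ ctrv_ext mulrBr mulKf // /ext cyc mulr0 if_same mulr0 subr0.
  by [].
(* Without a pivot the degree is special: [u] vanishes there by hypothesis and the primitive by its
   default value. *)
rewrite u_sp; last first.
  apply/forallP => i; have := nopiv i; case: posnP => //= _ /negbT.
  by rewrite negbK.
rewrite /ctrv big1 // => i _; rewrite /ctr.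
by case: ifP => _; rewrite !mulr0.
Qed.

End LogHomology.

(** * Restriction to the two invariant planes *)

Definition mn n (s : seq nat) : 'X_{1..n} := [multinom nth 0%N s i | i < n].
Arguments mn {n} s.

Lemma mdeg_mn1 a : mdeg (mn [:: a] : 'X_{1..1}) = a.
Proof. by rewrite mdegE big_ord1 mnmE. Qed.

Lemma mdeg_mn2 a b : mdeg (mn [:: a; b] : 'X_{1..2}) = (a + b)%N.
Proof. by rewrite mdegE !big_ord_recl big_ord0 addn0 !mnmE. Qed.

Lemma mdeg_mn4 a b c d : mdeg (mn [:: a; b; c; d] : 'X_{1..4}) = (a + (b + (c + d)))%N.
Proof. by rewrite mdegE !big_ord_recl big_ord0 addn0 !mnmE. Qed.

Lemma mn1P (m : 'X_{1..1}) : m = mn [:: m ord0].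
Proof. by apply/mnmP => i; rewrite ord1 mnmE. Qed.

Lemma ord2P (P : 'I_2 -> Prop) : P ord0 -> P ord_max -> forall i, P i.
Proof.
by move=> P0 P1 [[|[|//]] lt_i]; [move: P0|move: P1]; congr P; apply: val_inj.
Qed.

Lemma mn2P (m : 'X_{1..2}) : m = mn [:: m ord0; m ord_max].
Proof. by apply/mnmP; apply: ord2P; rewrite mnmE. Qed.

Lemma mn4P (m : 'X_{1..4}) : m = mn [:: m o0; m o1; m o2; m o3].
Proof. by apply/mnmP; apply: ord4P; rewrite mnmE /= oE. Qed.

Lemma sum2 (V : nmodType) (F : 'I_2 -> V) : \sum_i F i = F ord0 + F ord_max.
Proof.
rewrite !big_ord_recl big_ord0 addr0.
by congr (_ + F _); apply: val_inj.
Qed.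

Lemma prod2 (V : comNzRingType) (F : 'I_2 -> V) : \prod_i F i = F ord0 * F ord_max.
Proof.
rewrite !big_ord_recl big_ord0 mulr1.
by congr (_ * F _); apply: val_inj.
Qed.

Lemma prod4 (V : comNzRingType) (F : 'I_4 -> V) :
  \prod_i F i = F o0 * F o1 * F o2 * F o3.
Proof.
rewrite !big_ord_recl big_ord0 mulr1 !mulrA.
by congr (_ * _ * _ * _); congr F; apply: val_inj; rewrite /= oE.
Qed.

Section Restrict.
Variables (T : comNzRingType).

Lemma fps_subst0 k n (g : 'I_k -> {fps T[n]}) : fps_subst 0 g = 0.
Proof.
by apply: fpsP => m; rewrite fcoef_subst big1 // => i _; rewrite fcoef0 mul0r.
Qed.

(** Tailored to substitutions that set some variables to zero and rename the others: then a single
    exponent [phi m] contributes to the coefficient of [m]. *)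
Lemma fcoef_subst_restrict k n (g : 'I_k -> {fps T[n]})
    (phi : 'X_{1..n} -> 'X_{1..k}) (p : {fps T[k]}) m :
    (forall e, fcoef (mmap1 g e) m = (e == phi m)%:R) ->
    (mdeg (phi m) <= mdeg m)%N ->
  fcoef (fps_subst p g) m = fcoef p (phi m).
Proof.
move=> gE; rewrite -ltnS => lt_phi; rewrite fcoef_subst.
rewrite (bigD1 (BMultinom lt_phi)) //= gE eqxx mulr1 big1 ?addr0 // => e neq_e.
by rewrite gE; case: eqP => [eE|]; rewrite ?mulr0 //; case/eqP: neq_e; apply: val_inj.
Qed.

Lemma fpsX_exp n (i : 'I_n) e : fpsX T i ^+ e = fps_monom T (U_(i) *+ e)%MM.
Proof.
rewrite fpsXE; elim: e => [|e IHe]; first by rewrite expr0 mulm0n fps_monom0.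
by rewrite exprS IHe mulmS fps_monomD.
Qed.

Definition xy2 : 'I_2 -> {fps T[1]} := fun i => if i == ord0 then fpsX T ord0 else 0.

Lemma fcoef_xy2 (p : {fps T[2]}) a :
  fcoef (fps_subst p xy2) (mn [:: a]) = fcoef p (mn [:: a; 0%N]).
Proof.
rewrite (@fcoef_subst_restrict _ _ _ (fun m : 'X_{1..1} => mn [:: m ord0; 0%N]));
  rewrite ?mnmE ?mdeg_mn1 ?mdeg_mn2 ?addn0 // => e.
rewrite /mmap1 prod2 /xy2 eqxx fpsX_exp [_ == ord0]/= expr0n.
rewrite [e in RHS]mn2P; case: eqP => [e1|e1]; last first.
  rewrite mulr0 fcoef0; case: eqP => // /mnmP /(_ ord_max).
  by rewrite !mnmE => /e1.
rewrite mulr1 e1 [LHS]/=; congr (_ %:R); congr nat_of_bool.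
apply/eqP/eqP => [/mnmP/(_ ord0)|/mnmP/(_ ord0)]; rewrite !mnmE => /= E.
  by rewrite E mulmnE mnm1E eqxx mul1n.
by apply/mnmP => i; rewrite ord1 mnmE mulmnE mnm1E eqxx mul1n E.
Qed.

End Restrict.

(** * Series in two variables and their coefficients off the diagonal *)

Section DiagLemma.
Variables (K : numFieldType) (e : K).
Hypothesis e2 : e * e = -1.
Implicit Types (u t : {fps K[2]}).

(** The substitution z_1 = (w_1 + w_2)/2, z_2 = e (w_1 - w_2)/2; its inverse [sigM] is w_1 = z_1 - e
    z_2, w_2 = z_1 + e z_2. *)
Definition tauM (i j : 'I_2) : K :=
  if i == ord0 then 2^-1 else if j == ord0 then e / 2 else - e / 2.
Definition sigM (i j : 'I_2) : K :=
  if j == ord0 then 1 else if i == ord0 then - e else e.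

Let n2 : (2 : K) != 0. Proof. by rewrite Num.Theory.pnatr_eq0. Qed.

Lemma tau_sigM i j : \sum_k tauM i k * sigM k j = (i == j)%:R.
Proof.
rewrite sum2; move: i j; apply: ord2P; apply: ord2P; rewrite /tauM /sigM /=.
- by field.
- by ring.
- by field.
- by field: e2.
Qed.

Lemma sig_tauM i j : \sum_k sigM i k * tauM k j = (i == j)%:R.
Proof.
rewrite sum2; move: i j; apply: ord2P; apply: ord2P; rewrite /tauM /sigM /=; by field: e2.
Qed.

Definition tau : {fps K[2]} -> {fps K[2]} := lsub tauM.
Definition sig : {fps K[2]} -> {fps K[2]} := lsub sigM.

Lemma tauK : cancel tau sig. Proof. exact: lsubK tau_sigM. Qed.
Lemma sigK : cancel sig tau. Proof. exact: lsubK sig_tauM. Qed.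

Let w0 := fpsX K (ord0 : 'I_2).
Let w1 := fpsX K (ord_max : 'I_2).
Let ww (i : 'I_1) := w0 * w1.
Let zz (i : 'I_1) := w0 ^+ 2 + w1 ^+ 2.

Let w00 : fcoef w0 0%MM = 0. Proof. by rewrite /= eq_sym mnm1_eq0. Qed.
Let w10 : fcoef w1 0%MM = 0. Proof. by rewrite /= eq_sym mnm1_eq0. Qed.
Let ww0 i : fcoef (ww i) 0%MM = 0.
Proof. by rewrite fcoef0M w00 mul0r. Qed.
Let zz0 i : fcoef (zz i) 0%MM = 0.
Proof. by rewrite fcoefD !expr2 !fcoef0M w00 w10 !mul0r addr0. Qed.

Lemma ww_monom i : ww i = fps_monom K (mn [:: 1; 1]%N).
Proof.
rewrite /ww /w0 /w1 !fpsXE -fps_monomD; congr fps_monom.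
by apply/mnmP; apply: ord2P; rewrite mnmDE !mnm1E mnmE.
Qed.

Let comb1 (D : 'X_{1..1}) : mnm_comb (fun _ : 'I_1 => mn [:: 1; 1]%N : 'X_{1..2}) D = mn [:: D ord0; D ord0].
Proof.
rewrite /mnm_comb big_ord1; apply/mnmP; apply: ord2P;
  by rewrite mulmnE !mnmE /= mul1n.
Qed.

Lemma fcoef_diag (D : {fps K[1]}) a b :
  fcoef (fps_subst D ww) (mn [:: a; b]) = if a == b then fcoef D (mn [:: a]) else 0.
Proof.
have -> : ww = fun=> fps_monom K (mn [:: 1; 1]%N) by apply/funext => i; rewrite ww_monom.
have nz (i : 'I_1) : (mn [:: 1; 1]%N : 'X_{1..2}) != 0%MM.
  by rewrite -mdeg_eq0 mdeg_mn2.
have inj : injective (mnm_comb (fun _ : 'I_1 => mn [:: 1; 1]%N : 'X_{1..2})).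
  move=> D1 D2; rewrite !comb1 => /mnmP /(_ ord0); rewrite !mnmE /= => E.
  by rewrite [D1]mn1P [D2]mn1P E.
case: eqP => [<-|neq].
  have -> : mn [:: a; a] = mnm_comb (fun _ : 'I_1 => mn [:: 1; 1]%N : 'X_{1..2}) (mn [:: a]).
    by rewrite comb1 mnmE.
  exact: fcoef_subst_comb.
apply: fcoef_subst_notcomb => // m; apply/eqP; rewrite comb1 => /mnmP E.
by apply: neq; have := E ord0; have := E ord_max; rewrite !mnmE /= => -> ->.
Qed.

Lemma sig_ww : sig (w0 * w1) = w0 ^+ 2 + w1 ^+ 2.
Proof.
rewrite /sig rmorphM /= !lsubX /lin !sum2 /sigM /= -/w0 -/w1 !rmorph1 rmorphN.
have E2 : fpsC 2 e * fpsC 2 e = -1 by rewrite -rmorphM e2 rmorphN1.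
by ring: E2.
Qed.

Lemma sig_diag D : sig (fps_subst D ww) = fps_subst D zz.
Proof.
rewrite /sig /lsub (fps_subst_comp _ ww0 (lin0 _)); congr fps_subst.
by apply/funext => i; rewrite -/(lsub _ _) -/sig sig_ww.
Qed.

(** At z_2 = 0 the series D(z_1^2 + z_2^2) becomes D(z_1^2). *)
Lemma fcoef_zz D a : fcoef (fps_subst D zz) (mn [:: a; 0%N])
  = if odd a then 0 else fcoef D (mn [:: a./2]).
Proof.
rewrite -fcoef_xy2 fps_subst_comp //; last first.
  by move=> i; rewrite /xy2; case: ifP => _; rewrite ?fcoef0 //= eq_sym mnm1_eq0.
have xy20 i : fcoef (xy2 K i) 0%MM = 0.
  by rewrite /xy2; case: ifP => _; rewrite ?fcoef0 //= eq_sym mnm1_eq0.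
have -> : (fun i => fps_subst (zz i) (xy2 K)) = fun=> fps_monom K (mn [:: 2]%N : 'X_{1..1}).
  apply/funext => i; rewrite /zz -/(fps_subst_morph xy20 _) rmorphD !rmorphXn /=.
  rewrite /fps_subst_morph !fps_substX // /xy2 eqxx [_ == ord0]/= expr0n addr0 fpsX_exp.
  by congr fps_monom; rewrite [LHS]mn1P mulmnE mnm1E eqxx.
have comb (m : 'X_{1..1}) : mnm_comb (fun _ : 'I_1 => mn [:: 2]%N : 'X_{1..1}) m
    = mn [:: (m ord0).*2].
  rewrite /mnm_comb big_ord1 [LHS]mn1P; congr (mn [:: _]).
  by rewrite mulmnE mnmE [nth _ _ _]/= mul2n.
have nz (i : 'I_1) : (mn [:: 2]%N : 'X_{1..1}) != 0%MM.
  by rewrite -mdeg_eq0 mdeg_mn1.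
have inj : injective (mnm_comb (fun _ : 'I_1 => mn [:: 2]%N : 'X_{1..1})).
  move=> D1 D2; rewrite !comb => /mnmP /(_ ord0); rewrite !mnmE /= => E.
  by rewrite [D1]mn1P [D2]mn1P -(doubleK (D1 ord0)) E doubleK.
case: ifP => odd_a.
  apply: fcoef_subst_notcomb => // m; rewrite comb; apply/eqP => /mnmP /(_ ord0).
  by rewrite !mnmE /= => E; rewrite E odd_double in odd_a.
have {1}-> : mn [:: a] = mnm_comb (fun _ : 'I_1 => mn [:: 2]%N : 'X_{1..1}) (mn [:: a./2]).
  by rewrite comb mnmE /=; congr (mn [:: _]); rewrite -[LHS]odd_double_half odd_a.
exact: fcoef_subst_comb.
Qed.

(* A series [u] without the monomials [z_1^(2k)] is determined by the coefficients of
   [tau u] off the diagonal, since [z_1^2 + z_2^2 = w_1 w_2]. *)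
Definition no_even u := forall k, fcoef u (mn [:: k.*2; 0%N]) = 0.

Lemma tau_offdiag_inj u : no_even u ->
  (forall a b, a <> b -> fcoef (tau u) (mn [:: a; b]) = 0) -> u = 0.
Proof.
move=> u_ne u_off; pose D : {fps K[1]} := Fps (fun m => fcoef (tau u) (mn [:: m ord0; m ord0])).
have tauE : tau u = fps_subst D ww.
  apply: fpsP => m; rewrite [m]mn2P fcoef_diag; case: eqP => [->|/u_off //].
  by rewrite /= mnmE.
have uE : u = fps_subst D zz by rewrite -sig_diag -tauE tauK.
suff D0 : D = 0 by rewrite uE D0 fps_subst0.
apply: fpsP => m; have := u_ne (m ord0).
by rewrite {1}uE fcoef_zz odd_double doubleK -mn1P fcoef0.
Qed.

(** A series in z_1^2 + z_2^2 is subtracted from [sig t] to cancel the forbidden monomials. After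
    [tau] it is a series in w_1 w_2, so only diagonal coefficients change. *)
Lemma tau_offdiag_surj t : exists2 u, no_even u &
  forall a b, a <> b -> fcoef (tau u) (mn [:: a; b]) = fcoef t (mn [:: a; b]).
Proof.
pose D : {fps K[1]} := Fps (fun m => fcoef (sig t) (mn [:: (m ord0).*2; 0%N])).
exists (sig t - fps_subst D zz) => [k|a b /eqP neq_ab].
  by rewrite fcoefB fcoef_zz odd_double doubleK /= mnmE subrr.
have -> : tau (sig t - fps_subst D zz) = tau (sig t) - tau (fps_subst D zz).
  exact: rmorphB.
rewrite sigK -sig_diag sigK fcoefB fcoef_diag.
by rewrite (negbTE neq_ab) subr0.
Qed.

End DiagLemma.

Lemma fps_subst_scale k n (T : comNzRingType) (P : {fps T[k]}) (s : 'I_k -> T)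
    (g : 'I_k -> {fps T[n]}) :
  fps_subst P (fun i => fpsC n (s i) * g i)
    = fps_subst (Fps (fun e => fcoef P e * \prod_i s i ^+ e i)) g.
Proof.
apply: fpsP => m; rewrite !fcoef_subst; apply: eq_bigr => e _.
have -> : mmap1 (fun i => fpsC n (s i) * g i) e = fpsC n (\prod_i s i ^+ e i) * mmap1 g e.
  rewrite rmorph_prod -big_split; apply: eq_bigr => i _ /=.
  by rewrite exprMn rmorphXn.
by rewrite fcoefCM mulrA.
Qed.

Lemma sum2n (F : 'I_2 -> nat) : (\sum_i F i = F ord0 + F ord_max)%N.
Proof. by rewrite -[LHS]/(\sum_i F i)%R sum2. Qed.

Lemma fps_subst_lin n k (T : comNzRingType) (M : 'I_n -> 'I_n -> T) i
    (g : 'I_n -> {fps T[k]}) : (forall i, fcoef (g i) 0%MM = 0) ->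
  fps_subst (lin M i) g = \sum_j fpsC k (M i j) * g j.
Proof.
move=> g0; rewrite /lin -/(fps_subst_morph g0 _) raddf_sum; apply: eq_bigr => j _.
rewrite [LHS]((fps_subst_is_monoid g0).2 _ _); congr (_ * _).
  exact: fps_substC.
exact: (fps_substX g0).
Qed.

(** * The substitutions v = 0 and w = 0 *)

Section PureParts.
Variables (T : comNzRingType).

Definition xw (i : 'I_4) : {fps T[2]} :=
  nth 0 [:: fpsX T ord0; fpsX T ord_max; 0; 0] i.
Definition xv (i : 'I_4) : {fps T[2]} :=
  nth 0 [:: 0; 0; fpsX T ord0; fpsX T ord_max] i.

Lemma fcoef_X0 n (i : 'I_n) : fcoef (fpsX T i) 0%MM = 0.
Proof. by rewrite /= eq_sym mnm1_eq0. Qed.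

Lemma xw0 i : fcoef (xw i) 0%MM = 0.
Proof. by move: i; apply: ord4P; rewrite /xw oE /= ?mnm1_eq0 // eq_sym mnm1_eq0. Qed.

Lemma xv0 i : fcoef (xv i) 0%MM = 0.
Proof. by move: i; apply: ord4P; rewrite /xv oE /= ?mnm1_eq0 // eq_sym mnm1_eq0. Qed.

Lemma mn2E a b : (U_(ord0) *+ a + U_(ord_max) *+ b)%MM = mn [:: a; b] :> 'X_{1..2}.
Proof.
apply/mnmP; apply: ord2P; rewrite mnmDE !mulmnE !mnm1E mnmE /=.
  by rewrite mul1n mul0n addn0.
by rewrite mul1n mul0n.
Qed.

Lemma mn4_inj a b c d a' b' c' d' :
  (mn [:: a; b; c; d] == mn [:: a'; b'; c'; d'] :> 'X_{1..4})
    = [&& a == a', b == b', c == c' & d == d'].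
Proof.
apply/eqP/and4P => [/mnmP E|[/eqP-> /eqP-> /eqP-> /eqP->] //].
have := E o0; have := E o1; have := E o2; have := E o3.
by rewrite !mnmE !oE /= => -> -> -> ->; rewrite !eqxx.
Qed.

Lemma mn2_inj a b a' b' :
  (mn [:: a; b] == mn [:: a'; b'] :> 'X_{1..2}) = (a == a') && (b == b').
Proof.
apply/eqP/andP => [/mnmP E|[/eqP-> /eqP->] //].
by have := E ord0; have := E ord_max; rewrite !mnmE /= => -> ->; rewrite !eqxx.
Qed.

Lemma fcoef_xw (p : {fps T[4]}) a b :
  fcoef (fps_subst p xw) (mn [:: a; b]) = fcoef p (mn [:: a; b; 0; 0]%N).
Proof.
rewrite (@fcoef_subst_restrict _ _ _ _
  (fun m : 'X_{1..2} => mn [:: m ord0; m ord_max; 0; 0]%N)).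
- by rewrite !mnmE.
- move=> e; rewrite /mmap1 prod4 /xw !oE [nth _ _ 0]/= [nth _ _ 1]/= [nth _ _ 2]/= [nth _ _ 3]/=.
  rewrite !fpsX_exp -fps_monomD mn2E !expr0n [e in RHS]mn4P mn4_inj !mnmE [nth _ _ _]/= [nth _ _ (ord_max : 'I_2)]/=.
  case: (e o2 == 0%N); last by rewrite mulr0 mul0r fcoef0 !andbF.
  case: (e o3 == 0%N); last by rewrite mulr0 fcoef0 !andbF.
  by rewrite !mulr1 [LHS]/= mn2_inj andbT [a == _]eq_sym [b == _]eq_sym andbT.
by rewrite !mnmE mdeg_mn2 mdeg_mn4 !addn0.
Qed.

Lemma fcoef_xv (p : {fps T[4]}) a b :
  fcoef (fps_subst p xv) (mn [:: a; b]) = fcoef p (mn [:: 0; 0; a; b]%N).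
Proof.
rewrite (@fcoef_subst_restrict _ _ _ _
  (fun m : 'X_{1..2} => mn [:: 0; 0; m ord0; m ord_max]%N)).
- by rewrite !mnmE.
- move=> e; rewrite /mmap1 prod4 /xv !oE [nth _ _ 0]/= [nth _ _ 1]/= [nth _ _ 2]/= [nth _ _ 3]/=.
  rewrite !fpsX_exp !expr0n [e in RHS]mn4P mn4_inj !mnmE [nth _ _ _]/= [nth _ _ (ord_max : 'I_2)]/=.
  case: (e o0 == 0%N); last by rewrite !mul0r fcoef0.
  case: (e o1 == 0%N); last by rewrite mulr0 !mul0r fcoef0.
  by rewrite !mul1r -fps_monomD mn2E [LHS]/= mn2_inj [a == _]eq_sym [b == _]eq_sym.
by rewrite !mnmE mdeg_mn2 mdeg_mn4 !add0n.
Qed.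

End PureParts.

(** * The series sum_i a_i x_i on the two planes *)

Section PureLemma.
Variables (K : numFieldType) (im : K).
Hypothesis im2 : im * im = -1.

(* [x_i = \sum_j xM i j X_j] and [X_i = \sum_j xN i j x_j], where
   X = (w1, w2, v1, v2). *)
Definition xM (i j : 'I_4) : K :=
  nth 0 (nth [::] [:: [:: 4^-1; 4^-1; 4^-1; 4^-1];
                      [:: - im / 4; - im / 4; im / 4; im / 4];
                      [:: - im / 4; im / 4; im / 4; - im / 4];
                      [:: - 4^-1; 4^-1; - 4^-1; 4^-1]] i) j.

Definition xN (i j : 'I_4) : K :=
  nth 0 (nth [::] [:: [:: 1; im; im; -1];
                      [:: 1; im; - im; 1];
                      [:: 1; - im; - im; -1];
                      [:: 1; - im; im; 1]] i) j.

Lemma xMN i j : \sum_k xM i k * xN k j = (i == j)%:R.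
Proof.
rewrite sum4; move: i j; apply: ord4P; apply: ord4P;
  rewrite /xM /xN !oE -val_eqE /= ?oE /=; by field: im2.
Qed.

Lemma xNM i j : \sum_k xN i k * xM k j = (i == j)%:R.
Proof.
rewrite sum4; move: i j; apply: ord4P; apply: ord4P;
  rewrite /xM /xN !oE -val_eqE /= ?oE /=; by field: im2.
Qed.

(** On either plane x_2 = e x_1 and x_4 = e x_3, so z_1 = 2 x_1 and z_2 = 2 x_3 are coordinates
    there; the factor 2 makes them agree with [tauM]. *)
Definition zy (e : K) (i : 'I_4) : {fps K[2]} :=
  fpsC 2 (nth 0 [:: 2^-1; e / 2; 2^-1; e / 2] i)
    * (if (i < 2)%N then fpsX K ord0 else fpsX K ord_max).

Lemma zy0 e i : fcoef (zy e i) 0%MM = 0.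
Proof. by rewrite /zy fcoefCM; case: ifP; rewrite fcoef_X0 mulr0. Qed.

(* For [e = - im] and [e = im], the restrictions to v = 0 and to w = 0. *)
Definition rho e (h : {fps K[4]}) := fps_subst h (zy e).

HB.instance Definition _ e :=
  GRing.isZmodMorphism.Build {fps K[4]} {fps K[2]} (rho e) (@fps_substB 4 2 K (zy e)).
HB.instance Definition _ e :=
  GRing.isMonoidMorphism.Build {fps K[4]} {fps K[2]} (rho e)
    (fps_subst_is_monoid (zy0 e)).

(** Stated for both planes at once: [c] and [d] stand for the two columns of [xM] that survive on
    the plane, written through e. *)
Lemma tau_rho e (c : 'I_4 -> K) (d : 'I_4 -> K) (g : 'I_4 -> {fps K[2]}) h :
    (forall i, c i = nth 0 [:: 4^-1; e / 4; e / 4; e * e / 4] i) ->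
    (forall i, d i = nth 0 [:: 4^-1; e / 4; - e / 4; - (e * e) / 4] i) ->
    (forall i, g i = fpsC 2 (c i) * fpsX K ord0 + fpsC 2 (d i) * fpsX K ord_max) ->
  tau e (rho e h) = fps_subst h g.
Proof.
move=> cE dE gE; rewrite /tau /lsub /rho fps_subst_comp; [|exact: zy0|exact: lin0].
congr fps_subst; apply/funext => i; rewrite gE cE dE.
rewrite -/(lsub _ _) /zy rmorphM /= lsubC; case: ifP => lt_i; rewrite lsubX /lin sum2 mulrDr !mulrA -!rmorphM;
  congr (fpsC 2 _ * _ + fpsC 2 _ * _); move: i lt_i {gE}; apply: ord4P;
  rewrite !oE //= => _; rewrite /tauM /=; by field.
Qed.

Lemma fcoef_lsub_w h a b :
  fcoef (lsub xM h) (mn [:: a; b; 0; 0]%N) = fcoef (tau (- im) (rho (- im) h)) (mn [:: a; b]).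
Proof.
rewrite -fcoef_xw /lsub fps_subst_comp; [|exact: lin0|exact: xw0].
congr (fcoef _ _); symmetry; apply: (tau_rho (c := xM^~ o0) (d := xM^~ o1)).
- by apply: ord4P; rewrite /xM !oE /=; field: im2.
- by apply: ord4P; rewrite /xM !oE /=; field: im2.
move=> i; rewrite (fps_subst_lin _ _ (@xw0 K)) sum4.
by rewrite /xw !oE /= !mulr0 !addr0.
Qed.

Lemma fcoef_lsub_v h a b :
  fcoef (lsub xM h) (mn [:: 0; 0; a; b]%N) = fcoef (tau im (rho im h)) (mn [:: a; b]).
Proof.
rewrite -fcoef_xv /lsub fps_subst_comp; [|exact: lin0|exact: xv0].
congr (fcoef _ _); symmetry; apply: (tau_rho (c := xM^~ o2) (d := xM^~ o3)).
- by apply: ord4P; rewrite /xM !oE /=; field: im2.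
- by apply: ord4P; rewrite /xM !oE /=; field: im2.
move=> i; rewrite (fps_subst_lin _ _ (@xv0 K)) sum4.
by rewrite /xv !oE /= !mulr0 !add0r.
Qed.

Definition Rx (P : {fps K[2]}) : {fps K[4]} :=
  fps_subst P (fun i => if i == ord0 then fpsX K o1 ^+ 2 else fpsX K o3).

Let zsc e (i : 'I_2) : K := if i == ord0 then (e / 2) ^+ 2 else e / 2.
Let zmn (i : 'I_2) : 'X_{1..2} := if i == ord0 then mn [:: 2; 0]%N else mn [:: 0; 1]%N.

(** On the planes x_2^2 and x_4 are nonzero multiples of z_1^2 and z_2 when e^2 = -1, so the series
    in x_2^2 and x_4 account exactly for those even in z_1. *)
Lemma rho_Rx e P : rho e (Rx P)
  = fps_subst (Fps (fun m => fcoef P m * \prod_i zsc e i ^+ m i)) (fun i => fps_monom K (zmn i)).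
Proof.
rewrite -fps_subst_scale /rho /Rx fps_subst_comp; last exact: zy0.
  congr fps_subst; apply/funext; apply: ord2P; rewrite /zsc /zmn /=.
    rewrite -/(rho e _) rmorphXn /= /rho (fps_substX (zy0 e)) /zy oE /= exprMn -rmorphXn.
    by rewrite fpsX_exp; congr (_ * fps_monom K _); rewrite -mn2E mulm0n addm0.
  rewrite (fps_substX (zy0 e)) /zy oE /= fpsXE; congr (_ * fps_monom K _).
  by rewrite -mn2E mulm0n add0m mulm1n.
by move=> i; case: ifP; rewrite ?expr2 ?fcoef0M fcoef_X0 ?mul0r.
Qed.

Let zcomb m : mnm_comb zmn m = mn [:: (m ord0).*2; m ord_max].
Proof.
apply/mnmP; apply: ord2P; rewrite mnm_sumE sum2n !mulmnE /zmn !mnmE /=.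
  by rewrite mul0n addn0 mul2n.
by rewrite mul0n mul1n.
Qed.

Let zmn_neq0 i : zmn i != 0%MM.
Proof. by rewrite -mdeg_eq0 /zmn; case: ifP => _; rewrite mdeg_mn2. Qed.

Let zcomb_inj : injective (mnm_comb zmn).
Proof.
move=> m m'; rewrite !zcomb => /eqP; rewrite mn2_inj => /andP[/eqP E /eqP E'].
by rewrite [m]mn2P [m']mn2P E' -(doubleK (m ord0)) E doubleK.
Qed.

Definition zfac (e : K) k l : K := ((e / 2) ^+ 2) ^+ k * (e / 2) ^+ l.

Lemma fcoef_rho_Rx e P a l : fcoef (rho e (Rx P)) (mn [:: a; l])
  = if odd a then 0 else fcoef P (mn [:: a./2; l]) * zfac e a./2 l.
Proof.
rewrite rho_Rx; case: ifP => odd_a.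
  apply: fcoef_subst_notcomb => m; rewrite zcomb mn2_inj negb_and.
  by apply/orP; left; apply: contraTneq odd_a => ->; rewrite odd_double.
have {1}-> : mn [:: a; l] = mnm_comb zmn (mn [:: a./2; l]).
  by rewrite zcomb !mnmE /=; congr (mn [:: _; _]); rewrite -[LHS]odd_double_half odd_a.
rewrite (fcoef_subst_comb zmn_neq0 zcomb_inj) [LHS]/= prod2 /zsc !mnmE /=.
by [].
Qed.

Definition hR (P : 'I_4 -> {fps K[2]}) : {fps K[4]} := \sum_i Rx (P i) * fpsX K i.

Lemma fcoef2XM0 (p : {fps K[2]}) a b : fcoef (p * fpsX K ord0) (mn [:: a; b])
  = if a is a'.+1 then fcoef p (mn [:: a'; b]) else 0.
Proof.
rewrite mulrC fcoefXM mnmE /=; case: a => //= a; congr fcoef.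
by apply/mnmP; apply: ord2P; rewrite mnmBE !mnmE /= ?subn0 ?subn1.
Qed.

Lemma fcoef2XM1 (p : {fps K[2]}) a b : fcoef (p * fpsX K ord_max) (mn [:: a; b])
  = if b is b'.+1 then fcoef p (mn [:: a; b']) else 0.
Proof.
rewrite mulrC fcoefXM mnmE /=; case: b => //= b; congr fcoef.
by apply/mnmP; apply: ord2P; rewrite mnmBE !mnmE /= ?subn0 ?subn1.
Qed.

(** A plane only sees a_1 + e a_2, multiplied by z_1, and a_3 + e a_4, multiplied by z_2. As the a_i
    are even in z_1, the first fills the odd powers of z_1 and the second the even powers times a
    positive power of z_2; what is missing are the z_1^(2k). The two values of e separate the
    a_i. *)
Lemma rho_hR e P : rho e (hR P)
  = fpsC 2 2^-1 * ((rho e (Rx (P o0)) + fpsC 2 e * rho e (Rx (P o1))) * fpsX K ord0)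
  + fpsC 2 2^-1 * ((rho e (Rx (P o2)) + fpsC 2 e * rho e (Rx (P o3))) * fpsX K ord_max).
Proof.
rewrite /hR rmorph_sum sum4 !rmorphM /=.
have rX i : rho e (fpsX K i) = zy e i by exact: (fps_substX (zy0 e)).
rewrite !rX /zy !oE /= !rmorphM; ring.
Qed.

Lemma fcoef_rho_hR0 e P k l : fcoef (rho e (hR P)) (mn [:: k.*2.+1; l])
  = (fcoef (P o0) (mn [:: k; l]) + e * fcoef (P o1) (mn [:: k; l])) * zfac e k l / 2.
Proof.
rewrite rho_hR fcoefD !fcoefCM fcoef2XM0 fcoef2XM1 !(fcoefD, fcoefCM) !fcoef_rho_Rx.
rewrite odd_double doubleK; case: l => [|l].
  by field.
by rewrite fcoefD fcoefCM !fcoef_rho_Rx /= odd_double /=; field.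
Qed.

Lemma fcoef_rho_hR1 e P k l : fcoef (rho e (hR P)) (mn [:: k.*2; l.+1])
  = (fcoef (P o2) (mn [:: k; l]) + e * fcoef (P o3) (mn [:: k; l])) * zfac e k l / 2.
Proof.
rewrite rho_hR fcoefD !fcoefCM fcoef2XM0 fcoef2XM1 [in X in _ + X]fcoefD fcoefCM.
rewrite !fcoef_rho_Rx odd_double doubleK; case: k => [|k].
  by rewrite double0; field.
by rewrite doubleS fcoefD fcoefCM !fcoef_rho_Rx /= odd_double /=; field.
Qed.

Lemma fcoef_rho_hR2 e P : no_even (rho e (hR P)).
Proof.
move=> k; rewrite rho_hR fcoefD !fcoefCM fcoef2XM0 fcoef2XM1 mulr0 addr0.
case: k => [|k]; first by rewrite mulr0.
by rewrite doubleS fcoefD fcoefCM !fcoef_rho_Rx /= odd_double /= !mulr0 addr0 mulr0.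
Qed.

Let im0 : im != 0.
Proof. by apply: contra_eqN im2 => /eqP->; rewrite mul0r eq_sym oppr_eq0 oner_eq0. Qed.

Let zfac_neq0 e k l : e * e = -1 -> zfac e k l != 0.
Proof.
move=> e2; have e0 : e != 0.
  by apply: contra_eqN e2 => /eqP->; rewrite mul0r eq_sym oppr_eq0 oner_eq0.
have e20 : e / 2 != 0 by rewrite mulf_neq0 // invr_eq0 Num.Theory.pnatr_eq0.
by rewrite /zfac mulf_neq0 // !expf_neq0.
Qed.

Let n2 : (2 : K) != 0. Proof. by rewrite Num.Theory.pnatr_eq0. Qed.
Let nim2 : (- im) * (- im) = -1. Proof. by rewrite mulrNN. Qed.

Lemma pair_eq0 (a b : K) : a + im * b = 0 -> a + - im * b = 0 -> a = 0 /\ b = 0.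
Proof.
move=> E1 E2; have a0 : a = 0.
  by apply: (mulfI n2); rewrite mulr0 -[LHS](_ : a + im * b + (a + - im * b) = _);
    [rewrite E1 E2 addr0 | ring].
by split=> //; apply: (mulfI im0); rewrite mulr0 -E1 a0 add0r.
Qed.

Lemma rho_hR_eq0 P : rho im (hR P) = 0 -> rho (- im) (hR P) = 0 -> forall i, P i = 0.
Proof.
move=> Ev Ew.
have kill (e : K) (c : K) k l : e * e = -1 -> c * zfac e k l / 2 = 0 -> c = 0.
  move=> e2; have [->//|c0] := eqVneq c 0; move/eqP.
  by rewrite (negbTE (mulf_neq0 (mulf_neq0 c0 (zfac_neq0 k l e2)) _)) // invr_eq0.
have P01 k l : fcoef (P o0) (mn [:: k; l]) = 0 /\ fcoef (P o1) (mn [:: k; l]) = 0.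
  apply: pair_eq0.
    by apply: (kill im _ k l im2); rewrite -fcoef_rho_hR0 Ev fcoef0.
  by apply: (kill (- im) _ k l nim2); rewrite -fcoef_rho_hR0 Ew fcoef0.
have P23 k l : fcoef (P o2) (mn [:: k; l]) = 0 /\ fcoef (P o3) (mn [:: k; l]) = 0.
  apply: pair_eq0.
    by apply: (kill im _ k l im2); rewrite -fcoef_rho_hR1 Ev fcoef0.
  by apply: (kill (- im) _ k l nim2); rewrite -fcoef_rho_hR1 Ew fcoef0.
apply: ord4P; apply: fpsP => m; rewrite [m]mn2P fcoef0;
  by case: (P01 (m ord0) (m ord_max)); case: (P23 (m ord0) (m ord_max)).
Qed.

Lemma rho_hR_surj (uv uw : {fps K[2]}) : no_even uv -> no_even uw ->
  exists P, rho im (hR P) = uv /\ rho (- im) (hR P) = uw.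
Proof.
move=> uv_ne uw_ne.
(* The value that the coefficient of a_1 + e a_2 (for s = 0) or a_3 + e a_4 (otherwise) must take,
   from [fcoef_rho_hR0] and [fcoef_rho_hR1]. *)
pose B (e : K) (u : {fps K[2]}) (s : nat) (m : 'X_{1..2}) : K :=
  2 * fcoef u (if s is 0 then mn [:: (m ord0).*2.+1; m ord_max]
               else mn [:: (m ord0).*2; (m ord_max).+1]) / zfac e (m ord0) (m ord_max).
(* Solves the two equations for e = im and e = - im by half sum and half difference. *)
pose re s : {fps K[2]} := Fps (fun m => (B im uv s m + B (- im) uw s m) / 2).
pose ri s : {fps K[2]} := Fps (fun m => (B im uv s m - B (- im) uw s m) / (2 * im)).
pose P (i : 'I_4) := nth 0 [:: re 0%N; ri 0%N; re 1%N; ri 1%N] i.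
have zn0 k l : zfac im k l != 0 by apply: zfac_neq0.
have zn1 k l : zfac (- im) k l != 0 by apply: zfac_neq0.
have decomp (k : nat) : k = (odd k + k./2.*2)%N by rewrite odd_double_half.
exists P; split; apply: fpsP => m; rewrite [m]mn2P.
- rewrite (decomp (m ord0)); case: (odd _).
    rewrite add1n fcoef_rho_hR0 /P !oE /= /B !mnmE /=; field.
    by rewrite im0 zn0 zn1.
  rewrite add0n; case: (m ord_max) => [|l]; first by rewrite fcoef_rho_hR2 uv_ne.
  rewrite fcoef_rho_hR1 /P !oE /= /B !mnmE /=; field.
  by rewrite im0 zn0 zn1.
- rewrite (decomp (m ord0)); case: (odd _).
    rewrite add1n fcoef_rho_hR0 /P !oE /= /B !mnmE /=; field.
    by rewrite im0 zn0 zn1.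
  rewrite add0n; case: (m ord_max) => [|l]; first by rewrite fcoef_rho_hR2 uw_ne.
  rewrite fcoef_rho_hR1 /P !oE /= /B !mnmE /=; field.
  by rewrite im0 zn0 zn1.
Qed.

Lemma pure_inj P :
    (forall a b, a <> b -> fcoef (lsub xM (hR P)) (mn [:: a; b; 0; 0]%N) = 0
                        /\ fcoef (lsub xM (hR P)) (mn [:: 0; 0; a; b]%N) = 0) ->
  forall i, P i = 0.
Proof.
move=> off; apply: rho_hR_eq0.
  apply: (tau_offdiag_inj im2); first exact: fcoef_rho_hR2.
  by move=> a b neq_ab; rewrite -fcoef_lsub_v; case: (off a b neq_ab).
apply: (tau_offdiag_inj nim2); first exact: fcoef_rho_hR2.
by move=> a b neq_ab; rewrite -fcoef_lsub_w; case: (off a b neq_ab).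
Qed.

Lemma pure_surj (t : {fps K[4]}) : exists P, forall a b, a <> b ->
  fcoef (lsub xM (hR P)) (mn [:: a; b; 0; 0]%N) = fcoef t (mn [:: a; b; 0; 0]%N) /\
  fcoef (lsub xM (hR P)) (mn [:: 0; 0; a; b]%N) = fcoef t (mn [:: 0; 0; a; b]%N).
Proof.
pose tv : {fps K[2]} := Fps (fun m => fcoef t (mn [:: 0; 0; m ord0; m ord_max]%N)).
pose tw : {fps K[2]} := Fps (fun m => fcoef t (mn [:: m ord0; m ord_max; 0; 0]%N)).
have [uv uv_ne uvE] := tau_offdiag_surj im2 tv.
have [uw uw_ne uwE] := tau_offdiag_surj nim2 tw.
have [P [Pv Pw]] := rho_hR_surj uv_ne uw_ne; exists P => a b neq_ab.
by rewrite fcoef_lsub_w fcoef_lsub_v Pv Pw (uvE _ _ neq_ab) (uwE _ _ neq_ab) /= !mnmE.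
Qed.

End PureLemma.

(** * Normal forms in diagonal coordinates *)

Section Set4Eval.
Variables (T : comNzRingType).
Implicit Types (a : 'I_4 -> {fps T[4]}) (u : cform 4 T).

Lemma dxw4 i u b0 b1 b2 b3 : fc (dxw i u) (set4 b0 b1 b2 b3) = ext i (fc u) (set4 b0 b1 b2 b3).
Proof. by []. Qed.

Lemma cov_set4 a u b0 b1 b2 b3 : fc (cov a u) (set4 b0 b1 b2 b3)
  = (if b0 then a o0 * fc u (set4 false b1 b2 b3) else 0)
  + (if b1 then a o1 * ((-1) ^+ b0 * fc u (set4 b0 false b2 b3)) else 0)
  + (if b2 then a o2 * ((-1) ^+ (b0 + b1) * fc u (set4 b0 b1 false b3)) else 0)
  + (if b3 then a o3 * ((-1) ^+ (b0 + b1 + b2) * fc u (set4 b0 b1 b2 false)) else 0).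
Proof.
rewrite /cov fc_sum sum4 !fcZ !dxw4 ext40 ext41 ext42 ext43.
by case: b0; case: b1; case: b2; case: b3; rewrite ?mulr0.
Qed.

Lemma dF_set4 u b0 b1 b2 b3 : fc (dF u) (set4 b0 b1 b2 b3)
  = (if b0 then fps_deriv o0 (fc u (set4 false b1 b2 b3)) else 0)
  + (if b1 then (-1) ^+ b0 * fps_deriv o1 (fc u (set4 b0 false b2 b3)) else 0)
  + (if b2 then (-1) ^+ (b0 + b1) * fps_deriv o2 (fc u (set4 b0 b1 false b3)) else 0)
  + (if b3 then (-1) ^+ (b0 + b1 + b2) * fps_deriv o3 (fc u (set4 b0 b1 b2 false)) else 0).
Proof. by rewrite dFE fc_sum sum4 !dxw4 ext40 ext41 ext42 ext43. Qed.

Lemma vac_set4 b0 b1 b2 b3 :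
  fc (vacuum 4 T) (set4 b0 b1 b2 b3) = [&& ~~ b0, ~~ b1, ~~ b2 & ~~ b3]%:R.
Proof. by rewrite /= set4_eq0. Qed.

Lemma mind_set4 b0 b1 b2 b3 :
  mind (set4 b0 b1 b2 b3) = mn [:: b0 : nat; b1 : nat; b2 : nat; b3 : nat].
Proof. by apply/mnmP; apply: ord4P; rewrite !mnmE set4E /= oE. Qed.

End Set4Eval.

Section Nf.
Variables (T : comNzRingType) (z : 'I_2 -> 'I_4 -> {fps T[4]}) (F : 'I_2 -> {fps T[4]}).

Definition grad (f : {fps T[4]}) (i : 'I_4) := fps_deriv i f.

Local Notation vac := (vacuum 4 T).
Implicit Types (p q : 'I_2 -> {fps T[4]}) (a b h k : {fps T[4]}).

(* The representatives of the theorem, for a frame [z] and functions [F] in any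
   coordinates.  The parts [nf1b h k] and [nf2c h] contain the series
   h = \sum_i a_i x_i and k = \sum_i b_i x_i; the others have coefficients in
   the invariant series. *)
Definition nf1a p q := \sum_j (p j *: cov (z j) vac + q j *: cov (grad (F j)) vac).
Definition nf1b h k := cov (grad h) vac + k *: cov (grad (F ord0)) vac.
Definition nf2a a b p := a *: cov (z ord0) (cov (z ord_max) vac)
  + b *: cov (grad (F ord0)) (cov (grad (F ord_max)) vac)
  + \sum_j p j *: dF (F ord0 *: cov (z j) vac).
Definition nf2b q := \sum_j q j *: dF (cov (z j) vac).
Definition nf2c h := cov (grad h) (cov (grad (F ord0)) vac).
Definition nf3 p q := \sum_j (p j *: cov (z ord_max) (dF (cov (z j) vac))
                             + q j *: cov (grad (F ord0)) (dF (cov (z j) vac))).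

End Nf.

Section WLevel.
Variables (K : numFieldType) (im : K).
Hypothesis im2 : im * im = -1.
Implicit Types (f p : {fps K[4]}) (al m : 'X_{1..4}) (u : cform 4 K).

Definition wvar (i : 'I_4) : {fps K[4]} := fpsX K i.

(* f_1, f_2, and below the components of zeta_1, zeta_2, in the coordinates X. *)
Definition wfun (j : 'I_2) : {fps K[4]} :=
  if j == ord0 then fpsC 4 2^-1 * (wvar o0 * wvar o1 + wvar o2 * wvar o3)
  else fpsC 4 (- im / 2) * (wvar o0 * wvar o1 - wvar o2 * wvar o3).

Definition wzeta (j : 'I_2) (i : 'I_4) : {fps K[4]} :=
  if j == ord0 then
    fpsC 4 (nth 0 [:: - im / 8; im / 8; im / 8; - im / 8] i) * nth 0 [:: wvar o1; wvar o0; wvar o3; wvar o2] i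
  else
    fpsC 4 (nth 0 [:: - 8^-1; 8^-1; - 8^-1; 8^-1] i) * nth 0 [:: wvar o1; wvar o0; wvar o3; wvar o2] i.

(* The eigenvalues of the linear fields A and B, with pi = A /\ B. *)
Definition wA (i : 'I_4) : K := nth 0 [:: - im; im; im; - im] i.
Definition wB (i : 'I_4) : K := nth 0 [:: 4; - 4; 4; - 4] i.

(** Equivalently both weights A(al) and B(al) vanish; these are the exponents of the monomials in w1
    w2 and v1 v2. *)
Definition wt0 al := (al o0 == al o1) && (al o2 == al o3).

Lemma charK a b : (a%:R == b%:R :> K) = (a == b)%N.
Proof. exact: Num.Theory.eqr_nat. Qed.

Let im0 : im != 0.
Proof. by apply: contra_eqN im2 => /eqP->; rewrite mul0r eq_sym oppr_eq0 oner_eq0. Qed.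

Lemma wtE al (c : 'I_4 -> K) : wt c al =
  c o0 * (al o0)%:R + c o1 * (al o1)%:R + c o2 * (al o2)%:R + c o3 * (al o3)%:R.
Proof. by rewrite /wt sum4. Qed.

Lemma n8im : 8 * im != 0.
Proof. by rewrite mulf_neq0 // Num.Theory.pnatr_eq0. Qed.

Lemma zfieldE al : [/\ zfield wA wB al o0 = 8 * im * ((al o2)%:R - (al o3)%:R),
  zfield wA wB al o1 = - (8 * im * ((al o2)%:R - (al o3)%:R)),
  zfield wA wB al o2 = - (8 * im * ((al o0)%:R - (al o1)%:R)) &
  zfield wA wB al o3 = 8 * im * ((al o0)%:R - (al o1)%:R)].
Proof. by rewrite /zfield !wtE /wA /wB !oE /=; split; ring. Qed.

Lemma specialE al : special wA wB al =
  ((0 < al o0) || (0 < al o1) ==> (al o2 == al o3))%N &&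
  ((0 < al o2) || (0 < al o3) ==> (al o0 == al o1))%N.
Proof.
have [z0 z1 z2 z3] := zfieldE al.
have zE (a b : nat) : (8 * im * (a%:R - b%:R) == 0 :> K) = (a == b).
  by rewrite mulf_eq0 (negbTE n8im) subr_eq0 charK.
apply/forallP/andP => [sp|[sp01 sp23]].
  have := sp o0; have := sp o1; have := sp o2; have := sp o3.
  rewrite z0 z1 z2 z3 !oppr_eq0 !zE.
  by do 4![case: (posnP (al _)) => ?]; rewrite //= => -> ? ->.
apply: ord4P; rewrite ?z0 ?z1 ?z2 ?z3 ?oppr_eq0 zE; apply/implyP => pos.
- by rewrite pos in sp01.
- by rewrite pos orbT in sp01.
- by rewrite pos in sp23.
- by rewrite pos orbT in sp23.
Qed.

Lemma wt0_special al : wt0 al -> special wA wB al.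
Proof. by rewrite specialE => /andP[-> ->]; rewrite !implybT. Qed.

Lemma special_pure al : special wA wB al -> ~~ wt0 al ->
  (exists a b, a <> b /\ al = mn [:: a; b; 0; 0]%N) \/
  (exists a b, a <> b /\ al = mn [:: 0; 0; a; b]%N).
Proof.
rewrite specialE /wt0 => /andP[sp01 sp23] nwt.
have [E01|n01] := eqVneq (al o0) (al o1); last first.
  left; exists (al o0), (al o1); split; first exact/eqP.
  move: sp23; rewrite (negbTE n01) implybF negb_or -!leqNgt !leqn0 => /andP[/eqP E2 /eqP E3].
  by rewrite [LHS]mn4P E2 E3.
right; move: nwt; rewrite E01 eqxx /= => n23; exists (al o2), (al o3); split; first exact/eqP.
move: sp01; rewrite (negbTE n23) implybF negb_or -!leqNgt !leqn0 => /andP[/eqP E2 /eqP E3].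
by rewrite [LHS]mn4P E2 E3.
Qed.

Definition Wt0 p := forall m, ~~ wt0 m -> fcoef p m = 0.

(* The coefficient of X^al in [p] times the product of the X_i, i in [S]. *)
Definition sh p al (S : {set 'I_4}) := shcoef p al (mind S).

Definition s01 := set4 true true false false.
Definition s23 := set4 false false true true.
Definition s0123 := set4 true true true true.

Lemma wt0_mn a b c d : wt0 (mn [:: a; b; c; d]) = (a == b) && (c == d).
Proof. by rewrite /wt0 !mnmE !oE. Qed.

(** The index sets in question correspond to 1, w1 w2, v1 v2 and their product, monomials of weight
    zero. *)
Lemma wt0D m (b c : bool) : wt0 (m + mind (set4 b b c c))%MM = wt0 m.
Proof.
rewrite /wt0 !mnmDE !mnmE !set4E; case: b; case: c => /=;
  by rewrite ?addn0 ?addn1 ?eqSS.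
Qed.

Lemma sh_wt0 p al b c : Wt0 p -> ~~ wt0 al -> sh p al (set4 b b c c) = 0.
Proof.
move=> p0 nwt; rewrite /sh /shcoef; case: ifP => // le.
by apply: p0; rewrite -(wt0D _ b c) submK.
Qed.

(* The series of weight zero with [sh (mkW S phi) al S = phi al]. *)
Definition mkW (S : {set 'I_4}) (phi : 'X_{1..4} -> K) : {fps K[4]} :=
  Fps (fun m => if wt0 m then phi (m + mind S)%MM else 0).

Lemma mkW_wt0 S phi : Wt0 (mkW S phi).
Proof. by move=> m /negbTE /= ->. Qed.

Lemma sh_mkW b c phi al : wt0 al ->
    (~~ (mind (set4 b b c c) <= al)%MM -> phi al = 0) ->
  sh (mkW (set4 b b c c) phi) al (set4 b b c c) = phi al.
Proof.
move=> wta phi0; rewrite /sh /shcoef; case: ifP => [le|/negbT /phi0 -> //].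
by rewrite /= -(wt0D _ b c) submK // wta.
Qed.

Lemma Wt0D p p' : Wt0 p -> Wt0 p' -> Wt0 (p + p').
Proof. by move=> p0 p0' m nwt; rewrite fcoefD p0 ?p0' ?addr0. Qed.

Lemma Wt0CM c p : Wt0 p -> Wt0 (fpsC 4 c * p).
Proof. by move=> p0 m nwt; rewrite fcoefCM p0 ?mulr0. Qed.

Lemma shD p p' al S : sh (p + p') al S = sh p al S + sh p' al S.
Proof. by rewrite /sh /shcoef; case: ifP; rewrite ?addr0. Qed.

Lemma shCM c p al S : sh (fpsC 4 c * p) al S = c * sh p al S.
Proof. exact: shcoefCM. Qed.

Lemma sh0 al S : sh 0 al S = 0.
Proof. by rewrite /sh /shcoef; case: ifP. Qed.

Lemma shWM i p al (S : {set 'I_4}) : i \notin S -> sh (wvar i * p) al S = sh p al (i |: S).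
Proof. by move=> iS; rewrite /sh shcoefXM mindU. Qed.

Lemma sh_deriv i p al (S : {set 'I_4}) : i \notin S ->
  sh (fps_deriv i p) al (i |: S) = (al i)%:R * sh p al S.
Proof. by move=> iS; rewrite /sh mindU // shcoef_deriv mnmE (negbTE iS) subn0. Qed.

Lemma wF_deriv i : fps_deriv i (wfun ord0)
  = fpsC 4 2^-1 * nth 0 [:: wvar o1; wvar o0; wvar o3; wvar o2] i.
Proof.
rewrite /wfun /= fps_derivCM raddfD /= !fps_derivM !fps_derivX; congr (_ * _).
by move: i; apply: ord4P; rewrite -!val_eqE !oE /= ?oE /= !(mulr0, mul0r, mulr1, mul1r, addr0, add0r).
Qed.

Lemma wF_deriv1 i : fps_deriv i (wfun ord_max)
  = fpsC 4 (nth 0 [:: - im / 2; - im / 2; im / 2; im / 2] i) * nth 0 [:: wvar o1; wvar o0; wvar o3; wvar o2] i.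
Proof.
rewrite /wfun /= fps_derivCM raddfB /= !fps_derivM !fps_derivX.
move: i; apply: ord4P; rewrite -!val_eqE !oE /= ?oE /= !(mulr0, mul0r, mulr1, mul1r, addr0, add0r, subr0, sub0r) //;
  by rewrite mulrN -mulNr -rmorphN /= mulNr opprK.
Qed.

End WLevel.

Lemma deg_dF n (T : comNzRingType) k (u : cform n T) :
  deg_form k u -> deg_form k.+1 (dF u).
Proof.
move=> uk; apply: deg_form_sum => i; apply: deg_dxw => S cardS.
by rewrite /= uk ?raddf0.
Qed.

#[local] Opaque cov dF.

(** * Logarithmic coefficients of the representatives *)

Section Components.
Variables (K : numFieldType) (im : K).
Hypothesis im2 : im * im = -1.
Implicit Types (p q : 'I_2 -> {fps K[4]}) (a b f h k : {fps K[4]}).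
Implicit Types (al m : 'X_{1..4}) (u : cform 4 K).
Local Notation c4 := (@fpsC 4 K).
Local Notation W := (@wvar K).
Local Notation wz := (wzeta im).
Local Notation wF := (wfun im).
Local Notation vac := (vacuum 4 K).

Lemma cov_vac (g : 'I_4 -> {fps K[4]}) (b0 b1 b2 b3 : bool) :
  fc (cov g vac) (set4 b0 b1 b2 b3)
    = (if [&& b0, ~~ b1, ~~ b2 & ~~ b3] then g o0 else 0)
    + (if [&& ~~ b0, b1, ~~ b2 & ~~ b3] then g o1 else 0)
    + (if [&& ~~ b0, ~~ b1, b2 & ~~ b3] then g o2 else 0)
    + (if [&& ~~ b0, ~~ b1, ~~ b2 & b3] then g o3 else 0).
Proof.
rewrite cov_set4 !vac_set4.
by case: b0; case: b1; case: b2; case: b3; rewrite /= ?mulr0 ?mulr1 ?addr0 ?add0r.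
Qed.

Lemma W_deriv i j : fps_deriv i (W j) = (i == j)%:R. Proof. exact: fps_derivX. Qed.

Lemma wzE j i : wz j i = c4 (nth 0 (nth [::] [:: [:: - im / 8; im / 8; im / 8; - im / 8];
     [:: - 8^-1; 8^-1; - 8^-1; 8^-1]] j) i) * nth 0 [:: W o1; W o0; W o3; W o2] i.
Proof. by move: j; apply: ord2P. Qed.

(** zeta_j is linear and skew in (w1, w2) and in (v1, v2), without terms that mix the two pairs. *)
Lemma dz_set4 j (b0 b1 b2 b3 : bool) : fc (dF (cov (wz j) vac)) (set4 b0 b1 b2 b3)
  = if [&& b0, b1, ~~ b2 & ~~ b3] then c4 (nth 0 [:: im / 4; 4^-1] j)
    else if [&& ~~ b0, ~~ b1, b2 & b3] then c4 (nth 0 [:: - im / 4; 4^-1] j) else 0.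
Proof.
rewrite dF_set4 !cov_vac !wzE !oE.
case: b0; case: b1; case: b2; case: b3; rewrite /= ?(addr0, add0r, raddf0, mulr0) //;
  rewrite !fps_derivCM !W_deriv -!val_eqE /= ?oE /= ?(mulr0, addr0, add0r) // ?expr1 ?expr0 -?exprD;
  move: j; apply: ord2P; rewrite /= ?mulr1 ?mulN1r ?mul1r -?rmorphN -?rmorphD; congr c4; by field.
Qed.

Lemma nf1a_deg p q : deg_form 1 (nf1a wz wF p q).
Proof.
apply: deg_form_sum => j; apply: deg_formD; apply: deg_formZ;
  exact/deg_cov/deg_vac.
Qed.

Lemma nf1b_deg h k : deg_form 1 (nf1b wF h k).
Proof. by apply: deg_formD; [|apply: deg_formZ]; exact/deg_cov/deg_vac. Qed.

Lemma nf2a_deg a b p : deg_form 2 (nf2a wz wF a b p).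
Proof.
do 2?apply: deg_formD; try by apply/deg_formZ/deg_cov/deg_cov/deg_vac.
by apply: deg_form_sum => j; apply/deg_formZ/deg_dF/deg_formZ/deg_cov/deg_vac.
Qed.

Lemma nf2b_deg q : deg_form 2 (nf2b wz q).
Proof. by apply: deg_form_sum => j; apply/deg_formZ/deg_dF/deg_cov/deg_vac. Qed.

Lemma nf2c_deg h : deg_form 2 (nf2c wF h).
Proof. exact/deg_cov/deg_cov/deg_vac. Qed.

Lemma nf3_deg p q : deg_form 3 (nf3 wz wF p q).
Proof.
apply: deg_form_sum => j; apply: deg_formD;
  exact/deg_formZ/deg_cov/deg_dF/deg_cov/deg_vac.
Qed.

Definition s0 := set4 true false false false.
Definition s1 := set4 false true false false.
Definition s2 := set4 false false true false.
Definition s3 := set4 false false false true.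
Definition s02 := set4 true false true false.
Definition s03 := set4 true false false true.
Definition s12 := set4 false true true false.
Definition s13 := set4 false true false true.
Definition s012 := set4 true true true false.
Definition s013 := set4 true true false true.
Definition s023 := set4 true false true true.
Definition s123 := set4 false true true true.

Lemma deg1_cases (P : {set 'I_4} -> Prop) : P s0 -> P s1 -> P s2 -> P s3 ->
  forall S : {set 'I_4}, #|S| = 1%N -> P S.
Proof.
move=> P0 P1 P2 P3 S; rewrite (set4P S) card_set4.
by case: (o0 \in S); case: (o1 \in S); case: (o2 \in S); case: (o3 \in S).
Qed.

Lemma deg2_cases (P : {set 'I_4} -> Prop) :
  P s01 -> P s02 -> P s03 -> P s12 -> P s13 -> P s23 -> forall S : {set 'I_4}, #|S| = 2%N -> P S.
Proof.
move=> P0 P1 P2 P3 P4 P5 S; rewrite (set4P S) card_set4.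
by case: (o0 \in S); case: (o1 \in S); case: (o2 \in S); case: (o3 \in S).
Qed.

Lemma deg3_cases (P : {set 'I_4} -> Prop) : P s012 -> P s013 -> P s023 -> P s123 ->
  forall S : {set 'I_4}, #|S| = 3%N -> P S.
Proof.
move=> P0 P1 P2 P3 S; rewrite (set4P S) card_set4.
by case: (o0 \in S); case: (o1 \in S); case: (o2 \in S); case: (o3 \in S).
Qed.

Lemma lcE u al S : lc u al S = sh (fc u S) al S. Proof. by []. Qed.

Lemma nf1a_fc p q : let P := fun x y z t => c4 x * p ord0 + c4 y * p ord_max
                      + c4 z * q ord0 + c4 t * q ord_max in
  [/\ fc (nf1a wz wF p q) s0 = W o1 * P (- im / 8) (- 8^-1) 2^-1 (- im / 2),
      fc (nf1a wz wF p q) s1 = W o0 * P (im / 8) 8^-1 2^-1 (- im / 2),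
      fc (nf1a wz wF p q) s2 = W o3 * P (im / 8) (- 8^-1) 2^-1 (im / 2) &
      fc (nf1a wz wF p q) s3 = W o2 * P (- im / 8) 8^-1 2^-1 (im / 2)].
Proof.
rewrite /= /nf1a sum2; split; rewrite !fcD !fcZ /s0 /s1 /s2 /s3 !cov_vac /grad !wF_deriv !wF_deriv1 !wzE !oE /=;
  ring.
Qed.

(** The component along dX_i carries the other variable of its pair as a factor, so passing to dlog
    X_i completes the factor to w1 w2 or v1 v2. The two pairs are therefore read with different
    shifts. *)
Lemma nf1a_lc p q al : let P := fun x y z t S => x * sh (p ord0) al S + y * sh (p ord_max) al S
                      + z * sh (q ord0) al S + t * sh (q ord_max) al S in
  [/\ lc (nf1a wz wF p q) al s0 = P (- im / 8) (- 8^-1) 2^-1 (- im / 2) s01,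
      lc (nf1a wz wF p q) al s1 = P (im / 8) 8^-1 2^-1 (- im / 2) s01,
      lc (nf1a wz wF p q) al s2 = P (im / 8) (- 8^-1) 2^-1 (im / 2) s23 &
      lc (nf1a wz wF p q) al s3 = P (- im / 8) 8^-1 2^-1 (im / 2) s23].
Proof.
rewrite !lcE; have [-> -> -> ->] := nf1a_fc p q; split;
  by rewrite shWM ?set4E // ?set4_U0 ?set4_U1 ?set4_U2 ?set4_U3 !shD !shCM.
Qed.

(** Within a pair, k df_1 has equal logarithmic components while those of dh are proportional to the
    exponents. Hence h and k can be told apart exactly when the two exponents differ. *)
Lemma nf1b_lc h k al :
  [/\ lc (nf1b wF h k) al s0 = (al o0)%:R * fcoef h al + 2^-1 * sh k al s01,
      lc (nf1b wF h k) al s1 = (al o1)%:R * fcoef h al + 2^-1 * sh k al s01,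
      lc (nf1b wF h k) al s2 = (al o2)%:R * fcoef h al + 2^-1 * sh k al s23 &
      lc (nf1b wF h k) al s3 = (al o3)%:R * fcoef h al + 2^-1 * sh k al s23].
Proof.
have h0 : sh h al (set4 false false false false) = fcoef h al.
  by rewrite /sh -set4_0 mind0 shcoef0.
have dh i S : i \notin set4 false false false false ->
    S = i |: set4 false false false false -> sh (grad h i) al S = (al i)%:R * fcoef h al.
  by move=> iS ->; rewrite sh_deriv // h0.
have kW i (S S' : {set 'I_4}) : i \notin S -> S' = i |: S -> sh (k * (c4 2^-1 * W i)) al S = 2^-1 * sh k al S'.
  by move=> iS ->; rewrite mulrCA shCM [k * _]mulrC shWM.
rewrite !lcE /nf1b; split; rewrite fcD fcZ shD /s0 /s1 /s2 /s3 !cov_vac /= ?addr0 ?add0r.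
- by rewrite (dh o0) ?set4E ?set4_U0 // [grad _ o0]wF_deriv oE /= (kW o1 _ s01) ?set4E ?set4_U1.
- by rewrite (dh o1) ?set4E ?set4_U1 // [grad _ o1]wF_deriv oE /= (kW o0 _ s01) ?set4E ?set4_U0.
- by rewrite (dh o2) ?set4E ?set4_U2 // [grad _ o2]wF_deriv oE /= (kW o3 _ s23) ?set4E ?set4_U3.
- by rewrite (dh o3) ?set4E ?set4_U3 // [grad _ o3]wF_deriv oE /= (kW o2 _ s23) ?set4E ?set4_U2.
Qed.

Lemma cov2_fc (x y : 'I_4 -> {fps K[4]}) :
  [/\ fc (cov x (cov y vac)) s01 = x o0 * y o1 - x o1 * y o0,
      fc (cov x (cov y vac)) s02 = x o0 * y o2 - x o2 * y o0,
      fc (cov x (cov y vac)) s03 = x o0 * y o3 - x o3 * y o0 &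
  [/\ fc (cov x (cov y vac)) s12 = x o1 * y o2 - x o2 * y o1,
      fc (cov x (cov y vac)) s13 = x o1 * y o3 - x o3 * y o1 &
      fc (cov x (cov y vac)) s23 = x o2 * y o3 - x o3 * y o2]].
Proof.
split=> [||| ]; last split; rewrite cov_set4 !cov_vac /=; ring.
Qed.

Lemma nf2a_fcE a b p S (r1 r2 r3 r4 r5 r6 : {fps K[4]}) :
  fc (cov (wz ord0) (cov (wz ord_max) vac)) S = r1 ->
  fc (cov (grad (wF ord0)) (cov (grad (wF ord_max)) vac)) S = r2 ->
  fc (cov (grad (wF ord0)) (cov (wz ord0) vac)) S = r3 ->
  fc (dF (cov (wz ord0) vac)) S = r4 ->
  fc (cov (grad (wF ord0)) (cov (wz ord_max) vac)) S = r5 ->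
  fc (dF (cov (wz ord_max) vac)) S = r6 ->
  fc (nf2a wz wF a b p) S
    = a * r1 + b * r2 + (p ord0 * (r3 + wF ord0 * r4) + p ord_max * (r5 + wF ord0 * r6)).
Proof.
rewrite /nf2a sum2 !dFZ -/(grad (wF ord0)).
move: (cov (wz ord0) (cov _ _)) (cov (grad _) (cov (grad _) _)) (cov _ (cov (wz ord0) _)) => u1 u2 u3.
move: (cov (grad _) (cov _ _)) (dF _) (dF _) => u5 u4 u6.
by move=> <- <- <- <- <- <-; rewrite !fcD !fcZ !fcD !fcZ.
Qed.

(** Series do not form a field, so the inverses in the constants stay unevaluated for [ring];
    [nf2a_lc] simplifies them in K. *)
Lemma nf2a_fc a b p : let P := fun x y z t => c4 x * a + c4 y * b
                       + c4 z * p ord0 + c4 t * p ord_max in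
  [/\ fc (nf2a wz wF a b p) s02 = W o1 * (W o3 * P (2 * 8^-1 * 8^-1 * im) (2 * 2^-1 * 2^-1 * im) (2 * 2^-1 * 8^-1 * im) 0),
      fc (nf2a wz wF a b p) s03 = W o1 * (W o2 * P (- (2 * 8^-1 * 8^-1 * im)) (2 * 2^-1 * 2^-1 * im) 0 (2 * 2^-1 * 8^-1)),
      fc (nf2a wz wF a b p) s12 = W o0 * (W o3 * P (- (2 * 8^-1 * 8^-1 * im)) (2 * 2^-1 * 2^-1 * im) 0 (- (2 * 2^-1 * 8^-1))) &
      fc (nf2a wz wF a b p) s13 = W o0 * (W o2 * P (2 * 8^-1 * 8^-1 * im) (2 * 2^-1 * 2^-1 * im) (- (2 * 2^-1 * 8^-1 * im)) 0)].
Proof.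
move=> P; rewrite {}/P.
have [_ x02 x03 [x12 x13 _]] := cov2_fc (wz ord0) (wz ord_max).
have [_ y02 y03 [y12 y13 _]] := cov2_fc (grad (wF ord0)) (grad (wF ord_max)).
have [_ z02 z03 [z12 z13 _]] := cov2_fc (grad (wF ord0)) (wz ord0).
have [_ t02 t03 [t12 t13 _]] := cov2_fc (grad (wF ord0)) (wz ord_max).
split.
- rewrite (nf2a_fcE a b p x02 y02 z02 (dz_set4 _ _ _ _ _) t02 (dz_set4 _ _ _ _ _)).
  by rewrite /grad !wF_deriv !wF_deriv1 !wzE !oE /=; ring.
- rewrite (nf2a_fcE a b p x03 y03 z03 (dz_set4 _ _ _ _ _) t03 (dz_set4 _ _ _ _ _)).
  by rewrite /grad !wF_deriv !wF_deriv1 !wzE !oE /=; ring.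
- rewrite (nf2a_fcE a b p x12 y12 z12 (dz_set4 _ _ _ _ _) t12 (dz_set4 _ _ _ _ _)).
  by rewrite /grad !wF_deriv !wF_deriv1 !wzE !oE /=; ring.
- rewrite (nf2a_fcE a b p x13 y13 z13 (dz_set4 _ _ _ _ _) t13 (dz_set4 _ _ _ _ _)).
  by rewrite /grad !wF_deriv !wF_deriv1 !wzE !oE /=; ring.
Qed.

(** Only the shape of these two components is needed, to place them in weight-zero degrees: in the
    matching they are corrected by [nf2b]. The constants can thus remain existential. *)
Lemma nf2a_fc' a b p : exists c1 c2 d1 d2 : K,
  [/\ fc (nf2a wz wF a b p) s01 = W o0 * (W o1 * (c4 c1 * p ord0 + c4 c2 * p ord_max))
                                   + W o2 * (W o3 * (c4 d1 * p ord0 + c4 d2 * p ord_max)) &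
      fc (nf2a wz wF a b p) s23 = W o0 * (W o1 * (- c4 d1 * p ord0 + c4 d2 * p ord_max))
                                   + W o2 * (W o3 * (- c4 c1 * p ord0 + c4 c2 * p ord_max))].
Proof.
exists (2 * 2^-1 * 8^-1 * im + 2^-1 * 4^-1 * im), (2 * 2^-1 * 8^-1 + 2^-1 * 4^-1).
exists (2^-1 * 4^-1 * im), (2^-1 * 4^-1).
have [x01 _ _ [_ _ x23]] := cov2_fc (wz ord0) (wz ord_max).
have [y01 _ _ [_ _ y23]] := cov2_fc (grad (wF ord0)) (grad (wF ord_max)).
have [z01 _ _ [_ _ z23]] := cov2_fc (grad (wF ord0)) (wz ord0).
have [t01 _ _ [_ _ t23]] := cov2_fc (grad (wF ord0)) (wz ord_max).
split.
- rewrite (nf2a_fcE a b p x01 y01 z01 (dz_set4 _ _ _ _ _) t01 (dz_set4 _ _ _ _ _)).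
  by rewrite /grad !wF_deriv !wF_deriv1 !wzE !oE /= /wfun /=; ring.
- rewrite (nf2a_fcE a b p x23 y23 z23 (dz_set4 _ _ _ _ _) t23 (dz_set4 _ _ _ _ _)).
  by rewrite /grad !wF_deriv !wF_deriv1 !wzE !oE /= /wfun /=; ring.
Qed.

Lemma nf2a_lc a b p al : let P := fun x y z t => x * sh a al s0123 + y * sh b al s0123
                       + z * sh (p ord0) al s0123 + t * sh (p ord_max) al s0123 in
  [/\ lc (nf2a wz wF a b p) al s02 = P (im / 32) (im / 2) (im / 8) 0,
      lc (nf2a wz wF a b p) al s03 = P (- im / 32) (im / 2) 0 8^-1,
      lc (nf2a wz wF a b p) al s12 = P (- im / 32) (im / 2) 0 (- 8^-1) &
      lc (nf2a wz wF a b p) al s13 = P (im / 32) (im / 2) (- im / 8) 0].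
Proof.
rewrite !lcE; have [-> -> -> ->] := nf2a_fc a b p; split;
  rewrite !shWM ?set4_U0 ?set4_U1 ?set4_U2 ?set4_U3 ?set4E // !shD !shCM -?/s0123; by field.
Qed.

Lemma nf2b_fc q S : fc (nf2b wz q) S = q ord0 * fc (dF (cov (wz ord0) vac)) S
  + q ord_max * fc (dF (cov (wz ord_max) vac)) S.
Proof. by rewrite /nf2b sum2 fcD !fcZ. Qed.

Lemma nf2b_lc q al :
  [/\ lc (nf2b wz q) al s01 = im / 4 * sh (q ord0) al s01 + 4^-1 * sh (q ord_max) al s01,
      lc (nf2b wz q) al s23 = - im / 4 * sh (q ord0) al s23 + 4^-1 * sh (q ord_max) al s23 &
      forall S, S \in [:: s02; s03; s12; s13] -> lc (nf2b wz q) al S = 0].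
Proof.
split=> [||S]; first 1 last.
- by rewrite lcE nf2b_fc !dz_set4 /= ![q _ * _]mulrC shD !shCM.
- rewrite !inE => /or4P[] /eqP->; rewrite lcE nf2b_fc !dz_set4 /= !mulr0 addr0; exact: sh0.
- by rewrite lcE nf2b_fc !dz_set4 /= ![q _ * _]mulrC shD !shCM.
Qed.

Lemma nf2c_lc h al :
  [/\ lc (nf2c wF h) al s01 = 2^-1 * ((al o0)%:R - (al o1)%:R) * sh h al s01 &
      lc (nf2c wF h) al s23 = 2^-1 * ((al o2)%:R - (al o3)%:R) * sh h al s23].
Proof.
(* Here S contains i and takes one factor X_i, so the exponent of X_i in h is al_i - 1. The shift
   cancels in the difference of the two indices of a pair. *)
have dW i (S : {set 'I_4}) : i \in S -> sh (W i * grad h i) al S = ((al i)%:R - 1) * sh h al S.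
  move=> iS; rewrite {1}/sh shcoefXM shcoef_deriv mnmE iS -/(sh h al S).
  rewrite /sh /shcoef; case: mnm_lepP => [/(_ i)|_]; last by rewrite !mulr0.
  by rewrite mnmE iS => pos; rewrite natrB.
rewrite !lcE /nf2c; have [-> _ _ [_ _ ->]] := cov2_fc (grad h) (grad (wF ord0)).
have shB f g S : sh (f - g) al S = sh f al S - sh g al S by exact: shcoefB.
rewrite [grad (wF ord0)]/grad !wF_deriv !oE /= ![grad h _ * (c4 _ * _)]mulrCA.
rewrite !shB !shCM ![grad h _ * _]mulrC !dW ?set4E //.
by split; ring.
Qed.

Lemma nf3_fcE p q S (r1 r2 r3 r4 : {fps K[4]}) :
  fc (cov (wz ord_max) (dF (cov (wz ord0) vac))) S = r1 ->
  fc (cov (grad (wF ord0)) (dF (cov (wz ord0) vac))) S = r2 ->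
  fc (cov (wz ord_max) (dF (cov (wz ord_max) vac))) S = r3 ->
  fc (cov (grad (wF ord0)) (dF (cov (wz ord_max) vac))) S = r4 ->
  fc (nf3 wz wF p q) S
    = p ord0 * r1 + q ord0 * r2 + (p ord_max * r3 + q ord_max * r4).
Proof.
rewrite /nf3 sum2.
move: (cov (wz ord_max) (dF (cov (wz ord0) vac))) (cov (wz ord_max) (dF (cov (wz ord_max) vac))) => u1 u2.
move: (cov (grad (wF ord0)) (dF (cov (wz ord0) vac))) (cov (grad (wF ord0)) (dF (cov (wz ord_max) vac))) => u3 u4.
by move=> <- <- <- <-; rewrite !fcD !fcZ.
Qed.

Lemma covdz_fc x j : let v := dF (cov (wz j) vac) in
  [/\ fc (cov x v) s012 = x o2 * c4 (nth 0 [:: im / 4; 4^-1] j),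
      fc (cov x v) s013 = x o3 * c4 (nth 0 [:: im / 4; 4^-1] j),
      fc (cov x v) s023 = x o0 * c4 (nth 0 [:: - im / 4; 4^-1] j) &
      fc (cov x v) s123 = x o1 * c4 (nth 0 [:: - im / 4; 4^-1] j)].
Proof. by move=> v; split; rewrite cov_set4 !dz_set4 /=; ring. Qed.

Lemma nf3_fc p q : let P := fun x y z t => c4 x * p ord0 + c4 y * p ord_max
                      + c4 z * q ord0 + c4 t * q ord_max in
  [/\ fc (nf3 wz wF p q) s012 = W o3 * P (- (8^-1 * 4^-1 * im)) (- (8^-1 * 4^-1)) (2^-1 * 4^-1 * im) (2^-1 * 4^-1),
      fc (nf3 wz wF p q) s013 = W o2 * P (8^-1 * 4^-1 * im) (8^-1 * 4^-1) (2^-1 * 4^-1 * im) (2^-1 * 4^-1),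
      fc (nf3 wz wF p q) s023 = W o1 * P (8^-1 * 4^-1 * im) (- (8^-1 * 4^-1)) (- (2^-1 * 4^-1 * im)) (2^-1 * 4^-1) &
      fc (nf3 wz wF p q) s123 = W o0 * P (- (8^-1 * 4^-1 * im)) (8^-1 * 4^-1) (- (2^-1 * 4^-1 * im)) (2^-1 * 4^-1)].
Proof.
move=> P; rewrite {}/P.
have [x012 x013 x023 x123] := covdz_fc (wz ord_max) ord0.
have [y012 y013 y023 y123] := covdz_fc (grad (wF ord0)) ord0.
have [z012 z013 z023 z123] := covdz_fc (wz ord_max) ord_max.
have [t012 t013 t023 t123] := covdz_fc (grad (wF ord0)) ord_max.
split.
- rewrite (nf3_fcE p q x012 y012 z012 t012); rewrite /grad !wF_deriv !wzE !oE /=; ring.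
- rewrite (nf3_fcE p q x013 y013 z013 t013); rewrite /grad !wF_deriv !wzE !oE /=; ring.
- rewrite (nf3_fcE p q x023 y023 z023 t023); rewrite /grad !wF_deriv !wzE !oE /=; ring.
- rewrite (nf3_fcE p q x123 y123 z123 t123); rewrite /grad !wF_deriv !wzE !oE /=; ring.
Qed.

Lemma nf3_lc p q al : let P := fun x y z t => x * sh (p ord0) al s0123 + y * sh (p ord_max) al s0123
                      + z * sh (q ord0) al s0123 + t * sh (q ord_max) al s0123 in
  [/\ lc (nf3 wz wF p q) al s012 = P (- im / 32) (- 32^-1) (im / 8) 8^-1,
      lc (nf3 wz wF p q) al s013 = P (im / 32) 32^-1 (im / 8) 8^-1,
      lc (nf3 wz wF p q) al s023 = P (im / 32) (- 32^-1) (- im / 8) 8^-1 &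
      lc (nf3 wz wF p q) al s123 = P (- im / 32) 32^-1 (- im / 8) 8^-1].
Proof.
rewrite !lcE; have [-> -> -> ->] := nf3_fc p q; split;
  rewrite !shWM ?set4_U0 ?set4_U1 ?set4_U2 ?set4_U3 ?set4E // !shD !shCM -?/s0123; by field.
Qed.

End Components.

Lemma fps_deriv_deriv n (T : comNzRingType) i j (f : {fps T[n]}) :
  fps_deriv i (fps_deriv j f) = fps_deriv j (fps_deriv i f).
Proof.
have [->//|ij] := eqVneq i j; apply: fpsP => m; rewrite !fcoef_deriv -!addmA [(U_(j) + _)%MM]addmC !mnmDE !mnm1E.
by rewrite [j == i]eq_sym (negbTE ij) !addn0 mulrnAC.
Qed.

Lemma dF_dF n (T : comNzRingType) (u : cform n T) : dF (dF u) = 0.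
Proof.
rewrite (dFE u) raddf_sum /=; under eq_bigr => i _ do rewrite dFE.
apply: sum_skew => [i|i j]; rewrite !pd_dxw; first exact: dxw_sq.
rewrite dxw_dxw addrC; apply/eqP; rewrite subr_eq0; apply/eqP; do 2!congr (dxw _ _).
by apply: formP => S; apply: fps_deriv_deriv.
Qed.

(** * Matching in special degrees *)

Section Solve.
Variables (K : numFieldType) (im : K).
Hypothesis im2 : im * im = -1.
Implicit Types (p q : 'I_2 -> {fps K[4]}) (a b f h k : {fps K[4]}).
Implicit Types (al m : 'X_{1..4}) (u : cform 4 K) (P Q : 'I_4 -> {fps K[2]}).
Implicit Types (S : {set 'I_4}).
Local Notation c4 := (@fpsC 4 K).
Local Notation W := (@wvar K).
Local Notation wz := (wzeta im).
Local Notation wF := (wfun im).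
Local Notation vac := (vacuum 4 K).
Local Notation wdelta := (log_delta (wA im) (@wB K)).
Local Notation wspecial := (special (wA im) (@wB K)).

Definition hW P := lsub (xM im) (hR P).

Definition wtform u := forall al S, ~~ wt0 al -> lc u al S = 0.

Lemma sh_supp f al S i : i \in S -> al i = 0%N -> sh f al S = 0.
Proof.
move=> iS al0; rewrite /sh /shcoef; case: mnm_lepP => // /(_ i).
by rewrite mnmE iS al0.
Qed.

Lemma sh_shift f m S : sh f (m + mind S)%MM S = fcoef f m.
Proof. by rewrite /sh /shcoef lem_addl addmK. Qed.

Lemma wtformD u v : wtform u -> wtform v -> wtform (u + v).
Proof. by move=> u0 v0 al S nw; rewrite lcD u0 ?v0 ?addr0. Qed.

(** delta preserves the degree, and every weight-zero degree is special. *)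
Lemma wtform_cycle u : wtform u -> wdelta u = 0.
Proof.
move=> u0; apply: lcP => al S; rewrite lc0.
have [wt|nwt] := boolP (wt0 al); first by rewrite lc_delta_special // wt0_special.
rewrite lc_delta /ctrv big1 // => i _; rewrite /ctr u0 //.
by case: ifP; rewrite ?mulr0.
Qed.

Lemma sh_wt0E f al S : Wt0 f -> ~~ wt0 al -> S \in [:: s01; s23; s0123] -> sh f al S = 0.
Proof.
by move=> f0 nwt; rewrite !inE => /or3P[] /eqP->; apply: sh_wt0.
Qed.

Lemma nf1a_wt p q : (forall j, Wt0 (p j)) -> (forall j, Wt0 (q j)) -> wtform (nf1a wz wF p q).
Proof.
move=> p0 q0 al S nwt; have [/eqP S1|S1] := boolP (#|S| == 1%N); last exact: lc_deg (nf1a_deg _ _ _) S1.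
have s f : Wt0 f -> (sh f al s01 = 0) * (sh f al s23 = 0).
  by move=> f0; rewrite !sh_wt0E ?inE ?eqxx ?orbT.
have [E0 E1 E2 E3] := nf1a_lc im p q al.
move: S S1; apply: deg1_cases; rewrite ?E0 ?E1 ?E2 ?E3 !(s _ (p0 _)) !(s _ (q0 _)) !mulr0 !addr0 //.
Qed.

Lemma Wt0M2 f (i j : 'I_4) : (i, j) \in [:: (o0, o1); (o2, o3)] ->
  Wt0 f -> Wt0 (W i * (W j * f)).
Proof.
move=> ij f0 m nwt; rewrite fcoefXM; case: ifP => // mi; rewrite fcoefXM; case: ifP => // mj.
apply: f0; apply: contra nwt; move: mi mj; rewrite !inE in ij; case/orP: ij => /eqP[-> ->];
rewrite /wt0 !mnmBE !mnm1E -!val_eqE /= ?oE /=; lia.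
Qed.

Lemma Wt0C c f : Wt0 f -> Wt0 (c4 c * f). Proof. exact: Wt0CM. Qed.

Lemma nf2a_wt a b p : Wt0 a -> Wt0 b -> (forall j, Wt0 (p j)) -> wtform (nf2a wz wF a b p).
Proof.
move=> a0 b0 p0 al S nwt; have [/eqP S2|S2] := boolP (#|S| == 2%N); last exact: lc_deg (nf2a_deg _ _ _ _) S2.
have s f : Wt0 f -> sh f al s0123 = 0 by move=> f0; rewrite sh_wt0E ?inE ?eqxx ?orbT.
have [E02 E03 E12 E13] := nf2a_lc im a b p al.
have [c1 [c2 [d1 [d2 [F01 F23]]]]] := nf2a_fc' im a b p.
have N c : - c4 c = c4 (- c) by rewrite rmorphN.
move: S S2; apply: deg2_cases; rewrite ?E02 ?E03 ?E12 ?E13 ?(s a) ?(s b) ?(s (p _)) ?mulr0 ?addr0 //.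
  rewrite lcE F01; apply: (@sh_wt0 _ _ _ true false) nwt.
  by apply: Wt0D; apply: Wt0M2; rewrite ?inE ?eqxx ?orbT //; apply: Wt0D; apply: Wt0C.
rewrite lcE F23 !N; apply: (@sh_wt0 _ _ _ false true) nwt.
by apply: Wt0D; apply: Wt0M2; rewrite ?inE ?eqxx ?orbT //; apply: Wt0D; apply: Wt0C.
Qed.

Lemma nf2b_wt q : (forall j, Wt0 (q j)) -> wtform (nf2b wz q).
Proof.
move=> q0 al S nwt; have [/eqP S2|S2] := boolP (#|S| == 2%N); last exact: lc_deg (nf2b_deg _ _) S2.
have s f : Wt0 f -> (sh f al s01 = 0) * (sh f al s23 = 0).
  by move=> f0; rewrite !sh_wt0E ?inE ?eqxx ?orbT.
have [E01 E23 E] := nf2b_lc im q al.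
move: S S2; apply: deg2_cases; try by apply: E; rewrite !inE eqxx ?orbT.
  by rewrite E01 !(s _ (q0 _)) !mulr0 addr0.
by rewrite E23 !(s _ (q0 _)) !mulr0 addr0.
Qed.

Lemma nf3_wt p q : (forall j, Wt0 (p j)) -> (forall j, Wt0 (q j)) -> wtform (nf3 wz wF p q).
Proof.
move=> p0 q0 al S nwt; have [/eqP S3|S3] := boolP (#|S| == 3%N); last exact: lc_deg (nf3_deg _ _ _) S3.
have s f : Wt0 f -> sh f al s0123 = 0 by move=> f0; rewrite sh_wt0E ?inE ?eqxx ?orbT.
have [E0 E1 E2 E3] := nf3_lc im p q al.
move: S S3; apply: deg3_cases; rewrite ?E0 ?E1 ?E2 ?E3 !(s _ (p0 _)) !(s _ (q0 _)) !mulr0 !addr0 //.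
Qed.

Lemma deg0_cycle u : deg_form 0 u -> wdelta u = 0.
Proof.
move=> u0; apply: lcP => al S; rewrite lc0 lc_delta /ctrv big1 // => i _; rewrite /ctr.
case: ifP => iS; rewrite ?mulr0 // (lc_deg _ u0) ?mulr0 //.
by rewrite cardsU1 iS.
Qed.

(** [zfield al] is orthogonal to the covector al and to the covectors (1, 1, 0, 0) and (0, 0, 1, 1),
    which give the components of dh and k df_1; so all h and k are allowed. *)
Lemma nf1b_cycle h k : wdelta (nf1b wF h k) = 0.
Proof.
apply: lcP => al S; rewrite lc0 lc_delta.
have [->|S0] := eqVneq S set0; last first.
  rewrite /ctrv big1 // => i _; rewrite /ctr; case: ifP => iS; rewrite ?mulr0 //.
  rewrite (lc_deg _ (nf1b_deg _ _ _)) ?mulr0 // cardsU1 iS eqSS.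
  by rewrite cards_eq0.
have [z0 z1 z2 z3] := zfieldE im al.
have [E0 E1 E2 E3] := nf1b_lc im h k al.
rewrite set4_0 /ctrv sum4 ctr40 ctr41 ctr42 ctr43 -/s0 -/s1 -/s2 -/s3 E0 E1 E2 E3 z0 z1 z2 z3 /=.
by rewrite !expr0; ring.
Qed.

Lemma nf1b_dF f : nf1b wF 0 f = f *: dF (wF ord0 *: vac).
Proof.
rewrite /nf1b dFZ dF_vac scaler0 addr0; have -> : cov (grad 0) vac = 0 :> cform 4 K.
  by have := dFZ 0 vac; rewrite scale0r raddf0 scale0r addr0 => <-.
by rewrite add0r.
Qed.

Lemma hW_sub P Q : hW P - hW Q = hW (fun i => P i - Q i).
Proof.
rewrite /hW -raddfB; congr lsub; rewrite /hR -sumrB; apply: eq_bigr => i _.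
by rewrite -mulrBl /Rx fps_substB.
Qed.

Lemma hW0 P : (forall i, P i = 0) -> hW P = 0.
Proof.
move=> P0; rewrite /hW /hR big1 ?raddf0 // => i _; rewrite P0.
by rewrite /Rx fps_subst0 mul0r.
Qed.

Lemma mn_shift01 (a b c d : nat) : (mn [:: a; b; c; d] + mind s01)%MM = mn [:: a.+1; b.+1; c; d] :> 'X_{1..4}.
Proof. by apply/mnmP; apply: ord4P; rewrite mnmDE mind_set4 !mnmE !oE /= ?addn1 ?addn0. Qed.
Lemma mn_shift23 (a b c d : nat) : (mn [:: a; b; c; d] + mind s23)%MM = mn [:: a; b; c.+1; d.+1] :> 'X_{1..4}.
Proof. by apply/mnmP; apply: ord4P; rewrite mnmDE mind_set4 !mnmE !oE /= ?addn1 ?addn0. Qed.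

Lemma sh_pure01 f (a b : nat) : sh f (mn [:: a; b; 0; 0]%N) s01 =
  if (0 < a)%N && (0 < b)%N then fcoef f (mn [:: a.-1; b.-1; 0; 0]%N) else 0.
Proof.
case: a => [|a]; first by rewrite (@sh_supp _ _ _ o0) ?set4E ?mnmE ?oE.
case: b => [|b]; first by rewrite (@sh_supp _ _ _ o1) ?set4E ?mnmE ?oE.
by rewrite -mn_shift01 sh_shift.
Qed.

Lemma sh_pure23 f (a b : nat) : sh f (mn [:: 0; 0; a; b]%N) s23 =
  if (0 < a)%N && (0 < b)%N then fcoef f (mn [:: 0; 0; a.-1; b.-1]%N) else 0.
Proof.
case: a => [|a]; first by rewrite (@sh_supp _ _ _ o2) ?set4E ?mnmE ?oE.
case: b => [|b]; first by rewrite (@sh_supp _ _ _ o3) ?set4E ?mnmE ?oE.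
by rewrite -mn_shift23 sh_shift.
Qed.

Lemma pure_ind (G : 'X_{1..4} -> Prop) :
  (forall a b : nat, a <> b -> G (mn [:: a; b; 0; 0]%N)) ->
  (forall a b : nat, a <> b -> G (mn [:: 0; 0; a; b]%N)) ->
  forall al, wspecial al -> ~~ wt0 al -> G al.
Proof.
move=> Gw Gv al sp nwt; have [[a [b [ab ->]]]|[a [b [ab ->]]]] := special_pure im2 sp nwt; auto.
Qed.

Lemma nwt_pure01 (a b : nat) : a <> b -> ~~ wt0 (mn [:: a; b; 0; 0]%N).
Proof. by move/eqP => ab; rewrite wt0_mn negb_and ab. Qed.
Lemma nwt_pure23 (a b : nat) : a <> b -> ~~ wt0 (mn [:: 0; 0; a; b]%N).
Proof. by move/eqP => ab; rewrite wt0_mn negb_and ab. Qed.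

Lemma sp_pure01 (a b : nat) : wspecial (mn [:: a; b; 0; 0]%N).
Proof. by rewrite specialE // !mnmE !oE /= eqxx implybT. Qed.
Lemma sp_pure23 (a b : nat) : wspecial (mn [:: 0; 0; a; b]%N).
Proof. by rewrite specialE // !mnmE !oE /= eqxx implybT. Qed.

Lemma natB_neq0 (a b : nat) : a <> b -> a%:R - b%:R != 0 :> K.
Proof. by move=> /eqP ab; rewrite subr_eq0 charK. Qed.

Lemma lc_supp4 u al (b0 b1 b2 b3 : bool) :
  [|| b0 && (al o0 == 0)%N, b1 && (al o1 == 0)%N, b2 && (al o2 == 0)%N | b3 && (al o3 == 0)%N] ->
  lc u al (set4 b0 b1 b2 b3) = 0.
Proof.
case/or4P => /andP[b /eqP al0]; apply: (lc_supp _ _ al0); by rewrite set4E.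
Qed.

Lemma pure1_exist u : deg_form 1 u -> exists P Q, forall al S, wspecial al -> ~~ wt0 al ->
  lc (u - nf1b wF (hW P) (hW Q)) al S = 0.
Proof.
move=> u1.
(* In a pure degree one of the two pairs has zero exponents and zero coefficients, so this single
   quotient is the difference of the two equations for h on either plane. *)
pose t : {fps K[4]} := Fps (fun al => (lc u al s0 - lc u al s1 + lc u al s2 - lc u al s3)
   / ((al o0)%:R - (al o1)%:R + (al o2)%:R - (al o3)%:R)).
have [P PE] := pure_surj im2 t; rewrite -/(hW P) in PE; exists P.
move: (hW P) PE => h PE.
(* With h known, one equation gives k. As k enters multiplied by w1 w2 or v1 v2, its coefficient at
   [m] is read in the shifted degree. *)
pose k : {fps K[4]} := Fps (fun m => if (m o2 == 0)%N && (m o3 == 0)%N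
   then 2 * (lc u (m + mind s01)%MM s0 - (m o0).+1%:R * fcoef h (m + mind s01)%MM)
   else 2 * (lc u (m + mind s23)%MM s2 - (m o2).+1%:R * fcoef h (m + mind s23)%MM)).
have [Q QE] := pure_surj im2 k; rewrite -/(hW Q) in QE; exists Q.
move: (hW Q) QE => g QE.
(* The boundary cases a = 0 and b = 0: k contributes nothing, and only one of the two equations is
   nontrivial. *)
have sol0 (B c1 : K) : 0 - B != 0 -> c1 = B * ((0 - c1) / (0 - B)) + 2^-1 * 0.
  by rewrite mulr0 addr0 !sub0r oppr_eq0 => nz; rewrite invrN mulrNN mulrC divfK.
have sol1 (A c0 : K) : A - 0 != 0 -> c0 = A * ((c0 - 0) / (A - 0)) + 2^-1 * 0.
  by rewrite !subr0 mulr0 addr0 => nz; rewrite mulrC divfK.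
have sol2 (A B c0 c1 z : K) : A - B != 0 -> z = (c0 - c1) / (A - B) ->
    c0 = A * z + 2^-1 * (2 * (c0 - A * z)) /\ c1 = B * z + 2^-1 * (2 * (c0 - A * z)).
  move=> nz eh; have {}eh : z * (A - B) = c0 - c1 by rewrite eh divfK.
  have -> : c1 = c0 - z * (A - B) by rewrite eh; ring.
  by rewrite !mulKf ?Num.Theory.pnatr_eq0 //; split; ring.
have key01 (a b : nat) : a <> b -> let al := mn [:: a; b; 0; 0]%N in
    lc u al s0 = a%:R * fcoef h al + 2^-1 * sh g al s01 /\
    lc u al s1 = b%:R * fcoef h al + 2^-1 * sh g al s01.
  move=> ab al; rewrite {}/al; have [hE _] := PE a b ab; rewrite hE sh_pure01 /= !mnmE !oE /=.
  have nab := natB_neq0 ab.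
  rewrite ![lc u _ s2]lc_supp4 ?mnmE ?oE ?orbT // ![lc u _ s3]lc_supp4 ?mnmE ?oE ?orbT //.
  rewrite ?(subr0, addr0, add0r, sub0r).
  case: a ab nab {hE} => [|a] ab nab; [|case: b ab nab => [|b] ab nab].
  - rewrite [lc u _ s0]lc_supp4 ?mnmE ?oE ?eqxx ?orbT //=; split; first by rewrite !mul0r mulr0 addr0.
    exact: sol0.
  - rewrite [lc u _ s1]lc_supp4 ?mnmE ?oE ?eqxx ?orbT //=; split; last by rewrite !mul0r mulr0 addr0.
    exact: sol1.
  - have [qE _] := QE a b (fun e => ab (congr1 S e)); rewrite qE /= !mnmE !oE /=.
    rewrite mn_shift01; have [hE _] := PE a.+1 b.+1 ab; rewrite hE /= !mnmE !oE /=.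
    rewrite ?[lc u _ s2]lc_supp4 ?mnmE ?oE ?orbT // ?[lc u _ s3]lc_supp4 ?mnmE ?oE ?orbT //.
    by rewrite ?(subr0, addr0, add0r, sub0r); apply: sol2.
have key23 (a b : nat) : a <> b -> let al := mn [:: 0; 0; a; b]%N in
    lc u al s2 = a%:R * fcoef h al + 2^-1 * sh g al s23 /\
    lc u al s3 = b%:R * fcoef h al + 2^-1 * sh g al s23.
  move=> ab al; rewrite {}/al; have [_ hE] := PE a b ab; rewrite hE sh_pure23 /= !mnmE !oE /=.
  have nab := natB_neq0 ab.
  rewrite ![lc u _ s0]lc_supp4 ?mnmE ?oE ?orbT // ![lc u _ s1]lc_supp4 ?mnmE ?oE ?orbT //.
  rewrite ?(subr0, addr0, add0r, sub0r).
  case: a ab nab {hE} => [|a] ab nab; [|case: b ab nab => [|b] ab nab].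
  - rewrite [lc u _ s2]lc_supp4 ?mnmE ?oE ?eqxx ?orbT //=; split; first by rewrite !mul0r mulr0 addr0.
    exact: sol0.
  - rewrite [lc u _ s3]lc_supp4 ?mnmE ?oE ?eqxx ?orbT //=; split; last by rewrite !mul0r mulr0 addr0.
    exact: sol1.
  - have [_ qE] := QE a b (fun e => ab (congr1 S e)); rewrite qE /= !mnmE !oE /=.
    (* Off the diagonal (a, b) is not (0, 0), so [k] takes its second branch. *)
    have -> : (a == 0)%N && (b == 0)%N = false.
      by apply/negbTE/negP => /andP[/eqP e /eqP e']; apply: ab; rewrite e e'.
    rewrite mn_shift23; have [_ hE] := PE a.+1 b.+1 ab; rewrite hE /= !mnmE !oE /=.
    rewrite ?[lc u _ s0]lc_supp4 ?mnmE ?oE ?orbT // ?[lc u _ s1]lc_supp4 ?mnmE ?oE ?orbT //.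
    by rewrite ?(subr0, addr0, add0r, sub0r); apply: sol2.
move=> al S sp nwt; have [/eqP S1|S1] := boolP (#|S| == 1%N); last first.
  by rewrite lcB (lc_deg _ u1) // (lc_deg _ (nf1b_deg _ _ _)) // subr0.
move: al sp nwt S S1; apply: pure_ind => a b ab.
  have [e0 e1] := key01 a b ab; have [E0 E1 _ _] := nf1b_lc im h g (mn [:: a; b; 0; 0]%N).
  rewrite !mnmE !oE /= in E0 E1; apply: deg1_cases; rewrite lcB ?E0 ?E1 -?e0 -?e1 ?subrr //;
    by rewrite !lc_supp4 ?subr0 ?mnmE ?oE ?eqxx ?orbT.
have [e2 e3] := key23 a b ab; have [_ _ E2 E3] := nf1b_lc im h g (mn [:: 0; 0; a; b]%N).
rewrite !mnmE !oE /= in E2 E3; apply: deg1_cases; rewrite lcB ?E2 ?E3 -?e2 -?e3 ?subrr //;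
  by rewrite !lc_supp4 ?subr0 ?mnmE ?oE ?eqxx ?orbT.
Qed.

Lemma pure1_uniq v P Q : wtform v ->
    (forall al S, wspecial al -> lc (v + nf1b wF (hW P) (hW Q)) al S = 0) ->
  (forall i, P i = 0) /\ (forall i, Q i = 0).
Proof.
move=> v0 E; have solve (A B h g : K) : A - B != 0 -> A * h + 2^-1 * g = 0 -> B * h + 2^-1 * g = 0 ->
    h = 0 /\ g = 0.
  move=> nz eA eB; have h0 : h = 0.
    have e : (A - B) * h = (A * h + 2^-1 * g) - (B * h + 2^-1 * g) by ring.
    by apply: (mulfI nz); rewrite e eA eB subrr mulr0.
  split=> //; move: eA; rewrite h0 mulr0 add0r => /eqP.
  by rewrite mulf_eq0 invr_eq0 Num.Theory.pnatr_eq0 /= => /eqP.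
have key01 (a b : nat) : a <> b -> fcoef (hW P) (mn [:: a; b; 0; 0]%N) = 0 /\
    sh (hW Q) (mn [:: a; b; 0; 0]%N) s01 = 0.
  move=> ab; have [E0 E1 _ _] := nf1b_lc im (hW P) (hW Q) (mn [:: a; b; 0; 0]%N).
  rewrite !mnmE !oE /= in E0 E1.
  by apply: (solve _ _ _ _ (natB_neq0 ab)); rewrite -?E0 -?E1;
    [have := E _ s0 (sp_pure01 a b) | have := E _ s1 (sp_pure01 a b)]; rewrite lcD v0 ?add0r //; apply: nwt_pure01.
have key23 (a b : nat) : a <> b -> fcoef (hW P) (mn [:: 0; 0; a; b]%N) = 0 /\
    sh (hW Q) (mn [:: 0; 0; a; b]%N) s23 = 0.
  move=> ab; have [_ _ E2 E3] := nf1b_lc im (hW P) (hW Q) (mn [:: 0; 0; a; b]%N).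
  rewrite !mnmE !oE /= in E2 E3.
  by apply: (solve _ _ _ _ (natB_neq0 ab)); rewrite -?E2 -?E3;
    [have := E _ s2 (sp_pure23 a b) | have := E _ s3 (sp_pure23 a b)]; rewrite lcD v0 ?add0r //; apply: nwt_pure23.
split; apply: (pure_inj im2) => a b ab.
  by have [-> _] := key01 a b ab; have [-> _] := key23 a b ab.
(* The coefficient of k at (a, b) is visible in degree (a + 1, b + 1). *)
have ab1 : a.+1 <> b.+1 by case.
have [_] := key01 _ _ ab1; have [_] := key23 _ _ ab1.
by rewrite sh_pure01 sh_pure23.
Qed.

Lemma pure2_exist u : deg_form 2 u -> exists P, forall al S, wspecial al -> ~~ wt0 al ->
  lc (u - nf2c wF (hW P)) al S = 0.
Proof.
move=> u2.
(* The inverse of the factor in [nf2c_lc]; both exponents of the pair rise by one under the shift,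
   so their difference can be taken at [m]. *)
pose t : {fps K[4]} := Fps (fun m => if (m o2 == 0%N) && (m o3 == 0%N)
   then 2 * (lc u (m + mind s01)%MM s01 / ((m o0)%:R - (m o1)%:R))
   else 2 * (lc u (m + mind s23)%MM s23 / ((m o2)%:R - (m o3)%:R))).
have [P PE] := pure_surj im2 t; rewrite -/(hW P) in PE; exists P.
move: (hW P) PE => h PE.
have sol (A c : K) : A != 0 -> c - 2^-1 * A * (2 * (c / A)) = 0 by move=> nz; field.
have nz (a b : nat) : a <> b -> (a%:R - b%:R != 0 :> K) /\ (a.+1%:R - b.+1%:R = a%:R - b%:R :> K).
  by move=> ab; split; [exact: natB_neq0 | rewrite -![_.+1%:R]natr1; ring].
move=> al S sp nwt; have [/eqP S2|S2] := boolP (#|S| == 2%N); last first.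
  by rewrite lcB (lc_deg _ u2) // (lc_deg _ (nf2c_deg _ _)) // subr0.
move: al sp nwt S S2; apply: pure_ind => a b ab; apply: deg2_cases; rewrite lcB;
  try by rewrite !lc_supp4 ?subr0 ?mnmE ?oE ?eqxx ?orbT.
- have [-> _] := nf2c_lc im h (mn [:: a; b; 0; 0]%N); rewrite sh_pure01 !mnmE !oE /=.
  case: a b ab => [|a] [|b] ab; try by rewrite lc_supp4 ?mulr0 ?subr0 ?mnmE ?oE ?eqxx ?orbT.
  have ab1 : a <> b by move=> e; apply: ab; rewrite e.
  have [-> _] := PE a b ab1; rewrite /= !mnmE !oE /= mn_shift01.
  by have [n0 ->] := nz a b ab1; apply: sol.
- have [_ ->] := nf2c_lc im h (mn [:: 0; 0; a; b]%N); rewrite sh_pure23 !mnmE !oE /=.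
  case: a b ab => [|a] [|b] ab; try by rewrite lc_supp4 ?mulr0 ?subr0 ?mnmE ?oE ?eqxx ?orbT.
  have ab1 : a <> b by move=> e; apply: ab; rewrite e.
  have [_ ->] := PE a b ab1; rewrite /= !mnmE !oE /= mn_shift23.
  have -> : (a == 0)%N && (b == 0)%N = false by apply/negbTE/negP => /andP[/eqP e /eqP e']; apply: ab1; rewrite e e'.
  by have [n0 ->] := nz a b ab1; apply: sol.
Qed.

Lemma pure2_uniq v P : wtform v ->
    (forall al S, wspecial al -> lc (v + nf2c wF (hW P)) al S = 0) ->
  forall i, P i = 0.
Proof.
move=> v0 E; have solve (A g : K) : A != 0 -> 2^-1 * A * g = 0 -> g = 0.
  by move=> nz /eqP; rewrite !mulf_eq0 invr_eq0 Num.Theory.pnatr_eq0 (negbTE nz) /= => /eqP.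
apply: (pure_inj im2); rewrite -/(hW P); move: (hW P) E => h E.
move=> a b ab; have ab1 : a.+1 <> b.+1 by case.
split; apply: (solve _ _ (natB_neq0 ab1)).
  have [F _] := nf2c_lc im h (mn [:: a.+1; b.+1; 0; 0]%N).
  rewrite sh_pure01 !mnmE !oE /= in F; rewrite -F.
  by have := E _ s01 (sp_pure01 a.+1 b.+1); rewrite lcD v0 ?add0r //; apply: nwt_pure01.
have [_ F] := nf2c_lc im h (mn [:: 0; 0; a.+1; b.+1]%N).
rewrite sh_pure23 !mnmE !oE /= in F; rewrite -F.
by have := E _ s23 (sp_pure23 a.+1 b.+1); rewrite lcD v0 ?add0r //; apply: nwt_pure23.
Qed.

Lemma Wt0_eq0 f : Wt0 f -> (forall m, wt0 m -> fcoef f m = 0) -> f = 0.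
Proof.
move=> f0 E; apply: fpsP => m; rewrite fcoef0.
by have [/E|/f0] := boolP (wt0 m).
Qed.

Lemma wt1_solve (c0 c1 c2 c3 x y z t : K) :
  c0 = - im / 8 * x + - 8^-1 * y + 2^-1 * z + - im / 2 * t ->
  c1 = im / 8 * x + 8^-1 * y + 2^-1 * z + - im / 2 * t ->
  c2 = im / 8 * x + - 8^-1 * y + 2^-1 * z + im / 2 * t ->
  c3 = - im / 8 * x + 8^-1 * y + 2^-1 * z + im / 2 * t ->
  [/\ x = - 2 * im * (c1 - c0 - c3 + c2), y = 2 * (c1 - c0 + c3 - c2),
      z = 2^-1 * (c0 + c1 + c2 + c3) & t = - im / 2 * (c2 + c3 - c0 - c1)].
Proof. by move=> -> -> -> ->; split; field: im2. Qed.

Lemma wt1_uniq p q : (forall j, Wt0 (p j)) -> (forall j, Wt0 (q j)) ->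
    (forall al S, wt0 al -> lc (nf1a wz wF p q) al S = 0) ->
  (forall j, p j = 0) /\ (forall j, q j = 0).
Proof.
move=> p0 q0 E; suff key m : wt0 m ->
    [/\ fcoef (p ord0) m = 0, fcoef (p ord_max) m = 0, fcoef (q ord0) m = 0 & fcoef (q ord_max) m = 0].
  by split; apply: ord2P; apply: Wt0_eq0 => // m /key[].
move=> wt.
(* The coefficients at [m] occur in two degrees, shifted by w1 w2 for the w-components and by v1 v2
   for the v-components; together they give an invertible system of four equations. *)
have w01 : wt0 (m + mind s01)%MM by rewrite (wt0D m true false).
have w23 : wt0 (m + mind s23)%MM by rewrite (wt0D m false true).
have [F0 F1 _ _] := nf1a_lc im p q (m + mind s01)%MM.
have [_ _ F2 F3] := nf1a_lc im p q (m + mind s23)%MM.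
rewrite (E _ _ w01) !sh_shift in F0; rewrite (E _ _ w01) !sh_shift in F1.
rewrite (E _ _ w23) !sh_shift in F2; rewrite (E _ _ w23) !sh_shift in F3.
by have [-> -> -> ->] := wt1_solve F0 F1 F2 F3; rewrite !(subrr, addr0, mulr0).
Qed.

Lemma wt2_solve (c02 c03 c12 c13 a b x y : K) :
  c02 = im / 32 * a + im / 2 * b + im / 8 * x + 0 * y ->
  c03 = - im / 32 * a + im / 2 * b + 0 * x + 8^-1 * y ->
  c12 = - im / 32 * a + im / 2 * b + 0 * x + - 8^-1 * y ->
  c13 = im / 32 * a + im / 2 * b + - im / 8 * x + 0 * y ->
  [/\ a = - 8 * im * (c02 + c13 - c03 - c12), b = - im / 2 * (c02 + c13 + c03 + c12),
      x = - 4 * im * (c02 - c13) & y = 4 * (c03 - c12)].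
Proof. by move=> -> -> -> ->; split; field: im2. Qed.

Lemma wt2_solve' (c c' x y : K) :
  c = im / 4 * x + 4^-1 * y -> c' = - im / 4 * x + 4^-1 * y ->
  x = - 2 * im * (c - c') /\ y = 2 * (c + c').
Proof. by move=> -> ->; split; field: im2. Qed.

(** The system is triangular: the four components that mix the pairs involve a, b, p but not q, and
    once these vanish the components on {0, 1} and {2, 3} determine q. *)
Lemma wt2_uniq a b p q : Wt0 a -> Wt0 b -> (forall j, Wt0 (p j)) -> (forall j, Wt0 (q j)) ->
    (forall al S, wt0 al -> lc (nf2a wz wF a b p + nf2b wz q) al S = 0) ->
  [/\ a = 0, b = 0, forall j, p j = 0 & forall j, q j = 0].
Proof.
move=> a0 b0 p0 q0 E.
have key m : wt0 m ->
    [/\ fcoef a m = 0, fcoef b m = 0, fcoef (p ord0) m = 0 & fcoef (p ord_max) m = 0].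
  move=> wt; have w : wt0 (m + mind s0123)%MM by rewrite (wt0D m true true).
  have [F02 F03 F12 F13] := nf2a_lc im a b p (m + mind s0123)%MM.
  have [_ _ F] := nf2b_lc im q (m + mind s0123)%MM.
  have {}F S : S \in [:: s02; s03; s12; s13] -> lc (nf2a wz wF a b p) (m + mind s0123)%MM S = 0.
    by move=> SS; have := E _ S w; rewrite lcD (F S SS) addr0.
  rewrite F ?inE ?eqxx ?orbT // !sh_shift in F02; rewrite F ?inE ?eqxx ?orbT // !sh_shift in F03.
  rewrite F ?inE ?eqxx ?orbT // !sh_shift in F12; rewrite F ?inE ?eqxx ?orbT // !sh_shift in F13.
  by have [-> -> -> ->] := wt2_solve F02 F03 F12 F13; rewrite !(subrr, addr0, mulr0).
have az : a = 0 by apply: Wt0_eq0 => // m /key[].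
have bz : b = 0 by apply: Wt0_eq0 => // m /key[].
have pz : forall j, p j = 0 by apply: ord2P; apply: Wt0_eq0 => // m /key[].
have nz : nf2a wz wF a b p = 0.
  by rewrite /nf2a az bz !scale0r !add0r big1 // => j _; rewrite pz scale0r.
split=> //; suff key' m : wt0 m -> fcoef (q ord0) m = 0 /\ fcoef (q ord_max) m = 0.
  by apply: ord2P; apply: Wt0_eq0 => // m /key'[].
move=> wt; have w01 : wt0 (m + mind s01)%MM by rewrite (wt0D m true false).
have w23 : wt0 (m + mind s23)%MM by rewrite (wt0D m false true).
rewrite nz add0r in E.
have [F0 _ _] := nf2b_lc im q (m + mind s01)%MM.
have [_ F1 _] := nf2b_lc im q (m + mind s23)%MM.
rewrite (E _ _ w01) !sh_shift in F0; rewrite (E _ _ w23) !sh_shift in F1.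
by have [-> ->] := wt2_solve' F0 F1; rewrite !(subrr, addr0, mulr0).
Qed.

Lemma wt3_solve (c0 c1 c2 c3 x y z t : K) :
  c0 = - im / 32 * x + - 32^-1 * y + im / 8 * z + 8^-1 * t ->
  c1 = im / 32 * x + 32^-1 * y + im / 8 * z + 8^-1 * t ->
  c2 = im / 32 * x + - 32^-1 * y + - im / 8 * z + 8^-1 * t ->
  c3 = - im / 32 * x + 32^-1 * y + - im / 8 * z + 8^-1 * t ->
  [/\ x = - 8 * im * (c1 - c0 + c2 - c3), y = 8 * (c1 - c0 - c2 + c3),
      z = - 2 * im * (c0 + c1 - c2 - c3) & t = 2 * (c0 + c1 + c2 + c3)].
Proof. by move=> -> -> -> ->; split; field: im2. Qed.

Lemma wt3_uniq p q : (forall j, Wt0 (p j)) -> (forall j, Wt0 (q j)) ->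
    (forall al S, wt0 al -> lc (nf3 wz wF p q) al S = 0) ->
  (forall j, p j = 0) /\ (forall j, q j = 0).
Proof.
move=> p0 q0 E; suff key m : wt0 m ->
    [/\ fcoef (p ord0) m = 0, fcoef (p ord_max) m = 0, fcoef (q ord0) m = 0 & fcoef (q ord_max) m = 0].
  by split; apply: ord2P; apply: Wt0_eq0 => // m /key[].
move=> wt; have w : wt0 (m + mind s0123)%MM by rewrite (wt0D m true true).
have [F0 F1 F2 F3] := nf3_lc im p q (m + mind s0123)%MM.
rewrite (E _ _ w) !sh_shift in F0; rewrite (E _ _ w) !sh_shift in F1.
rewrite (E _ _ w) !sh_shift in F2; rewrite (E _ _ w) !sh_shift in F3.
by have [-> -> -> ->] := wt3_solve F0 F1 F2 F3; rewrite !(subrr, addr0, mulr0).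
Qed.

Lemma wt1_exist u : deg_form 1 u -> exists p q,
  [/\ forall j, Wt0 (p j), forall j, Wt0 (q j) &
   forall al S, wt0 al -> lc (u - nf1a wz wF p q) al S = 0].
Proof.
move=> u1.
(* Sums and differences decouple [nf1a_lc]: t and t' are to be q_0 - im q_1 and q_0 + im q_1, while
   s and s' are to be im p_0 + p_1 and - im p_0 + p_1. *)
pose t := mkW s01 (fun al => lc u al s0 + lc u al s1).
pose s := mkW s01 (fun al => 4 * (lc u al s1 - lc u al s0)).
pose t' := mkW s23 (fun al => lc u al s2 + lc u al s3).
pose s' := mkW s23 (fun al => 4 * (lc u al s3 - lc u al s2)).
pose p (j : 'I_2) := if j == ord0 then c4 (- im / 2) * s + c4 (im / 2) * s' else c4 2^-1 * s + c4 2^-1 * s'.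
pose q (j : 'I_2) := if j == ord0 then c4 2^-1 * t + c4 2^-1 * t' else c4 (- im / 2) * t' + c4 (im / 2) * t.
exists p, q; split=> [j|j|al S wt].
- by rewrite /p; case: ifP => _; apply: Wt0D; apply: Wt0C; apply: mkW_wt0.
- by rewrite /q; case: ifP => _; apply: Wt0D; apply: Wt0C; apply: mkW_wt0.
have [/eqP S1|S1] := boolP (#|S| == 1%N); last first.
  by rewrite lcB (lc_deg _ u1) // (lc_deg _ (nf1a_deg _ _ _)) // subr0.
(* In weight zero the shift fails only if both exponents of the pair are 0, and then the components
   to be matched vanish by regularity. *)
have sup01 : ~~ (mind s01 <= al)%MM -> al o0 = 0%N /\ al o1 = 0%N.
  move/andP: wt => [/eqP e01 _]; rewrite -e01 => nle; case: (posnP (al o0)) => // pos.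
  case/mnm_lepP: nle; apply: ord4P; rewrite mnmE set4E //=; lia.
have sup23 : ~~ (mind s23 <= al)%MM -> al o2 = 0%N /\ al o3 = 0%N.
  move/andP: wt => [_ /eqP e01]; rewrite -e01 => nle; case: (posnP (al o2)) => // pos.
  case/mnm_lepP: nle; apply: ord4P; rewrite mnmE set4E //=; lia.
have tE : sh t al s01 = lc u al s0 + lc u al s1.
  by apply: (sh_mkW (b := true) (c := false)) => // /sup01 [z0 z1]; rewrite !lc_supp4 ?z0 ?z1 ?addr0.
have sE : sh s al s01 = 4 * (lc u al s1 - lc u al s0).
  by apply: (sh_mkW (b := true) (c := false)) => // /sup01 [z0 z1]; rewrite !lc_supp4 ?z0 ?z1 ?subr0 ?mulr0.
have t'E : sh t' al s23 = lc u al s2 + lc u al s3.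
  by apply: (sh_mkW (b := false) (c := true)) => // /sup23 [z0 z1]; rewrite !lc_supp4 ?z0 ?z1 ?addr0.
have s'E : sh s' al s23 = 4 * (lc u al s3 - lc u al s2).
  by apply: (sh_mkW (b := false) (c := true)) => // /sup23 [z0 z1]; rewrite !lc_supp4 ?z0 ?z1 ?subr0 ?mulr0.
have [E0 E1 E2 E3] := nf1a_lc im p q al.
move: S S1; apply: deg1_cases; rewrite lcB ?E0 ?E1 ?E2 ?E3 {E0 E1 E2 E3} /p /q /= !shD !shCM ?tE ?sE ?t'E ?s'E;
  by field: im2.
Qed.

Lemma wt2_exist u : deg_form 2 u -> exists a b p q,
  [/\ Wt0 a, Wt0 b, forall j, Wt0 (p j), forall j, Wt0 (q j) &
   forall al S, wt0 al -> lc (u - (nf2a wz wF a b p + nf2b wz q)) al S = 0].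
Proof.
move=> u2; pose e (l : seq K) al := nth 0 l 0 * lc u al s02 + nth 0 l 1 * lc u al s03
   + nth 0 l 2 * lc u al s12 + nth 0 l 3 * lc u al s13.
pose M l := mkW s0123 (e l).
(* These lists are the rows of the inverse in [wt2_solve], in the order [s02], [s03], [s12],
   [s13]. *)
pose a := M [:: - 8 * im; 8 * im; 8 * im; - 8 * im].
pose b := M [:: - im / 2; - im / 2; - im / 2; - im / 2].
pose p (j : 'I_2) := if j == ord0 then M [:: - 4 * im; 0; 0; 4 * im] else M [:: 0; 4; - 4; 0].
(* What remains lies in the components {0, 1} and {2, 3}, where [nf2b] is supported. *)
pose w := u - nf2a wz wF a b p.
pose y := mkW s01 (fun al => 4 * lc w al s01).
pose y' := mkW s23 (fun al => 4 * lc w al s23).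
pose q (j : 'I_2) := if j == ord0 then c4 (- im / 2) * y + c4 (im / 2) * y' else c4 2^-1 * y + c4 2^-1 * y'.
exists a, b, p, q; split=> [||j|j|al S wt]; try exact: mkW_wt0.
- by rewrite /p; case: ifP => _; apply: mkW_wt0.
- by rewrite /q; case: ifP => _; apply: Wt0D; apply: Wt0C; apply: mkW_wt0.
rewrite opprD addrA -/w lcB.
have w2 : deg_form 2 w by move=> S' S'2; rewrite /w fcB (u2 S') // (nf2a_deg _ _ _ _ S'2) subr0.
have [/eqP S2|S2] := boolP (#|S| == 2%N); last first.
  by rewrite (lc_deg _ w2) // (lc_deg _ (nf2b_deg _ _)) // subr0.
have [e01 e23] : al o0 = al o1 /\ al o2 = al o3 by case/andP: wt => /eqP -> /eqP ->.
have sup01 : ~~ (mind s01 <= al)%MM -> al o0 = 0%N.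
  move=> nle; case: (posnP (al o0)) => // pos.
  case/mnm_lepP: nle; apply: ord4P; rewrite mnmE set4E //=; lia.
have sup23 : ~~ (mind s23 <= al)%MM -> al o2 = 0%N.
  move=> nle; case: (posnP (al o2)) => // pos.
  case/mnm_lepP: nle; apply: ord4P; rewrite mnmE set4E //=; lia.
have sup : ~~ (mind s0123 <= al)%MM -> (al o0 == 0)%N || (al o2 == 0)%N.
  apply: contraR => pos; apply/mnm_lepP; apply: ord4P; rewrite mnmE set4E //=; lia.
have ME l : sh (M l) al s0123 = e l al.
  apply: (sh_mkW (b := true) (c := true)) => // /sup pos.
  by rewrite /e !lc_supp4 -?e01 -?e23 ?mulr0 ?addr0 //=; case/orP: pos => ->; rewrite ?orbT.
have yE : sh y al s01 = 4 * lc w al s01.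
  by apply: (sh_mkW (b := true) (c := false)) => // /sup01 z; rewrite !lc_supp4 ?z ?mulr0.
have y'E : sh y' al s23 = 4 * lc w al s23.
  by apply: (sh_mkW (b := false) (c := true)) => // /sup23 z; rewrite !lc_supp4 ?z ?mulr0 ?orbT.
have [Q01 Q23 Q0] := nf2b_lc im q al.
have [A02 A03 A12 A13] := nf2a_lc im a b p al.
move: S S2; apply: deg2_cases; rewrite ?Q01 ?Q23 ?(Q0 s02) ?(Q0 s03) ?(Q0 s12) ?(Q0 s13)
  ?inE ?eqxx ?orbT ?subr0 //;
  first 1 [ by rewrite /q /= !shD !shCM yE; field: im2 ];
  last 1 [ by rewrite /q /= !shD !shCM y'E; field: im2 ];
  rewrite /w lcB ?A02 ?A03 ?A12 ?A13 /a /b /p /= !ME /e /=; by field: im2.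
Qed.

Lemma wt3_exist u : deg_form 3 u -> exists p q,
  [/\ forall j, Wt0 (p j), forall j, Wt0 (q j) &
   forall al S, wt0 al -> lc (u - nf3 wz wF p q) al S = 0].
Proof.
move=> u3; pose e (l : seq K) al := nth 0 l 0 * lc u al s012 + nth 0 l 1 * lc u al s013
   + nth 0 l 2 * lc u al s023 + nth 0 l 3 * lc u al s123.
pose M l := mkW s0123 (e l).
(* The rows of the inverse in [wt3_solve], in the order [s012], [s013], [s023], [s123]. *)
pose p (j : 'I_2) := if j == ord0 then M [:: 8 * im; - 8 * im; - 8 * im; 8 * im] else M [:: - 8; 8; - 8; 8].
pose q (j : 'I_2) := if j == ord0 then M [:: - 2 * im; - 2 * im; 2 * im; 2 * im] else M [:: 2; 2; 2; 2].
exists p, q; split=> [j|j|al S wt].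
- by rewrite /p; case: ifP => _; apply: mkW_wt0.
- by rewrite /q; case: ifP => _; apply: mkW_wt0.
have [/eqP S3|S3] := boolP (#|S| == 3%N); last first.
  by rewrite lcB (lc_deg _ u3) // (lc_deg _ (nf3_deg _ _ _)) // subr0.
have [e01 e23] : al o0 = al o1 /\ al o2 = al o3 by case/andP: wt => /eqP -> /eqP ->.
have sup : ~~ (mind s0123 <= al)%MM -> (al o0 == 0)%N || (al o2 == 0)%N.
  apply: contraR => pos; apply/mnm_lepP; apply: ord4P; rewrite mnmE set4E //=; lia.
have ME l : sh (M l) al s0123 = e l al.
  apply: (sh_mkW (b := true) (c := true)) => // /sup pos.
  by rewrite /e !lc_supp4 -?e01 -?e23 ?mulr0 ?addr0 //=; case/orP: pos => ->; rewrite ?orbT.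
have [A0 A1 A2 A3] := nf3_lc im p q al.
move: S S3; apply: deg3_cases; rewrite lcB ?A0 ?A1 ?A2 ?A3 /p /q /= !ME /e /=; by field: im2.
Qed.

Definition spec0 u := forall al S, wspecial al -> lc u al S = 0.

Lemma spec0_wt u : spec0 u -> forall al S, wt0 al -> lc u al S = 0.
Proof. by move=> u0 al S /(wt0_special im2); apply: u0. Qed.

Lemma lc_vac f al S : lc (f *: vac) al S = if S == set0 then fcoef f al else 0.
Proof.
rewrite /lc fcZ /=; case: eqP => [->|_]; first by rewrite mulr1 mind0 shcoef0.
by rewrite mulr0 /shcoef; case: ifP.
Qed.

Lemma exist0 u : deg_form 0 u -> exists f P, Wt0 f /\ spec0 (u - (f + hW P) *: vac).
Proof.
move=> u0; pose f := fc u set0.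
have uE : u = f *: vac.
  apply: formP => S; rewrite fcZ /= /f; case: eqP => [->|/eqP]; first by rewrite mulr1.
  by rewrite -cards_eq0 mulr0 => /u0.
have [P PE] := pure_surj im2 f; rewrite -/(hW P) in PE.
(* [hW P] also has coefficients in weight-zero degrees, so the invariant series is the weight-zero
   part of what it leaves over. *)
exists (Fps (fun m => if wt0 m then fcoef (f - hW P) m else 0)), P.
move: (hW P) PE => h PE; split=> [m /negbTE /= -> //|al S sp].
rewrite uE -scalerBl lc_vac; case: ifP => // _; rewrite fcoefB fcoefD [fcoef (Fps _) _]/=.
case: ifP => [_|/negbT nwt]; first by rewrite subrK subrr.
rewrite add0r; apply/eqP; rewrite subr_eq0 eq_sym; apply/eqP.
by move: al sp nwt; apply: pure_ind => a b /PE[].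
Qed.

Lemma uniq0 f P : Wt0 f -> spec0 ((f + hW P) *: vac) -> f = 0 /\ forall i, P i = 0.
Proof.
move=> f0 E; have {}E al : wspecial al -> fcoef f al + fcoef (hW P) al = 0.
  by move=> sp; have := E al set0 sp; rewrite lc_vac eqxx fcoefD.
have P0 : forall i, P i = 0.
  apply: (pure_inj im2) => a b ab; rewrite -/(hW P).
  have := E _ (sp_pure01 a b); have := E _ (sp_pure23 a b).
  by rewrite !f0 ?nwt_pure01 ?nwt_pure23 // !add0r.
split=> //; apply: Wt0_eq0 => // m /(wt0_special im2)/E.
by rewrite (hW0 P0) fcoef0 addr0.
Qed.

(** The off-diagonal degrees come first, because [nf1b] also contributes to the weight-zero ones;
    the invariant part then corrects the latter without disturbing the former. *)
Lemma exist1 u : deg_form 1 u -> exists p q P Q,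
  [/\ forall j, Wt0 (p j), forall j, Wt0 (q j) &
      spec0 (u - (nf1a wz wF p q + nf1b wF (hW P) (hW Q)))].
Proof.
move=> u1; have [P [Q PQ]] := pure1_exist u1.
have v1 : deg_form 1 (u - nf1b wF (hW P) (hW Q)).
  by move=> S S1; rewrite fcB (u1 S) // (nf1b_deg _ _ _ S1) subr0.
have [p [q [p0 q0 E]]] := wt1_exist v1; exists p, q, P, Q; split=> // al S sp.
rewrite opprD addrCA addrC; have [wt|nwt] := boolP (wt0 al); first exact: E.
by rewrite lcB PQ // (nf1a_wt p0 q0) // subr0.
Qed.

Lemma uniq1 p q P Q : (forall j, Wt0 (p j)) -> (forall j, Wt0 (q j)) ->
    spec0 (nf1a wz wF p q + nf1b wF (hW P) (hW Q)) ->
  [/\ forall j, p j = 0, forall j, q j = 0, forall i, P i = 0 & forall i, Q i = 0].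
Proof.
move=> p0 q0 E; have [P0 Q0] := pure1_uniq (nf1a_wt p0 q0) E.
have nz : nf1b wF (hW P) (hW Q) = 0.
  by rewrite (hW0 P0) (hW0 Q0) nf1b_dF scale0r.
rewrite nz addr0 in E; have [pz qz] := wt1_uniq p0 q0 (spec0_wt E).
by split.
Qed.

Lemma exist2 u : deg_form 2 u -> exists a b p q P,
  [/\ Wt0 a /\ Wt0 b, forall j, Wt0 (p j), forall j, Wt0 (q j) &
      spec0 (u - (nf2a wz wF a b p + nf2b wz q + nf2c wF (hW P)))].
Proof.
move=> u2; have [P PE] := pure2_exist u2.
have v2 : deg_form 2 (u - nf2c wF (hW P)).
  by move=> S S2; rewrite fcB (u2 S) // (nf2c_deg _ _ S2) subr0.
have [a [b [p [q [a0 b0 p0 q0 E]]]]] := wt2_exist v2; exists a, b, p, q, P; split=> // al S sp.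
rewrite opprD addrCA addrC; have [wt|nwt] := boolP (wt0 al); first exact: E.
by rewrite lcB PE // (wtformD (nf2a_wt a0 b0 p0) (nf2b_wt q0)) // subr0.
Qed.

Lemma nf2c_dF h : nf2c wF h = dF (nf1b wF 0 h).
Proof. by rewrite nf1b_dF dFZ dF_dF scaler0 addr0 dFZ dF_vac scaler0 addr0. Qed.

(** delta anticommutes with d, and dh /\ df_1 is d of the cycle h df_1. *)
Lemma nf2c_cycle h : wdelta (nf2c wF h) = 0.
Proof.
have := nf1b_cycle 0 h; rewrite nf2c_dF /log_delta dF_dF => /eqP; rewrite subr_eq0 => /eqP->.
by rewrite dF_dF subr0 /log_pi !raddf0.
Qed.

Lemma uniq2 a b p q P : Wt0 a -> Wt0 b -> (forall j, Wt0 (p j)) -> (forall j, Wt0 (q j)) ->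
    spec0 (nf2a wz wF a b p + nf2b wz q + nf2c wF (hW P)) ->
  [/\ a = 0 /\ b = 0, forall j, p j = 0, forall j, q j = 0 & forall i, P i = 0].
Proof.
move=> a0 b0 p0 q0 E; have P0 := pure2_uniq (wtformD (nf2a_wt a0 b0 p0) (nf2b_wt q0)) E.
have nz : nf2c wF (hW P) = 0 by rewrite nf2c_dF (hW0 P0) nf1b_dF scale0r raddf0.
rewrite nz addr0 in E; have [az bz pz qz] := wt2_uniq a0 b0 p0 q0 (spec0_wt E).
by split.
Qed.

(** A pure degree has at most two positive exponents, which leaves no room for three distinct dlog
    X_i. This is why no a_i occur in H_3 and H_4. *)
Lemma pure_top (k : nat) u al S : (2 < k)%N -> deg_form k u -> wspecial al -> ~~ wt0 al -> lc u al S = 0.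
Proof.
move=> k3 uk sp nwt; have [/eqP Sk|Sk] := boolP (#|S| == k); last exact: lc_deg uk Sk.
move: al sp nwt S Sk; apply: pure_ind => a b ab S; rewrite (set4P S) card_set4;
  case: (o0 \in S); case: (o1 \in S); case: (o2 \in S); case: (o3 \in S) => Sk;
  by [rewrite -Sk in k3 | rewrite lc_supp4 // !mnmE !oE /= ?orbT].
Qed.

Lemma exist3 u : deg_form 3 u -> exists p q,
  [/\ forall j, Wt0 (p j), forall j, Wt0 (q j) & spec0 (u - nf3 wz wF p q)].
Proof.
move=> u3; have [p [q [p0 q0 E]]] := wt3_exist u3; exists p, q; split=> // al S sp.
have [wt|nwt] := boolP (wt0 al); first exact: E.
apply: (@pure_top 3) => // S' S3; by rewrite fcB (u3 S') // (nf3_deg _ _ _ S3) ?subr0.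
Qed.

Lemma uniq3 p q : (forall j, Wt0 (p j)) -> (forall j, Wt0 (q j)) ->
    spec0 (nf3 wz wF p q) -> (forall j, p j = 0) /\ (forall j, q j = 0).
Proof. by move=> p0 q0 /spec0_wt; apply: wt3_uniq. Qed.

(** Contraction with a vector is injective on top forms, so a nonzero coefficient forces [zfield al]
    to vanish, that is, weight zero. *)
Lemma top_cycle u : deg_form 4 u -> wdelta u = 0 <-> Wt0 (fc u setT).
Proof.
move=> u4; split=> [u0 m nwt|w0]; last first.
  apply: wtform_cycle => al S nwt; have [/eqP S4|S4] := boolP (#|S| == 4); last exact: lc_deg u4 S4.
  have -> : S = set4 true true true true.
    by rewrite -set4_full; apply/eqP; rewrite eqEcard subsetT cardsT card_ord S4.
  by rewrite lcE sh_wt0 // -set4_full.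
rewrite fcoef_lc set4_full; have := wt0D m true true.
set al := (m + _)%MM => wtE; move: nwt; rewrite -wtE /wt0 negb_and => nwt.
have [z0 z1 z2 z3] := zfieldE im al.
have nz (a b : nat) : a != b -> 8 * im * (a%:R - b%:R) != 0 :> K.
  by move=> /eqP ab; rewrite mulf_neq0 ?n8im ?natB_neq0.
have F S : ctrv (zfield (wA im) (@wB K) al) (lc u al) S = 0 by rewrite -lc_delta u0 lc0.
case/orP: nwt => /nz nz'.
  (* The component that omits an index isolates the entry of [zfield al] there; the entries at 2 and
     0 detect the two differences of exponents. *)
  have := F (set4 true true false true); rewrite /ctrv sum4 ctr40 ctr41 ctr42 ctr43 /= z2.
  have sg : (-1) ^+ (1 + 1) = 1 :> K by rewrite sqrrN expr1n.
  by rewrite sg mul1r !mulr0 !add0r addr0 mulNr => /eqP; rewrite oppr_eq0 mulf_eq0 (negbTE nz') => /eqP.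
have := F (set4 false true true true); rewrite /ctrv sum4 ctr40 ctr41 ctr42 ctr43 /= z0.
by rewrite !mulr0 !addr0 => /eqP; rewrite mulf_eq0 (negbTE nz') => /eqP.
Qed.

End Solve.

(** * Descent to real forms *)

Section RealSide.
Variable R : realType.
Local Notation X := (@x R).
Local Notation vacR := (vacuum 4 R).

Lemma f1_deriv i : fps_deriv i (f1 : {fps R[4]}) = nth 0 [:: 2 * X o0; - (2 * X o1); 2 * X o2; - (2 * X o3)] i.
Proof.
rewrite /f1 /x1 /x2 /x3 /x4 -/o0 -/o1 -/o2 -/o3 /x !(raddfB, raddfD) /= !expr2 !fps_derivM !fps_derivX.
by move: i; apply: ord4P; rewrite -!val_eqE /= !oE /=; ring.
Qed.

Lemma f2_deriv i : fps_deriv i (f2 : {fps R[4]}) = nth 0 [:: 2 * X o1; 2 * X o0; 2 * X o3; 2 * X o2] i.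
Proof.
rewrite /f2 /x1 /x2 /x3 /x4 -/o0 -/o1 -/o2 -/o3 /x.
have -> : 2%:R = fpsC 4 2 :> {fps R[4]} by rewrite rmorph_nat.
rewrite fps_derivCM (raddfD (fps_deriv i)) /= !fps_derivM !fps_derivX.
by move: i; apply: ord4P; rewrite -!val_eqE /= !oE /=; ring.
Qed.

Definition zR (j : 'I_2) (i : 'I_4) : {fps R[4]} := Defs.half R *
  nth 0 (nth [::] [:: [:: - X o2; X o3; X o0; - X o1]; [:: - X o3; - X o2; X o1; X o0]] j) i.

Lemma cov_vacE (a : 'I_4 -> {fps R[4]}) : cov a vacR = a o0 *: dxw o0 vacR + a o1 *: dxw o1 vacR
   + a o2 *: dxw o2 vacR + a o3 *: dxw o3 vacR.
Proof. exact: sum4. Qed.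

Lemma toF_zeta1_shape h a b c d (w0 w1 w2 w3 : dform 4 R) :
  toF (h *: (a *: w0 + b *: w1 + c *: w2 - d *: w3))
    = (h * a) *: toF w0 + (h * b) *: toF w1 + (h * c) *: toF w2 + (h * - d) *: toF w3.
Proof.
rewrite toFZ raddfB !raddfD /= !toFZ.
by rewrite scalerN !scalerA [h * - d]mulrN scaleNr.
Qed.

Lemma toF_zeta2_shape h a b c d (w0 w1 w2 w3 : dform 4 R) :
  toF (h *: (a *: w0 - b *: w1 + c *: w2 + d *: w3))
    = (h * a) *: toF w0 + (h * - b) *: toF w1 + (h * c) *: toF w2 + (h * d) *: toF w3.
Proof.
rewrite toFZ !raddfD raddfN /= !toFZ.
by rewrite scalerN !scalerA [h * - b]mulrN scaleNr.
Qed.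

Lemma toF_zeta j : toF (zeta j) = cov (zR j) vacR.
Proof.
rewrite cov_vacE /zR !oE -!toF_dx; move: j; apply: ord2P.
  exact: toF_zeta1_shape.
exact: toF_zeta2_shape.
Qed.

Definition fR (j : 'I_2) : {fps R[4]} := if j == ord0 then f1 else f2.

Lemma toF_df j : toF (df j) = cov (grad (fR j)) vacR.
Proof. by rewrite /df /df1 /df2 /fR; case: ifP => _; rewrite toF_dR0. Qed.

Definition A_ (i : 'I_4) : {fps R[4]} := nth 0 [:: X o2; X o3; - X o0; - X o1] i.
Definition B_ (i : 'I_4) : {fps R[4]} := 4 * nth 0 [:: - X o3; X o2; X o1; - X o0] i.

Lemma toF_df1 : toF df1 = cov (grad f1) vacR. Proof. exact: toF_dR0. Qed.
Lemma toF_df2 : toF df2 = cov (grad f2) vacR. Proof. exact: toF_dR0. Qed.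

Lemma toF_wedge4 i j (w1 w2 : dform 4 R) :
  toF (dx R i ∧ dx R j ∧ w1 ∧ w2) = dxw i (dxw j (wf (toF w1) (toF w2))).
Proof. by rewrite !toF_dxw toF_wedge. Qed.

Lemma fc_toF (w : dform 4 R) K : w K = fc (toF w) K. Proof. by []. Qed.

Lemma wedge4_top i j (w1 w2 : dform 4 R) a b :
  toF w1 = cov a vacR -> toF w2 = cov b vacR ->
  (dx R i ∧ dx R j ∧ w1 ∧ w2) setT = fc (dxw i (dxw j (cov a (cov b vacR)))) setT.
Proof. by move=> e1 e2; rewrite fc_toF toF_wedge4 e1 e2 wf_cov. Qed.

Lemma poissonE (i j : 'I_4) : (i < j)%N -> poisson R i j = A_ i * B_ j - A_ j * B_ i.
Proof.
move=> lt_ij; rewrite [LHS](wedge4_top i j toF_df1 toF_df2).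
have [u01 u02 u03 [u12 u13 u23]] := @cov2_fc R (grad f1) (grad f2).
rewrite set4_full; move: (cov (grad f1) _) u01 u02 u03 u12 u13 u23 => u u01 u02 u03 u12 u13 u23.
move: i j lt_ij; apply: ord4P; apply: ord4P => lt_ij; (try by rewrite !oE in lt_ij);
  rewrite dxw4 ?ext40 ?ext41 ?ext42 ?ext43 dxw4 ?ext40 ?ext41 ?ext42 ?ext43 -/s23 -/s13 -/s12 -/s03 -/s02 -/s01
    ?u01 ?u02 ?u03 ?u12 ?u13 ?u23 /grad !f1_deriv !f2_deriv /A_ /B_ !oE /=; ring.
Qed.

Lemma toF_contract_poisson w : toF (contract2 (@poisson R) w) = interior B_ (interior A_ (toF w)).
Proof.
rewrite toF_contract2 -ctw2_interior /ctw2; apply: eq_bigr => i _; apply: eq_bigr => j lt_ij.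
by rewrite poissonE.
Qed.

End RealSide.

Lemma eq_cov n (T : comNzRingType) (a b : 'I_n -> {fps T[n]}) u : a =1 b -> cov a u = cov b u.
Proof. by move=> /funext ->. Qed.

(** * Complexification, diagonal coordinates and real parts *)

Section Bridge.
Variables (R : realType) (K : numFieldType) (im : K).
Hypothesis im2 : im * im = -1.
Variables (c : {rmorphism R -> K}) (r : {additive K -> R}).
Hypothesis rM : forall a b, r (c a * b) = a * r b.
Hypothesis r1 : r 1 = 1.
Implicit Types (p : {fps R[4]}) (w : dform 4 R) (v : cform 4 K) (P : {fps K[4]}).
Local Notation c4 := (@fpsC 4 K).
Local Notation W := (@wvar K).
Local Notation wz := (wzeta im).
Local Notation wF := (wfun im).
Local Notation vac := (vacuum 4 K).
Local Notation wdelta := (log_delta (wA im) (@wB K)).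
Local Notation wpi := (log_pi (wA im) (@wB K)).

(* [phi] and [Phi] pass to the coordinates X over [K]; [psi] and [Psi] go back
   and take real parts. *)
Definition phi p : {fps K[4]} := lsub (xM im) (fps_map c p).
Definition psi P : {fps R[4]} := fps_map r (lsub (xN im) P).
Definition PhiC (u : cform 4 R) : cform 4 K := pull (xM im) (fmap c u).
Definition Phi w : cform 4 K := PhiC (toF w).
Definition Psi v : cform 4 R := fmap r (pull (xN im) v).

Lemma PhiE w : Phi w = PhiC (toF w). Proof. by []. Qed.
Lemma PhiCE u : PhiC u = pull (xM im) (fmap c u). Proof. by []. Qed.

Lemma phi_zmod : zmod_morphism phi. Proof. by move=> p p'; rewrite /phi !raddfB. Qed.
Lemma phi_monoid : monoid_morphism phi.
Proof. by split=> [|p p']; rewrite /phi ?rmorph1 ?rmorphM. Qed.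
Lemma psi_zmod : zmod_morphism psi. Proof. by move=> P P'; rewrite /psi !raddfB. Qed.
Lemma PhiC_zmod : zmod_morphism PhiC. Proof. by move=> u v; rewrite /PhiC !raddfB. Qed.
Lemma Phi_zmod : zmod_morphism Phi. Proof. by move=> w w'; rewrite /Phi /PhiC !raddfB. Qed.
Lemma Psi_zmod : zmod_morphism Psi. Proof. by move=> v v'; rewrite /Psi !raddfB. Qed.

HB.instance Definition _ := GRing.isZmodMorphism.Build {fps R[4]} {fps K[4]} phi phi_zmod.
HB.instance Definition _ := GRing.isMonoidMorphism.Build {fps R[4]} {fps K[4]} phi phi_monoid.
HB.instance Definition _ := GRing.isZmodMorphism.Build {fps K[4]} {fps R[4]} psi psi_zmod.
HB.instance Definition _ := GRing.isZmodMorphism.Build (cform 4 R) (cform 4 K) PhiC PhiC_zmod.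
HB.instance Definition _ := GRing.isZmodMorphism.Build (dform 4 R) (cform 4 K) Phi Phi_zmod.
HB.instance Definition _ := GRing.isZmodMorphism.Build (cform 4 K) (cform 4 R) Psi Psi_zmod.

Lemma rc a : r (c a) = a. Proof. by rewrite -[c a]mulr1 rM r1 mulr1. Qed.

Lemma fmap_rc (u : cform 4 R) : fmap r (fmap c u) = u.
Proof. by apply: formP => S; apply: fpsP => m; rewrite /= rc. Qed.

Lemma psiK p : psi (phi p) = p.
Proof. by rewrite /psi /phi (lsubK (xMN im2)); apply: fpsP => m; rewrite /= rc. Qed.

Lemma PsiK w : Psi (Phi w) = toF w.
Proof. by rewrite /Psi /Phi /PhiC (pullK (xMN im2)) fmap_rc. Qed.

Lemma PhiCZ p u : PhiC (p *: u) = phi p *: PhiC u.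
Proof. by rewrite /PhiC fmapZ pullZ. Qed.

Lemma PsiZ P u : Psi (P *: PhiC u) = psi P *: u.
Proof. by rewrite /Psi /PhiC pullZ (pullK (xMN im2)) (fmap_projZr rM). Qed.

Lemma PhiC_dF u : PhiC (dF u) = dF (PhiC u).
Proof. by rewrite /PhiC fmap_dF pull_dF. Qed.

Lemma Psi_dF v : Psi (dF v) = dF (Psi v).
Proof. by rewrite /Psi pull_dF fmap_dF. Qed.

Lemma PhiC_vac : PhiC (vacuum 4 R) = vac.
Proof. by rewrite /PhiC fmap_vac pull_vac. Qed.

Lemma PhiC_cov a u : PhiC (cov a u) = cov (fun j => \sum_i phi (a i) * dlin (xM im) i j) (PhiC u).
Proof. by rewrite /PhiC fmap_cov pull_cov. Qed.

Lemma PhiC_grad p u : PhiC (cov (grad p) u) = cov (grad (phi p)) (PhiC u).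
Proof.
rewrite PhiC_cov; apply: eq_cov => j; rewrite /grad /phi lsub_deriv.
by apply: eq_bigr => i _; rewrite fps_map_deriv mulrC.
Qed.

Lemma deg_Phi k w : is_form k w -> deg_form k (Phi w).
Proof. by move=> /is_formE wk; apply/deg_pull/deg_fmap. Qed.

Lemma deg_Psi k v : deg_form k v -> is_form k (ofF (Psi v)).
Proof. by move=> vk; apply/is_formE; rewrite ofFK; apply/deg_fmap/deg_pull. Qed.

(** The constants are expressed through 1/4 and im. The powers of [q] are chosen so that the two
    sides of the identities below have equal degree in [q], and [ring] needs no relation besides
    [JJ]. *)
Let q := c4 4^-1.
Let J := c4 im.
Let JJ : J * J = -1. Proof. by rewrite /J -rmorphM im2 rmorphN1. Qed.
Let q2 : c4 2^-1 = 8 * q * q.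
Proof. by rewrite /q -(rmorph_nat c4) -!rmorphM; congr c4; field. Qed.
Let q8 : c4 8^-1 = 32 * q * q * q * q.
Proof. by rewrite /q -(rmorph_nat c4) -!rmorphM; congr c4; field. Qed.
Let Jq : (c4 (im / 4) = J * q) * (c4 (- im / 4) = - (J * q)).
Proof. by split; rewrite ?mulNr ?rmorphN /= rmorphM. Qed.
Let J8 : (c4 (im / 8) = J * c4 8^-1) * (c4 (- im / 8) = - (J * c4 8^-1)).
Proof. by split; rewrite ?mulNr ?rmorphN /= rmorphM. Qed.

Lemma linE i : lin (xM im) i = nth 0 [:: q * (W o0 + W o1 + W o2 + W o3);
   J * q * (- W o0 - W o1 + W o2 + W o3); J * q * (- W o0 + W o1 + W o2 - W o3);
   q * (- W o0 + W o1 - W o2 + W o3)] i.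
Proof.
by rewrite /lin sum4 /q /J; move: i; apply: ord4P; rewrite /xM !oE /= -?/(W _); ring.
Qed.

Lemma phiX i : phi (fpsX R i) = lin (xM im) i.
Proof. by rewrite /phi fps_mapX lsubX. Qed.

Lemma phiC a : phi (fpsC 4 a) = c4 (c a).
Proof. by rewrite /phi fps_mapC lsubC. Qed.

Lemma phi_half : phi (Defs.half R) = c4 2^-1.
Proof. by rewrite phiC fmorphV rmorph_nat. Qed.

Lemma phi_f j : phi (fR R j) = wF j.
Proof.
move: j; apply: ord2P; rewrite /fR /f1 /f2 /wfun /= /x1 /x2 /x3 /x4 /x -/o0 -/o1 -/o2 -/o3.
  by rewrite raddfB raddfD raddfB /= !rmorphXn /= !phiX !linE !oE /= q2; ring: JJ.
rewrite rmorphM rmorph_nat raddfD /= !rmorphM /= !phiX !linE !oE /=.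
rewrite rmorphN /= q2 -/J.
by ring: JJ.
Qed.

Lemma PhiC_zeta j u : PhiC (cov (zR R j) u) = cov (wz j) (PhiC u).
Proof.
rewrite PhiC_cov; apply: eq_cov => k; rewrite sum4 /zR !rmorphM /= phi_half /dlin.
rewrite wzE q2; move: j k; apply: ord2P; apply: ord4P;
  by rewrite /xM !oE /= ?J8 ?Jq ?rmorphN /= ?phiX !linE !oE /= ?q8 -/q; ring: JJ.
Qed.

Lemma pull_poisson v :
  pull (xM im) (interior (fun i => fps_map c (B_ R i)) (interior (fun i => fps_map c (A_ R i)) v))
   = wpi (pull (xM im) v).
Proof.
rewrite (@pull_interior _ _ _ _ (logfield (@wB K))) ?(@pull_interior _ _ _ _ (logfield (wA im))) // => i.
  rewrite sum4 -/(phi _) /dlin /logfield /A_ -?/(W _).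
  by move: i; apply: ord4P; rewrite /xM /wA !oE /= ?Jq ?rmorphN /= ?phiX !linE !oE /= -/q -/J; ring: JJ.
rewrite sum4 -/(phi _) /dlin /logfield /B_ -?/(W _) rmorphM rmorph_nat.
by move: i; apply: ord4P; rewrite /xM /wB !oE /= ?Jq ?rmorphN ?(rmorph_nat c4) /= ?phiX !linE !oE /= -/q; ring: JJ.
Qed.

Lemma fmap_interior (V : 'I_4 -> {fps R[4]}) u :
  fmap c (interior V u) = interior (fun i => fps_map c (V i)) (fmap c u).
Proof. by rewrite /interior raddf_sum; apply: eq_bigr => i _; rewrite /= fmapZ fmap_ctw. Qed.

Lemma fmap_proj_interior (V : 'I_4 -> {fps R[4]}) v :
  fmap r (interior (fun i => fps_map c (V i)) v) = interior V (fmap r v).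
Proof. by rewrite /interior raddf_sum; apply: eq_bigr => i _; rewrite /= (fmap_projZ rM) fmap_ctw. Qed.

Lemma toF_delta w : toF (delta w)
  = interior (@B_ R) (interior (@A_ R) (dF (toF w))) - dF (interior (@B_ R) (interior (@A_ R) (toF w))).
Proof.
have E a b : toF (a - b) = toF a - toF b :> cform 4 R by exact: raddfB.
rewrite /delta E (toF_contract_poisson (dR w)) (toF_dR w) (toF_dR (contract2 _ w)).
by rewrite (toF_contract_poisson w).
Qed.

Lemma PhiC_pi u : PhiC (interior (@B_ R) (interior (@A_ R) u)) = wpi (PhiC u).
Proof. by rewrite /PhiC 2!fmap_interior pull_poisson. Qed.

Lemma Phi_delta w : Phi (delta w) = wdelta (Phi w).
Proof.
rewrite /Phi toF_delta raddfB /= PhiC_dF /log_delta; move: (toF w) => u.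
by congr (_ - dF _); rewrite PhiC_pi ?PhiC_dF.
Qed.

Lemma Psi_log_pi v : Psi (wpi v) = interior (@B_ R) (interior (@A_ R) (Psi v)).
Proof.
rewrite -[in LHS](pullK (xNM im2) v) -pull_poisson /Psi (pullK (xMN im2)).
by rewrite !fmap_proj_interior.
Qed.

Lemma Psi_delta v : Psi (wdelta v) = toF (delta (ofF (Psi v))).
Proof. by rewrite toF_delta ofFK /log_delta raddfB /= Psi_log_pi !Psi_dF Psi_log_pi. Qed.

Lemma cycle_iff w : delta w = 0 <-> wdelta (Phi w) = 0.
Proof.
rewrite -Phi_delta; split=> [->|E]; first by rewrite raddf0.
by apply: toF_inj; rewrite -PsiK E !raddf0.
Qed.

Lemma log_deltaB (u v : cform 4 K) : wdelta (u - v) = wdelta u - wdelta v.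
Proof.
have alg (a b d e : cform 4 K) : a - b - (d - e) = a - d - (b - e).
  by rewrite !opprB !addrA [LHS]addrAC [a - b - d]addrAC [LHS]addrAC.
have lpB a b : wpi (a - b) = wpi a - wpi b by rewrite /log_pi !raddfB.
rewrite /log_delta lpB (raddfB (@dF 4 K) u v) lpB (raddfB (@dF 4 K) (wpi u)).
exact: alg.
Qed.

(* A normal form [N] over [K] matching [Phi w] in the special degrees differs
   from it by a boundary, whose real part is a boundary. *)
Lemma boundary_of_spec k w N w' : is_form k w -> delta w = 0 -> deg_form k N ->
  wdelta N = 0 -> spec0 im (Phi w - N) -> Psi N = toF w' -> is_boundary k (w' - w).
Proof.
move=> wk w0 Nk N0 sp NE.
have dk : deg_form k (Phi w - N) by move=> S Sk; rewrite fcB (deg_Phi wk Sk) (Nk _ Sk) subr0.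
have d0 : wdelta (Phi w - N) = 0.
  by rewrite log_deltaB (proj1 (cycle_iff w) w0) N0 subrr.
have [v vk vE] := log_delta_exact dk d0 sp.
exists (ofF (Psi (- v))).
  by apply: deg_Psi => S Sk; rewrite fcN (vk _ Sk) oppr0.
apply: toF_inj; rewrite -Psi_delta -[- v]sub0r log_deltaB -vE.
have -> : wdelta 0 = 0 by have := log_deltaB 0 0; rewrite !subrr.
by rewrite sub0r opprB (raddfB Psi) /= NE PsiK -(raddfB (@toF 4 R)).
Qed.

Lemma spec_of_boundary k w : is_boundary k w -> spec0 im (Phi w).
Proof. by case=> v vk -> al S sp; rewrite Phi_delta lc_delta_special. Qed.

End Bridge.

(** * The representatives over R and over K *)

Section NfReal.
Variable R : realType.
Local Notation vacR := (vacuum 4 R).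
Local Notation zR := (zR R).
Local Notation fR := (fR R).
Implicit Types (p q : 'I_2 -> {fps R[4]}) (h k : {fps R[4]}).

Lemma toFD_eq (u v : dform 4 R) u' v' : toF u = u' -> toF v = v' -> toF (u + v) = u' + v'.
Proof. by move=> <- <-; apply: raddfD. Qed.

Lemma toFZ_eq h (u : dform 4 R) u' : toF u = u' -> toF (h *: u) = h *: u'.
Proof. by move=> <-; apply: toFZ. Qed.

Lemma toF_sum_eq n (F : 'I_n -> dform 4 R) G :
  (forall i, toF (F i) = G i) -> toF (\sum_i F i) = \sum_i G i.
Proof. by move=> FG; rewrite raddf_sum; apply: eq_bigr => i _; apply: FG. Qed.

Lemma toF_wedge_eq (u v : dform 4 R) a v' :
  toF u = cov a vacR -> toF v = v' -> toF (u ∧ v) = cov a v'.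
Proof.
move=> uE <-; apply: etrans (toF_wedge u v) _; rewrite uE; exact: wf_cov.
Qed.

Lemma toF_dR_eq (u : dform 4 R) u' : toF u = u' -> toF (dR u) = dF u'.
Proof. by move=> <-; apply: toF_dR. Qed.

Definition nfX1 p q h k := nf1a zR fR p q + nf1b fR h k.
Definition nfX2 a b p q h := nf2a zR fR a b p + nf2b zR q + nf2c fR h.

Lemma nf1bE (T : comNzRingType) (F : 'I_2 -> {fps T[4]}) f g :
  nf1b F f g = dF (f *: vacuum 4 T) + g *: cov (grad (F ord0)) (vacuum 4 T).
Proof. by rewrite dFZ dF_vac scaler0 addr0. Qed.

Lemma nf2cE (T : comNzRingType) (F : 'I_2 -> {fps T[4]}) f :
  nf2c F f = dF (f *: cov (grad (F ord0)) (vacuum 4 T)).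
Proof.
rewrite dFZ; have -> : dF (cov (grad (F ord0)) (vacuum 4 T)) = 0.
  have -> : cov (grad (F ord0)) (vacuum 4 T) = dF (F ord0 *: vacuum 4 T).
    by rewrite dFZ dF_vac scaler0 addr0.
  exact: dF_dF.
by rewrite scaler0 addr0.
Qed.

Lemma toF_nf1 (p q : 'I_2 -> {fps R[4]}) (a b : 'I_4 -> {fps R[4]}) :
  toF (\sum_j (p j *: zeta j + q j *: df j)
       + \sum_i (dR (form0 (a i * x i)) + (b i * x i) *: df1))
   = nfX1 p q (\sum_i a i * x i) (\sum_i b i * x i).
Proof.
apply: toFD_eq.
  apply: toF_sum_eq => j; apply: toFD_eq; apply: toFZ_eq; first exact: toF_zeta.
  exact: toF_df.
have -> : nf1b fR (\sum_i a i * x i) (\sum_i b i * x i)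
    = \sum_i (dF ((a i * x i) *: vacR) + (b i * x i) *: cov (grad f1) vacR).
  by rewrite nf1bE !scaler_suml raddf_sum -big_split.
apply: toF_sum_eq => i; apply: toFD_eq; first by apply: toF_dR_eq; apply: toF_form0.
by apply: toFZ_eq; apply: toF_df1.
Qed.

Lemma toF_zeta1 : toF (zeta1 : dform 4 R) = cov (zR ord0) vacR.
Proof. exact: (toF_zeta R ord0). Qed.
Lemma toF_zeta2 : toF (zeta2 : dform 4 R) = cov (zR ord_max) vacR.
Proof. exact: (toF_zeta R ord_max). Qed.

Lemma toF_nf2 (p0 q0 : {fps R[4]}) (p q : 'I_2 -> {fps R[4]}) (a : 'I_4 -> {fps R[4]}) :
  toF (p0 *: (zeta1 ∧ zeta2) + q0 *: (df1 ∧ df2)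
       + \sum_j (p j *: dR (f1 *: zeta j) + q j *: dR (zeta j))
       + \sum_i dR (form0 (a i * x i)) ∧ df1)
   = nfX2 p0 q0 p q (\sum_i a i * x i).
Proof.
rewrite /nfX2; apply: toFD_eq; last first.
  have -> : nf2c fR (\sum_i a i * x i) = \sum_i cov (grad (a i * x i)) (cov (grad f1) vacR).
    rewrite nf2cE scaler_suml raddf_sum; apply: eq_bigr => i _ /=.
    rewrite dFZ [X in _ + _ *: X](_ : _ = 0) ?scaler0 ?addr0 //.
    rewrite (_ : cov _ _ = dF (fR ord0 *: vacR)) ?dF_dF //.
    by rewrite dFZ dF_vac scaler0 addr0.
  by apply: toF_sum_eq => i; apply: toF_wedge_eq; [exact: toF_dR0 | exact: toF_df1].
rewrite /nf2a /nf2b -[RHS]addrA -big_split; apply: toFD_eq.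
  apply: toFD_eq; apply: toFZ_eq; first exact: toF_wedge_eq toF_zeta1 toF_zeta2.
  exact: toF_wedge_eq (toF_df1 R) (toF_df2 R).
apply: toF_sum_eq => j; apply: toFD_eq; apply: toFZ_eq; apply: toF_dR_eq; last exact: toF_zeta.
by apply: toFZ_eq; exact: toF_zeta.
Qed.

Lemma toF_nf3 (p q : 'I_2 -> {fps R[4]}) :
  toF (\sum_j (p j *: (zeta2 ∧ dR (zeta j)) + q j *: (df1 ∧ dR (zeta j))))
   = nf3 zR fR p q.
Proof.
apply: toF_sum_eq => j; apply: toFD_eq; apply: toFZ_eq.
  by apply: toF_wedge_eq; [exact: toF_zeta2 | apply: toF_dR_eq; exact: toF_zeta].
by apply: toF_wedge_eq; [exact: toF_df1 | apply: toF_dR_eq; exact: toF_zeta].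
Qed.

End NfReal.

Section NfBridge.
Variables (R : realType) (K : numFieldType) (im : K).
Hypothesis im2 : im * im = -1.
Variables (c : {rmorphism R -> K}) (r : {additive K -> R}).
Hypothesis rM : forall a b, r (c a * b) = a * r b.
Local Notation phi := (phi im c).
Local Notation psi := (psi im r).
Local Notation PhiC := (PhiC im c).
Local Notation Psi := (Psi im r).
Local Notation vac := (vacuum 4 K).
Local Notation vacR := (vacuum 4 R).
Local Notation zR := (zR R).
Local Notation fR := (fR R).
Local Notation wz := (wzeta im).
Local Notation wF := (wfun im).

Lemma PhiC_gradf j u : PhiC (cov (grad (fR j)) u) = cov (grad (wF j)) (PhiC u).
Proof. by rewrite PhiC_grad phi_f. Qed.

Lemma PhiC_zeta_eq j u E : E = PhiC u -> cov (wz j) E = PhiC (cov (zR j) u).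
Proof. by move=> ->; apply: esym; apply: PhiC_zeta. Qed.

Lemma PhiC_gradf_eq j u E : E = PhiC u -> cov (grad (wF j)) E = PhiC (cov (grad (fR j)) u).
Proof. by move=> ->; apply: esym; apply: PhiC_gradf. Qed.

Lemma PhiC_dF_eq u E : E = PhiC u -> dF E = PhiC (dF u).
Proof. by move=> ->; apply: esym; apply: PhiC_dF. Qed.

Lemma PhiC_vac_eq : vac = PhiC vacR. Proof. exact: esym (PhiC_vac im c). Qed.

Lemma PhiCZ_eq p u E : E = PhiC u -> PhiC (p *: u) = phi p *: E.
Proof. by move=> ->; apply: PhiCZ. Qed.

Lemma PhiCD_eq u v U V : PhiC u = U -> PhiC v = V -> PhiC (u + v) = U + V.
Proof. by move=> <- <-; apply: raddfD. Qed.

Lemma PhiC_sum_eq n (F : 'I_n -> cform 4 R) G :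
  (forall i, PhiC (F i) = G i) -> PhiC (\sum_i F i) = \sum_i G i.
Proof. by move=> FG; rewrite raddf_sum; apply: eq_bigr => i _; apply: FG. Qed.

Lemma PsiZ_eq P u E : E = PhiC u -> Psi (P *: E) = psi P *: u.
Proof. by move=> ->; apply: PsiZ. Qed.

Lemma PsiD_eq u v U V : Psi u = U -> Psi v = V -> Psi (u + v) = U + V.
Proof. by move=> <- <-; apply: raddfD. Qed.

Lemma Psi_sum_eq n (F : 'I_n -> cform 4 K) G :
  (forall i, Psi (F i) = G i) -> Psi (\sum_i F i) = \sum_i G i.
Proof. by move=> FG; rewrite raddf_sum; apply: eq_bigr => i _; apply: FG. Qed.

Lemma Psi_dF_eq u U : Psi u = U -> Psi (dF u) = dF U.
Proof. by move=> <-; apply: Psi_dF. Qed.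

Lemma cov_wzE j : cov (wz j) vac = PhiC (cov (zR j) vacR).
Proof. exact: PhiC_zeta_eq PhiC_vac_eq. Qed.

Lemma cov_wFE j : cov (grad (wF j)) vac = PhiC (cov (grad (fR j)) vacR).
Proof. exact: PhiC_gradf_eq PhiC_vac_eq. Qed.

Lemma wdzE j : dF (cov (wz j) vac) = PhiC (dF (cov (zR j) vacR)).
Proof. exact: PhiC_dF_eq (cov_wzE j). Qed.

Lemma wdFzE j : dF (wF ord0 *: cov (wz j) vac) = PhiC (dF (fR ord0 *: cov (zR j) vacR)).
Proof.
apply: PhiC_dF_eq; apply: esym; apply: etrans (PhiCZ_eq _ (cov_wzE j)) _.
by rewrite phi_f.
Qed.

Lemma PhiC_nf1 p q h k : PhiC (nfX1 p q h k)
  = nf1a wz wF (phi \o p) (phi \o q) + nf1b wF (phi h) (phi k).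
Proof.
rewrite /nfX1 !nf1bE; apply: PhiCD_eq.
  by apply: PhiC_sum_eq => j; apply: PhiCD_eq; apply: PhiCZ_eq; [apply: cov_wzE | apply: cov_wFE].
apply: PhiCD_eq; last by apply: PhiCZ_eq; apply: cov_wFE.
by apply: esym; apply: PhiC_dF_eq; apply: esym; apply: PhiCZ_eq; apply: PhiC_vac_eq.
Qed.

Lemma Psi_nf1 p q h k : Psi (nf1a wz wF p q + nf1b wF h k)
  = nfX1 (psi \o p) (psi \o q) (psi h) (psi k).
Proof.
rewrite /nfX1 !nf1bE; apply: PsiD_eq.
  by apply: Psi_sum_eq => j; apply: PsiD_eq; apply: PsiZ_eq; [apply: cov_wzE | apply: cov_wFE].
apply: PsiD_eq; last by apply: PsiZ_eq; apply: cov_wFE.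
by apply: Psi_dF_eq; apply: PsiZ_eq; apply: PhiC_vac_eq.
Qed.

Lemma PhiC_nf2 a b p q h : PhiC (nfX2 a b p q h)
  = nf2a wz wF (phi a) (phi b) (phi \o p) + nf2b wz (phi \o q) + nf2c wF (phi h).
Proof.
rewrite /nfX2 !nf2cE; apply: PhiCD_eq; last first.
  by apply: esym; apply: PhiC_dF_eq; apply: esym; apply: PhiCZ_eq; apply: cov_wFE.
apply: PhiCD_eq; last by apply: PhiC_sum_eq => j; apply: PhiCZ_eq; apply: wdzE.
apply: PhiCD_eq; last by apply: PhiC_sum_eq => j; apply: PhiCZ_eq; apply: wdFzE.
apply: PhiCD_eq; apply: PhiCZ_eq; first exact: PhiC_zeta_eq (cov_wzE _).
exact: PhiC_gradf_eq (cov_wFE _).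
Qed.

Lemma Psi_nf2 a b p q h : Psi (nf2a wz wF a b p + nf2b wz q + nf2c wF h)
  = nfX2 (psi a) (psi b) (psi \o p) (psi \o q) (psi h).
Proof.
rewrite /nfX2 !nf2cE; apply: PsiD_eq; last by apply: Psi_dF_eq; apply: PsiZ_eq; apply: cov_wFE.
apply: PsiD_eq; last by apply: Psi_sum_eq => j; apply: PsiZ_eq; apply: wdzE.
apply: PsiD_eq; last by apply: Psi_sum_eq => j; apply: PsiZ_eq; apply: wdFzE.
apply: PsiD_eq; apply: PsiZ_eq; first exact: PhiC_zeta_eq (cov_wzE _).
exact: PhiC_gradf_eq (cov_wFE _).
Qed.

Lemma PhiC_nf3 p q : PhiC (nf3 zR fR p q) = nf3 wz wF (phi \o p) (phi \o q).
Proof.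
apply: PhiC_sum_eq => j; apply: PhiCD_eq; apply: PhiCZ_eq.
  exact: PhiC_zeta_eq (wdzE _).
exact: PhiC_gradf_eq (wdzE _).
Qed.

Lemma Psi_nf3 p q : Psi (nf3 wz wF p q) = nf3 zR fR (psi \o p) (psi \o q).
Proof.
apply: Psi_sum_eq => j; apply: PsiD_eq; apply: PsiZ_eq.
  exact: PhiC_zeta_eq (wdzE _).
exact: PhiC_gradf_eq (wdzE _).
Qed.

End NfBridge.

(** * Weight-zero series as series in f_1 and f_2 *)

Section InvariantSeries.
Variables (K : numFieldType) (im : K).
Hypothesis im2 : im * im = -1.
Local Notation W := (@wvar K).
Local Notation wF := (wfun im).
Implicit Types (Q : {fps K[2]}) (P : {fps K[4]}).

Definition fg_mn (i : 'I_2) : 'X_{1..4} :=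
  if i == ord0 then mn [:: 1; 1; 0; 0]%N else mn [:: 0; 0; 1; 1]%N.
Definition fg (i : 'I_2) : {fps K[4]} := fps_monom K (fg_mn i).

Lemma fg_comb (e : 'X_{1..2}) : mnm_comb fg_mn e = mn [:: e ord0; e ord0; e ord_max; e ord_max].
Proof.
rewrite /mnm_comb; apply/mnmP => i; rewrite mnm_sumE sum2n /fg_mn /= !mulmnE !mnmE.
by move: i; apply: ord4P; rewrite !oE /=; lia.
Qed.

Lemma fg_comb_inj : injective (mnm_comb fg_mn).
Proof.
move=> e e'; rewrite !fg_comb => /eqP; rewrite mn4_inj => /and4P[/eqP e0 _ /eqP e1 _].
by rewrite (mn2P e) (mn2P e') e0 e1.
Qed.

Lemma fg_mn_neq0 i : fg_mn i != 0%MM.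
Proof.
apply/eqP => /mnmP; rewrite /fg_mn; case: ifP => _ E.
  by have := E o0; rewrite !mnmE !oE.
by have := E o2; rewrite !mnmE !oE.
Qed.

Lemma fcoef_subst_fg_notcomb Q m : (forall e, m != mnm_comb fg_mn e) -> fcoef (fps_subst Q fg) m = 0.
Proof. exact: fcoef_subst_notcomb. Qed.

Lemma fcoef_subst_fg_comb Q e : fcoef (fps_subst Q fg) (mnm_comb fg_mn e) = fcoef Q e.
Proof. exact: (fcoef_subst_comb fg_mn_neq0 fg_comb_inj). Qed.

Lemma fg0 i : fcoef (fg i) 0%MM = 0.
Proof. by rewrite /fg /= eq_sym (negbTE (fg_mn_neq0 i)). Qed.

Lemma wF0 j : fcoef (wF j) 0%MM = 0.
Proof.
by rewrite /wfun /wvar; case: ifP => _; rewrite fcoefCM fcoefD ?fcoefN !fcoef0M !fcoef_X0 !(mulr0, oppr0, addr0).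
Qed.

(** With g_1 = w1 w2 and g_2 = v1 v2, f_1 = (g_1 + g_2)/2 and f_2 = - im (g_1 - g_2)/2; [fgN] is the
    inverse g_1 = f_1 + im f_2, g_2 = f_1 - im f_2. *)
Definition fgM (i j : 'I_2) : K :=
  if i == ord0 then 2^-1 else if j == ord0 then - im / 2 else im / 2.
Definition fgN (i j : 'I_2) : K :=
  if j == ord0 then 1 else if i == ord0 then im else - im.

Lemma fgE : (fg ord0 = W o0 * W o1) * (fg ord_max = W o2 * W o3).
Proof.
rewrite /fg /fg_mn /= /wvar !fpsXE -!fps_monomD; split; congr fps_monom;
  by apply/mnmP; apply: ord4P; rewrite mnmDE !mnm1E !mnmE -!val_eqE /= !oE.
Qed.

Lemma wF_fg j : wF j = fps_subst (lin fgM j) fg.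
Proof.
rewrite (fps_subst_lin _ _ fg0) sum2 !fgE /fgM; move: j; apply: ord2P; rewrite /wfun /=.
  by rewrite mulrDr.
by rewrite mulNr rmorphN /= mulNr mulrBr opprB addrC mulNr.
Qed.

Lemma fg_wF j : fg j = fps_subst (lin fgN j) wF.
Proof.
have hh : fpsC 4 2^-1 + fpsC 4 2^-1 = 1 :> {fps K[4]}.
  by rewrite -rmorphD -(rmorph1 (@fpsC 4 K)); congr fpsC; field.
rewrite (fps_subst_lin _ _ wF0) sum2 /fgN; move: j; apply: ord2P; rewrite /wfun /= fgE rmorph1 mul1r;
  set A := W o0 * W o1; set B := W o2 * W o3; rewrite mulrA -rmorphM /=.
  have -> : im * (- im / 2) = 2^-1 by field: im2.
  by rewrite -[LHS]mul1r -hh; ring.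
have -> : - im * (- im / 2) = - 2^-1 by field: im2.
by rewrite rmorphN /= -[LHS]mul1r -hh; ring.
Qed.

Lemma Wt0_subst_wF Q : Wt0 (fps_subst Q wF).
Proof.
have -> : fps_subst Q wF = fps_subst (lsub fgM Q) fg.
  rewrite /lsub fps_subst_comp; [|exact: lin0|exact: fg0].
  by congr fps_subst; apply/funext => j; rewrite wF_fg.
move=> m nwt; apply: fcoef_subst_fg_notcomb => e.
by apply: contraNneq nwt => ->; rewrite fg_comb wt0_mn !eqxx.
Qed.

Lemma Wt0_ex P : Wt0 P -> exists Q, P = fps_subst Q wF.
Proof.
move=> P0; pose Q : {fps K[2]} := Fps (fun e => fcoef P (mnm_comb fg_mn e)).
have PE : P = fps_subst Q fg.
  apply: fpsP => m; have [wt|nwt] := boolP (wt0 m).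
    have -> : m = mnm_comb fg_mn (mn [:: m o0; m o2]).
      by rewrite fg_comb !mnmE /=; move/andP: wt => [/eqP e1 /eqP e2]; rewrite {1}[m]mn4P -e1 -e2.
    by rewrite fcoef_subst_fg_comb.
  rewrite P0 // fcoef_subst_fg_notcomb // => e.
  by apply: contraNneq nwt => ->; rewrite fg_comb wt0_mn !eqxx.
exists (lsub fgN Q); rewrite PE /lsub fps_subst_comp; [|exact: lin0|exact: wF0].
by congr fps_subst; apply/funext => j; rewrite fg_wF.
Qed.

End InvariantSeries.

(** * Descent of the coefficient series *)

Section Descent.
Variables (R : realType) (K : numFieldType) (im : K).
Hypothesis im2 : im * im = -1.
Variables (c : {rmorphism R -> K}) (r : {additive K -> R}).
Hypothesis rM : forall a b, r (c a * b) = a * r b.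
Hypothesis r1 : r 1 = 1.
Local Notation phi := (phi im c).
Local Notation psi := (psi im r).
Local Notation Phi := (Phi im c).
Local Notation Psi := (Psi im r).
Implicit Types (p : {fps R[4]}) (P : {fps K[4]}).

Lemma in_RfE p : in_Rf p <-> exists Q : {fps R[2]}, p = fps_subst Q (fR R).
Proof. by []. Qed.

Lemma fR0 j : fcoef (fR R j) 0%MM = 0.
Proof.
rewrite /fR /f1 /f2 /x1 /x2 /x3 /x4 /x; case: ifP => _.
  by rewrite fcoefB fcoefD fcoefB !expr2 !fcoef0M !fcoef_X0 !mulr0 subr0 addr0 subr0.
by rewrite fcoef0M [X in _ * X]fcoefD !fcoef0M !fcoef_X0 !mulr0 addr0 mulr0.
Qed.

Lemma Wt0_phi p : in_Rf p -> Wt0 (phi p).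
Proof.
case/in_RfE => Q ->; rewrite /phi fps_map_subst /lsub fps_subst_comp; last exact: lin0.
  rewrite (_ : (fun i => _) = wfun im); first exact: Wt0_subst_wF.
  by apply/funext => j; rewrite -(phi_f im2 c).
by move=> i; rewrite /= fR0 raddf0.
Qed.

(** f_1 and f_2 are real, so taking real parts acts on the coefficients of the series substituted
    into. *)
Lemma in_Rf_psi P : Wt0 P -> in_Rf (psi P).
Proof.
case/(Wt0_ex im2) => Q ->; apply/in_RfE; exists (fps_map r Q).
rewrite /psi /lsub fps_subst_comp; [|exact: wF0|exact: lin0].
rewrite -(fps_proj_subst rM); congr (fps_map r (fps_subst Q _)); apply/funext => j.
by rewrite -(phi_f im2 c) -/(lsub _ _) /phi (lsubK (xMN im2)).
Qed.

Lemma phi_hR (P : 'I_4 -> {fps R[2]}) : phi (hR P) = hW im (fun i => fps_map c (P i)).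
Proof.
rewrite /hW /phi; congr lsub; rewrite /hR raddf_sum; apply: eq_bigr => i _ /=.
rewrite rmorphM /= fps_mapX; congr (_ * _); rewrite /Rx fps_map_subst.
by congr fps_subst; apply/funext => j; case: ifP => _; rewrite ?rmorphXn /= fps_mapX.
Qed.

Lemma psi_hW (P : 'I_4 -> {fps K[2]}) : psi (hW im P) = hR (fun i => fps_map r (P i)).
Proof.
rewrite /hW /psi (lsubK (xMN im2)) /hR raddf_sum; apply: eq_bigr => i _ /=.
rewrite -(fps_mapX c) mulrC (fps_projM rM) mulrC; congr (_ * _); rewrite /Rx -(fps_proj_subst rM).
congr (fps_map r (fps_subst _ _)).
by apply/funext => j; case: ifP => _; rewrite ?rmorphXn /= fps_mapX.
Qed.

End Descent.

(** * The homology groups *)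

Section UniqueRep.
Variable R : realType.

Lemma deltaB (u v : dform 4 R) : delta (u - v) = delta u - delta v.
Proof.
have E a b : toF (a - b) = toF a - toF b :> cform 4 R by exact: raddfB.
pose D (u : cform 4 R) := interior (@B_ R) (interior (@A_ R) (dF u))
  - dF (interior (@B_ R) (interior (@A_ R) u)).
apply: toF_inj; apply: etrans (toF_delta _) _; apply: etrans (congr1 D (E u v)) _.
apply: etrans _ (esym (E _ _)).
apply: etrans _ (esym (congr2 (fun a b => a - b) (toF_delta u) (toF_delta v))).
rewrite /D; move: (toF u) (toF v) => u' v'.
have alg (a b d e : cform 4 R) : a - b - (d - e) = a - d - (b - e).
  by rewrite !opprB !addrA [LHS]addrAC [a - b - d]addrAC [LHS]addrAC.
pose I (u : cform 4 R) := interior (@B_ R) (interior (@A_ R) u).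
have iB a b : I (a - b) = I a - I b by rewrite /I !raddfB.
have dB a b : dF (a - b) = dF a - dF b :> cform 4 R by exact: raddfB.
have e1 : I (dF (u' - v')) = I (dF u') - I (dF v') by rewrite dB iB.
have e2 : dF (I (u' - v')) = dF (I u') - dF (I v') by rewrite iB dB.
by apply: etrans (congr2 (fun a b => a - b) e1 e2) _; apply: alg.
Qed.

Lemma is_boundaryB k (u v : dform 4 R) : is_boundary k u -> is_boundary k v -> is_boundary k (u - v).
Proof.
move=> [u' u'k ->] [v' v'k ->]; exists (u' - v'); last by rewrite deltaB.
have E a b : toF (a - b) = toF a - toF b :> cform 4 R by exact: raddfB.
move/is_formE: u'k => u'k; move/is_formE: v'k => v'k; apply/is_formE; rewrite E => S Sk.
by rewrite fcB u'k // v'k // subr0.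
Qed.

(** Two representatives of one class differ from the same cycle by boundaries, so uniqueness only
    concerns differences of normal forms. *)
Lemma unique_representativesI k (T : Type) (adm : T -> Prop) (nf : T -> dform 4 R) :
    (forall t, adm t -> is_cycle k (nf t)) ->
    (forall w, is_cycle k w -> exists2 t, adm t & is_boundary k (nf t - w)) ->
    (forall t t', adm t -> adm t' -> is_boundary k (nf t - nf t') -> t = t') ->
  unique_representatives k adm nf.
Proof.
move=> cyc ex un; split=> // C [w wc ->]; have [t ta tb] := ex w wc.
exists t; split=> // t' [t'a t'b]; apply: un => //.
have alg (a b d : dform 4 R) : a - d - (b - d) = a - b by rewrite opprB addrA subrK.
by rewrite -(alg _ _ w); apply: is_boundaryB.
Qed.

End UniqueRep.

(** * Additivity of the representatives in their coefficients *)

Section Differences.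
Variables (T : comNzRingType) (z : 'I_2 -> 'I_4 -> {fps T[4]}) (F : 'I_2 -> {fps T[4]}).
Implicit Types (p q : 'I_2 -> {fps T[4]}) (a b h k : {fps T[4]}).

Lemma sum_combB n (p p' : 'I_n -> {fps T[4]}) (e : 'I_n -> cform 4 T) :
  \sum_j p j *: e j - \sum_j p' j *: e j = \sum_j (p j - p' j) *: e j.
Proof. by rewrite -sumrB; apply: eq_bigr => j _; rewrite scalerBl. Qed.

Lemma sum_comb2B n (p p' q q' : 'I_n -> {fps T[4]}) (e e' : 'I_n -> cform 4 T) :
  \sum_j (p j *: e j + q j *: e' j) - \sum_j (p' j *: e j + q' j *: e' j)
   = \sum_j ((p j - p' j) *: e j + (q j - q' j) *: e' j).
Proof. by rewrite -sumrB; apply: eq_bigr => j _; rewrite !scalerBl opprD addrACA. Qed.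

Lemma subrD_eq (u v u' v' a b : cform 4 T) :
  u - u' = a -> v - v' = b -> u + v - (u' + v') = a + b.
Proof. by move=> <- <-; rewrite opprD addrACA. Qed.

Lemma dF_subZ h h' (e : cform 4 T) : dF (h *: e) - dF (h' *: e) = dF ((h - h') *: e).
Proof. by rewrite scalerBl raddfB. Qed.

Lemma nf1B p q h k p' q' h' k' :
  nf1a z F p q + nf1b F h k - (nf1a z F p' q' + nf1b F h' k')
   = nf1a z F (fun j => p j - p' j) (fun j => q j - q' j) + nf1b F (h - h') (k - k').
Proof.
rewrite !nf1bE; apply: subrD_eq; first exact: sum_comb2B.
by apply: subrD_eq; [exact: dF_subZ | exact: esym (scalerBl _ _ _)].
Qed.

Lemma nf2B a b p q h a' b' p' q' h' :
  nf2a z F a b p + nf2b z q + nf2c F h - (nf2a z F a' b' p' + nf2b z q' + nf2c F h')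
   = nf2a z F (a - a') (b - b') (fun j => p j - p' j) + nf2b z (fun j => q j - q' j)
     + nf2c F (h - h').
Proof.
rewrite !nf2cE; apply: subrD_eq; last exact: dF_subZ.
apply: subrD_eq; last exact: sum_combB.
apply: subrD_eq; last exact: sum_combB.
by apply: subrD_eq; exact: esym (scalerBl _ _ _).
Qed.

Lemma nf3B p q p' q' :
  nf3 z F p q - nf3 z F p' q' = nf3 z F (fun j => p j - p' j) (fun j => q j - q' j).
Proof. exact: sum_comb2B. Qed.

End Differences.

(** * Existence and uniqueness in each degree *)

Section Main.
Variables (R : realType) (K : numFieldType) (im : K).
Hypothesis im2 : im * im = -1.
Variables (c : {rmorphism R -> K}) (r : {additive K -> R}).
Hypothesis rM : forall a b, r (c a * b) = a * r b.
Hypothesis r1 : r 1 = 1.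
Local Notation phi := (phi im c).
Local Notation psi := (psi im r).
Local Notation Phi := (Phi im c).
Local Notation PhiC := (PhiC im c).
Local Notation Psi := (Psi im r).
Local Notation vac := (vacuum 4 K).
Local Notation wz := (wzeta im).
Local Notation wF := (wfun im).
Local Notation hW := (hW im).
Local Notation wdelta := (log_delta (wA im) (@wB K)).
Implicit Types (p : {fps R[4]}) (w : dform 4 R).

Lemma cycleI k w : deg_form k (Phi w) -> wdelta (Phi w) = 0 -> is_cycle k w.
Proof.
move=> wk w0; split; last exact/(cycle_iff im2 rM r1).
have -> : w = ofF (Psi (Phi w)) by rewrite (PsiK im2 rM r1); apply: toF_inj; rewrite ofFK.
exact: deg_Psi.
Qed.

Lemma log_deltaD (u v : cform 4 K) : wdelta (u + v) = wdelta u + wdelta v.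
Proof. by have := log_deltaB im (u + v) v; rewrite addrK => ->; rewrite subrK. Qed.

Lemma spec_diff k w w' N N' : is_boundary k (w - w') -> Phi w = N -> Phi w' = N' ->
  spec0 im (N - N').
Proof. by move=> bd <- <-; have := spec_of_boundary im2 c bd; rewrite raddfB. Qed.

Lemma phi_inj p p' : phi p - phi p' = 0 -> p = p'.
Proof. by move/subr0_eq => e; rewrite -(psiK im2 rM r1 p) e (psiK im2 rM r1). Qed.

Lemma map_inj n (f g : {fps R[n]}) : fps_map c f - fps_map c g = 0 -> f = g.
Proof.
move/subr0_eq => e; apply: fpsP => m; apply: (fmorph_inj c).
by have := congr1 (fun h => fcoef h m) e.
Qed.

Lemma in_RxE (a : 'I_4 -> {fps R[4]}) : (forall i, in_Rx (a i)) ->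
  exists P : 'I_4 -> {fps R[2]}, forall i, a i = Rx (P i).
Proof. by move=> aR; exists (fun i => projT1 (cid (aR i))) => i; case: (cid (aR i)). Qed.

Lemma sum_hR (a : 'I_4 -> {fps R[4]}) (P : 'I_4 -> {fps R[2]}) :
  (forall i, a i = Rx (P i)) -> \sum_i a i * x i = hR P.
Proof. by move=> aE; apply: eq_bigr => i _; rewrite aE. Qed.

Lemma ex_nf0 (p : {fps R[4]}) (a : {ffun 'I_4 -> {fps R[4]}}) : in_Rf p -> (forall i, in_Rx (a i)) ->
  exists2 P : 'I_4 -> {fps R[2]}, forall i, a i = Rx (P i) &
  Phi (form0 (p + \sum_i a i * x i)) = (phi p + hW (fun i => fps_map c (P i))) *: vac.
Proof.
move=> pR /in_RxE[P aE]; exists P => //.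
by rewrite PhiE toF_form0 PhiCZ PhiC_vac (sum_hR aE) raddfD /= phi_hR.
Qed.

Lemma unique_representatives_H0 : unique_representatives 0
    (fun t : {fps R[4]} * {ffun 'I_4 -> {fps R[4]}} =>
       let: (p, a) := t in in_Rf p /\ forall i, in_Rx (a i))
    (fun t => let: (p, a) := t in form0 (p + \sum_i a i * x i)).
Proof.
apply: unique_representativesI => [[p a] [pR aR]|w [wk w0]|[p a] [p' a'] [pR aR] [p'R a'R] bd].
- have [P _ E] := ex_nf0 pR aR.
  have d0 : deg_form 0 (Phi (form0 (p + \sum_i a i * x i))) by rewrite E; apply/deg_formZ/deg_vac.
  by apply: cycleI => //; apply: deg0_cycle.
- have [f [P [f0 sp]]] := exist0 im2 (deg_Phi im c wk).
  exists (psi f, [ffun i => Rx (fps_map r (P i))]).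
    split; first exact: (in_Rf_psi im2 rM f0).
    by move=> i; rewrite ffunE; exists (fps_map r (P i)).
  have d0 : deg_form 0 ((f + hW P) *: vac) by apply/deg_formZ/deg_vac.
  apply: (boundary_of_spec im2 rM r1 wk w0 d0 (deg0_cycle im d0) sp).
  have e1 := PsiZ_eq im2 rM (f + hW P) (PhiC_vac_eq im c).
  apply: etrans e1 _.
  by rewrite toF_form0 raddfD /= (psi_hW im2 rM) (sum_hR (fun i => ffunE _ i)).
have [P aE E] := ex_nf0 pR aR; have [P' a'E E'] := ex_nf0 p'R a'R.
have := spec_diff bd E E'; rewrite -scalerBl.
rewrite opprD addrACA (hW_sub im).
case/(uniq0 im2); first by move=> m nwt; rewrite fcoefB !(Wt0_phi im2 c) ?subrr.
move=> /phi_inj -> P0; congr (_, _); apply/ffunP => i; rewrite aE a'E.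
by congr Rx; apply: map_inj; apply: P0.
Qed.

Lemma ffun_psi n (P : 'I_n -> {fps K[4]}) :
  fun_of_fin [ffun i => psi (P i)] = psi \o P.
Proof. by apply/funext => j; rewrite ffunE. Qed.

Lemma sum_ffun_hR (P : 'I_4 -> {fps K[2]}) :
  \sum_i [ffun i => Rx (fps_map r (P i))] i * x i = psi (hW P) :> {fps R[4]}.
Proof. by rewrite (sum_hR (fun i => ffunE _ i)) (psi_hW im2 rM). Qed.

Lemma in_Rx_ffun (P : 'I_4 -> {fps K[2]}) i : in_Rx ([ffun i => Rx (fps_map r (P i))] i : {fps R[4]}).
Proof. by rewrite ffunE; exists (fps_map r (P i)). Qed.

Lemma in_Rf_ffun n (P : 'I_n -> {fps K[4]}) j : (forall j, Wt0 (P j)) ->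
  in_Rf ([ffun i => psi (P i)] j).
Proof. by move=> P0; rewrite ffunE; apply: (in_Rf_psi im2 rM). Qed.

Lemma Wt0_phiB p p' : in_Rf p -> in_Rf p' -> Wt0 (phi p - phi p').
Proof. by move=> pR p'R m nwt; rewrite fcoefB !(Wt0_phi im2 c) ?subrr. Qed.

Lemma ffun_phi_inj n (p p' : {ffun 'I_n -> {fps R[4]}}) :
  (forall j, (phi \o p) j - (phi \o p') j = 0) -> p = p'.
Proof. by move=> E; apply/ffunP => j; apply: phi_inj; apply: E. Qed.

Lemma ffun_Rx_inj (a a' : {ffun 'I_4 -> {fps R[4]}}) P P' :
  (forall i, a i = Rx (P i)) -> (forall i, a' i = Rx (P' i)) ->
  (forall i, fps_map c (P i) - fps_map c (P' i) = 0) -> a = a'.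
Proof.
by move=> aE a'E E; apply/ffunP => i; rewrite aE a'E; congr Rx; apply: map_inj; apply: E.
Qed.

Lemma ex_nf1 (p q : {ffun 'I_2 -> {fps R[4]}}) (a b : {ffun 'I_4 -> {fps R[4]}}) P Q :
  (forall i, a i = Rx (P i)) -> (forall i, b i = Rx (Q i)) ->
  Phi (\sum_j (p j *: zeta j + q j *: df j)
       + \sum_i (dR (form0 (a i * x i)) + (b i * x i) *: df1))
  = nf1a wz wF (phi \o p) (phi \o q)
    + nf1b wF (hW (fun i => fps_map c (P i))) (hW (fun i => fps_map c (Q i))).
Proof.
move=> aE bE; apply: etrans (congr1 PhiC (toF_nf1 p q a b)) _.
by rewrite PhiC_nf1 // (sum_hR aE) (sum_hR bE) !phi_hR.
Qed.

Lemma unique_representatives_H1 : unique_representatives 1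
    (fun t : {ffun 'I_2 -> {fps R[4]}} * {ffun 'I_2 -> {fps R[4]}} *
             {ffun 'I_4 -> {fps R[4]}} * {ffun 'I_4 -> {fps R[4]}} =>
       let: (p, q, a, b) := t in
       (forall j, in_Rf (p j) /\ in_Rf (q j)) /\
       (forall i, in_Rx (a i) /\ in_Rx (b i)))
    (fun t => let: (p, q, a, b) := t in
       \sum_j (p j *: zeta j + q j *: df j)
       + \sum_i (dR (form0 (a i * x i)) + (b i * x i) *: df1)).
Proof.
apply: unique_representativesI => [[[[p q] a] b] [pqR abR]|w [wk w0]
  |[[[p q] a] b] [[[p' q'] a'] b'] [pqR abR] [pqR' abR'] bd].
- have [P aE] := in_RxE (fun i => (abR i).1); have [Q bE] := in_RxE (fun i => (abR i).2).
  have E := ex_nf1 p q aE bE.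
  apply: cycleI; rewrite E; first by apply: deg_formD; [apply: nf1a_deg | apply: nf1b_deg].
  rewrite log_deltaD nf1b_cycle addr0; apply: wtform_cycle => //.
  by apply: nf1a_wt => j; apply: (Wt0_phi im2); case: (pqR j).
- have [p [q [P [Q [p0 q0 sp]]]]] := exist1 im2 (deg_Phi im c wk).
  exists ([ffun i => psi (p i)], [ffun i => psi (q i)],
          [ffun i => Rx (fps_map r (P i))], [ffun i => Rx (fps_map r (Q i))]).
    by split=> i; split; (exact: in_Rf_ffun) || exact: in_Rx_ffun.
  have d1 : deg_form 1 (nf1a wz wF p q + nf1b wF (hW P) (hW Q)).
    by apply: deg_formD; [apply: nf1a_deg | apply: nf1b_deg].
  have c1 : wdelta (nf1a wz wF p q + nf1b wF (hW P) (hW Q)) = 0.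
    by rewrite log_deltaD nf1b_cycle addr0; apply: wtform_cycle => //; apply: nf1a_wt.
  apply: (boundary_of_spec im2 rM r1 wk w0 d1 c1 sp).
  apply: etrans (Psi_nf1 im2 rM _ _ _ _) _; apply: esym; apply: etrans (toF_nf1 _ _ _ _) _.
  by rewrite !ffun_psi !sum_ffun_hR.
have [P aE] := in_RxE (fun i => (abR i).1); have [Q bE] := in_RxE (fun i => (abR i).2).
have [P' aE'] := in_RxE (fun i => (abR' i).1); have [Q' bE'] := in_RxE (fun i => (abR' i).2).
have := spec_diff bd (ex_nf1 p q aE bE) (ex_nf1 p' q' aE' bE').
rewrite nf1B !hW_sub; case/(uniq1 im2) => [j|j|pz qz Pz Qz].
- by apply: Wt0_phiB; [case: (pqR j) | case: (pqR' j)].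
- by apply: Wt0_phiB; [case: (pqR j) | case: (pqR' j)].
by rewrite (ffun_phi_inj pz) (ffun_phi_inj qz) (ffun_Rx_inj aE aE' Pz) (ffun_Rx_inj bE bE' Qz).
Qed.

Lemma ex_nf2 (p0 q0 : {fps R[4]}) (p q : {ffun 'I_2 -> {fps R[4]}})
    (a : {ffun 'I_4 -> {fps R[4]}}) P : (forall i, a i = Rx (P i)) ->
  Phi (p0 *: (zeta1 ∧ zeta2) + q0 *: (df1 ∧ df2)
       + \sum_j (p j *: dR (f1 *: zeta j) + q j *: dR (zeta j))
       + \sum_i dR (form0 (a i * x i)) ∧ df1)
  = nf2a wz wF (phi p0) (phi q0) (phi \o p) + nf2b wz (phi \o q)
    + nf2c wF (hW (fun i => fps_map c (P i))).
Proof.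
move=> aE; apply: etrans (congr1 PhiC (toF_nf2 p0 q0 p q a)) _.
by rewrite PhiC_nf2 // (sum_hR aE) !phi_hR.
Qed.

Lemma nf2_deg a b (p q : 'I_2 -> {fps K[4]}) h : deg_form 2 (nf2a wz wF a b p + nf2b wz q + nf2c wF h).
Proof.
by apply: deg_formD; [apply: deg_formD; [apply: nf2a_deg | apply: nf2b_deg] | apply: nf2c_deg].
Qed.

Lemma nf2_cycle a b (p q : 'I_2 -> {fps K[4]}) h : Wt0 a -> Wt0 b -> (forall j, Wt0 (p j)) -> (forall j, Wt0 (q j)) ->
  wdelta (nf2a wz wF a b p + nf2b wz q + nf2c wF h) = 0.
Proof.
move=> a0 b0 p0 q0; rewrite log_deltaD nf2c_cycle addr0; apply: wtform_cycle => //.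
by apply: wtformD; [apply: nf2a_wt | apply: nf2b_wt].
Qed.

Lemma unique_representatives_H2 : unique_representatives 2
    (fun t : {fps R[4]} * {fps R[4]} *
             {ffun 'I_2 -> {fps R[4]}} * {ffun 'I_2 -> {fps R[4]}} *
             {ffun 'I_4 -> {fps R[4]}} =>
       let: (p0, q0, p, q, a) := t in
       [/\ in_Rf p0, in_Rf q0,
           forall j, in_Rf (p j) /\ in_Rf (q j)
         & forall i, in_Rx (a i)])
    (fun t => let: (p0, q0, p, q, a) := t in
       p0 *: (zeta1 ∧ zeta2) + q0 *: (df1 ∧ df2)
       + \sum_j (p j *: dR (f1 *: zeta j) + q j *: dR (zeta j))
       + \sum_i dR (form0 (a i * x i)) ∧ df1).
Proof.
apply: unique_representativesI => [[[[[p0 q0] p] q] a] [p0R q0R pqR aR]|w [wk w0]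
  |[[[[p0 q0] p] q] a] [[[[p0' q0'] p'] q'] a'] [p0R q0R pqR aR] [p0R' q0R' pqR' aR'] bd].
- have [P aE] := in_RxE aR; have E := ex_nf2 p0 q0 p q aE.
  apply: cycleI; rewrite E; first exact: nf2_deg.
  by apply: nf2_cycle => [||j|j]; apply: (Wt0_phi im2) => //; case: (pqR j).
- have [a [b [p [q [P [[a0 b0] p0 q0 sp]]]]]] := exist2 im2 (deg_Phi im c wk).
  exists (psi a, psi b, [ffun i => psi (p i)], [ffun i => psi (q i)],
          [ffun i => Rx (fps_map r (P i))]).
    by split=> [||i|i]; try split; first [exact: (in_Rf_psi im2 rM) | exact: in_Rf_ffun | exact: in_Rx_ffun].
  apply: (boundary_of_spec im2 rM r1 wk w0 (nf2_deg _ _ _ _ _) (nf2_cycle _ a0 b0 p0 q0) sp).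
  apply: etrans (Psi_nf2 im2 rM _ _ _ _ _) _; apply: esym; apply: etrans (toF_nf2 _ _ _ _ _) _.
  by rewrite !ffun_psi sum_ffun_hR.
have [P aE] := in_RxE aR; have [P' aE'] := in_RxE aR'.
have := spec_diff bd (ex_nf2 p0 q0 p q aE) (ex_nf2 p0' q0' p' q' aE').
rewrite nf2B hW_sub; case/(uniq2 im2) => [||j|j|[az bz] pz qz Pz]; try exact: Wt0_phiB.
- by apply: Wt0_phiB; [case: (pqR j) | case: (pqR' j)].
- by apply: Wt0_phiB; [case: (pqR j) | case: (pqR' j)].
by rewrite (phi_inj az) (phi_inj bz) (ffun_phi_inj pz) (ffun_phi_inj qz) (ffun_Rx_inj aE aE' Pz).
Qed.

Lemma ex_nf3 (p q : {ffun 'I_2 -> {fps R[4]}}) :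
  Phi (\sum_j (p j *: (zeta2 ∧ dR (zeta j)) + q j *: (df1 ∧ dR (zeta j))))
  = nf3 wz wF (phi \o p) (phi \o q).
Proof. by apply: etrans (congr1 PhiC (toF_nf3 p q)) _; apply: PhiC_nf3. Qed.

Lemma unique_representatives_H3 : unique_representatives 3
    (fun t : {ffun 'I_2 -> {fps R[4]}} * {ffun 'I_2 -> {fps R[4]}} =>
       let: (p, q) := t in forall j, in_Rf (p j) /\ in_Rf (q j))
    (fun t => let: (p, q) := t in
       \sum_j (p j *: (zeta2 ∧ dR (zeta j)) + q j *: (df1 ∧ dR (zeta j)))).
Proof.
have cyc (p q : 'I_2 -> {fps K[4]}) : (forall j, Wt0 (p j)) -> (forall j, Wt0 (q j)) ->
    wdelta (nf3 wz wF p q) = 0.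
  by move=> p0 q0; apply: wtform_cycle => //; apply: nf3_wt.
apply: unique_representativesI => [[p q] pqR|w [wk w0]|[p q] [p' q'] pqR pqR' bd].
- apply: cycleI; rewrite ex_nf3; first exact: nf3_deg.
  by apply: cyc => j; apply: (Wt0_phi im2); case: (pqR j).
- have [p [q [p0 q0 sp]]] := exist3 im2 (deg_Phi im c wk).
  exists ([ffun i => psi (p i)], [ffun i => psi (q i)]); first by split; exact: in_Rf_ffun.
  apply: (boundary_of_spec im2 rM r1 wk w0 (nf3_deg _ _ _) (cyc _ _ p0 q0) sp).
  apply: etrans (Psi_nf3 im2 rM _ _) _; apply: esym; apply: etrans (toF_nf3 _ _) _.
  by rewrite !ffun_psi.
have := spec_diff bd (ex_nf3 p q) (ex_nf3 p' q').
rewrite nf3B; case/(uniq3 im2) => [j|j|pz qz].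
- by apply: Wt0_phiB; [case: (pqR j) | case: (pqR' j)].
- by apply: Wt0_phiB; [case: (pqR j) | case: (pqR' j)].
by rewrite (ffun_phi_inj pz) (ffun_phi_inj qz).
Qed.

Lemma toF_mu : toF (mu : dform 4 R) = dxw o0 (dxw o1 (dxw o2 (dxw o3 (vacuum 4 R)))).
Proof.
apply: etrans (toF_dxw _ _) _; congr (dxw _ _); apply: etrans (toF_dxw _ _) _; congr (dxw _ _).
by apply: etrans (toF_dxw _ _) _; congr (dxw _ _); apply: toF_dx.
Qed.

(** The determinant of four covectors, by Laplace expansion along complementary 2x2 minors. *)
Lemma cov4_top (a b g e : 'I_4 -> {fps K[4]}) :
  fc (cov a (cov b (cov g (cov e vac)))) (set4 true true true true)
   = (a o0 * b o1 - a o1 * b o0) * (g o2 * e o3 - g o3 * e o2)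
   - (a o0 * b o2 - a o2 * b o0) * (g o1 * e o3 - g o3 * e o1)
   + (a o0 * b o3 - a o3 * b o0) * (g o1 * e o2 - g o2 * e o1)
   + (a o1 * b o2 - a o2 * b o1) * (g o0 * e o3 - g o3 * e o0)
   - (a o1 * b o3 - a o3 * b o1) * (g o0 * e o2 - g o2 * e o0)
   + (a o2 * b o3 - a o3 * b o2) * (g o0 * e o1 - g o1 * e o0).
Proof.
have [<- <- <- [<- <- <-]] := cov2_fc g e; move: (cov g _) => u.
by rewrite /s01 /s02 /s03 /s12 /s13 /s23 cov_set4 !cov_set4 /=; ring.
Qed.

Lemma Phi_mu : exists2 d : K, d != 0 & fc (Phi mu) setT = fpsC 4 d.
Proof.
(* The determinant of [xM]. *)
exists 16^-1; first by rewrite invr_eq0 Num.Theory.pnatr_eq0.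
rewrite PhiE toF_mu PhiCE !fmap_dxw fmap_vac !pull_dxw pull_vac set4_full cov4_top.
rewrite /dlin -!rmorphM -!rmorphB -!rmorphM /= -?rmorphB -?rmorphD -?rmorphB -?rmorphD; congr fpsC.
by rewrite /xM !oE /=; field: im2.
Qed.

(** There are no nonzero 5-forms in four variables. *)
Lemma H4_boundary w : is_boundary 4 w <-> w = 0.
Proof.
have d0 : delta 0 = 0 :> dform 4 R by have := deltaB (0 : dform 4 R) 0; rewrite !subrr.
split=> [[v vk ->]|->]; last by exists 0 => // S _; rewrite ffunE.
have -> : v = 0; last exact: d0.
apply/ffunP => S; rewrite ffunE; apply: vk; rewrite neq_ltn.
by rewrite (leq_ltn_trans (max_card _)) // card_ord.
Qed.

Lemma H4_cycle w : is_cycle 4 w <-> exists2 p, in_Rf p & w = p *: mu.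
Proof.
have [d nz dE] := Phi_mu.
have fcE p : fc (Phi (p *: mu)) setT = fpsC 4 d * phi p.
  by rewrite PhiE toFZ PhiCZ fcZ -PhiE dE mulrC.
have mu4 : is_form 4 (mu : dform 4 R).
  apply/is_formE; rewrite toF_mu; do 4!apply: deg_dxw; exact: deg_vac.
have wt_iff p : Wt0 (fc (Phi (p *: mu)) setT) <-> Wt0 (phi p).
  rewrite fcE; split=> [E m /E|]; last exact: Wt0CM.
  by rewrite fcoefCM => /eqP; rewrite mulf_eq0 (negbTE nz) => /eqP.
have form4 p : is_form 4 (p *: mu : dform 4 R).
  by apply/is_formE; rewrite toFZ; apply: deg_formZ; apply/is_formE.
split=> [[wk w0]|[p pR ->]].
  have wE : w = w setT *: mu by rewrite muE; apply: top_form.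
  exists (w setT) => //; rewrite -(psiK im2 rM r1 (w setT)); apply: (in_Rf_psi im2 rM).
  apply/wt_iff; rewrite -wE; apply/(top_cycle im2 (deg_Phi im c wk)).
  exact/(cycle_iff im2 rM r1).
apply: cycleI; first exact: deg_Phi.
apply/(top_cycle im2); first exact: deg_Phi.
by apply/wt_iff; apply: Wt0_phi.
Qed.

End Main.

(** * The case K = R[i] with the real part as projection *)

Section RealPart.
Variable R : realType.

Definition re_part (z : R[i]) : R := complex.Re z.

Lemma re_part_zmod : zmod_morphism re_part.
Proof. by move=> [a b] [a' b']. Qed.

HB.instance Definition _ := GRing.isZmodMorphism.Build R[i] R re_part re_part_zmod.

Lemma re_partM (a : R) (z : R[i]) : re_part (real_complex R a * z) = a * re_part z.
Proof. by case: z => b b'; rewrite /re_part /= mul0r subr0. Qed.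

Lemma imag_sq : ('i%C : R[i]) * 'i%C = -1.
Proof. by rewrite -expr2 sqr_i. Qed.

End RealPart.

Theorem theorem1p2 (R : realType) :
  (* H_0 *)
  unique_representatives 0
    (fun t : {fps R[4]} * {ffun 'I_4 -> {fps R[4]}} =>
       let: (p, a) := t in in_Rf p /\ forall i, in_Rx (a i))
    (fun t => let: (p, a) := t in form0 (p + \sum_i a i * x i))
  /\
  (* H_1 *)
  unique_representatives 1
    (fun t : {ffun 'I_2 -> {fps R[4]}} * {ffun 'I_2 -> {fps R[4]}} *
             {ffun 'I_4 -> {fps R[4]}} * {ffun 'I_4 -> {fps R[4]}} =>
       let: (p, q, a, b) := t in
       (forall j, in_Rf (p j) /\ in_Rf (q j)) /\
       (forall i, in_Rx (a i) /\ in_Rx (b i)))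
    (fun t => let: (p, q, a, b) := t in
       \sum_j (p j *: zeta j + q j *: df j)
       + \sum_i (dR (form0 (a i * x i)) + (b i * x i) *: df1))
  /\
  (* H_2 *)
  unique_representatives 2
    (fun t : {fps R[4]} * {fps R[4]} *
             {ffun 'I_2 -> {fps R[4]}} * {ffun 'I_2 -> {fps R[4]}} *
             {ffun 'I_4 -> {fps R[4]}} =>
       let: (p0, q0, p, q, a) := t in
       [/\ in_Rf p0, in_Rf q0,
           forall j, in_Rf (p j) /\ in_Rf (q j)
         & forall i, in_Rx (a i)])
    (fun t => let: (p0, q0, p, q, a) := t in
       p0 *: (zeta1 ∧ zeta2) + q0 *: (df1 ∧ df2)
       + \sum_j (p j *: dR (f1 *: zeta j) + q j *: dR (zeta j))
       + \sum_i dR (form0 (a i * x i)) ∧ df1)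
  /\
  (* H_3 *)
  unique_representatives 3
    (fun t : {ffun 'I_2 -> {fps R[4]}} * {ffun 'I_2 -> {fps R[4]}} =>
       let: (p, q) := t in forall j, in_Rf (p j) /\ in_Rf (q j))
    (fun t => let: (p, q) := t in
       \sum_j (p j *: (zeta2 ∧ dR (zeta j)) + q j *: (df1 ∧ dR (zeta j))))
  /\
  (* H_4 : there are no boundaries, and the cycles are R[[f_1, f_2]] mu. *)
  ((forall w : dform 4 R, is_boundary 4 w <-> w = 0) /\
   (forall w : dform 4 R, is_cycle 4 w <-> exists2 p, in_Rf p & w = p *: mu)).
Proof.
have rM := @re_partM R; have r1 : @re_part R 1 = 1 by [].
have i2 := @imag_sq R.
split; first exact: (unique_representatives_H0 i2 rM r1).
split; first exact: (unique_representatives_H1 i2 rM r1).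
split; first exact: (unique_representatives_H2 i2 rM r1).
split; first exact: (unique_representatives_H3 i2 rM r1).
split; first exact: H4_boundary.
exact: (H4_cycle i2 rM r1).
Qed.
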